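(* Let $\Bbbk$ be a field, let $B$ be a pointed bialgebra over $\Bbbk$, and let $\operatorname{gr}B$ be its coradically graded version. Then there exist a unique quiver $Q$ and a unique graded bialgebra structure on the path coalgebra $\Bbbk Q$ such that $\operatorname{gr}B$ can be realized as a sub-bialgebra of $\Bbbk Q$ with $\Bbbk Q_0\oplus\Bbbk Q_1\subseteq\operatorname{gr}B$.
   Context: A quiver is a quadruple $Q=(Q_0,Q_1,s,t)$ where $Q_0$ is the set of vertices, $Q_1$ the set of arrows (both possibly infinite), and $s,t:Q_1\to Q_0$ are the source and target maps. Vertices are trivial paths of length $0$; a path of length $n\ge1$ is $p=a_n\cdots a_1$ with $a_i\in Q_1$ and $s(a_{i+1})=t(a_i)$ for $i=1,\dots,n-1$. $Q_n$ denotes the set of paths of length $n$ and $\Bbbk Q_n$ its $\Bbbk$-span. The path coalgebra $\Bbbk Q=\bigoplus_{n\ge0}\Bbbk Q_n$ has basis all paths, with $\Delta(g)=g\otimes g$, $\varepsilon(g)=1$ for $g\in Q_0$, and for a nontrivial path $p=a_n\cdots a_1$, $$\Delta(p)=t(a_n)\otimes p+\sum_{i=1}^{n-1}a_n\cdots a_{i+1}\otimes a_i\cdots a_1+p\otimes s(a_1),\qquad\varepsilon(p)=0.$$ A graded bialgebra structure on $\Bbbk Q$ is a multiplication and unit on $\Bbbk Q$ making it, with this coalgebra structure, a bialgebra such that the multiplication respects the length grading: $\Bbbk Q_m\cdot\Bbbk Q_n\subseteq\Bbbk Q_{m+n}$, with the unit in $\Bbbk Q_0$. A bialgebra is pointed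 if all its simple subcoalgebras are one-dimensional. For a pointed bialgebra $B$ with coradical filtration $\{B_i\}_{i\ge0}$, $\operatorname{gr}B=B_0\oplus B_1/B_0\oplus B_2/B_1\oplus\cdots$ is the associated coradically graded bialgebra induced by the coradical filtration. *)

(* Defs.v *)
From HB Require Import structures.
From mathcomp Require Import all_boot all_order all_algebra generic_quotient.
From mathcomp Require Import boolp classical_sets.
From mathcomp.multinomials Require Import freeg.

Set Implicit Arguments.
Unset Strict Implicit.
Unset Printing Implicit Defensive.

Import GRing.Theory.
Local Open Scope classical_set_scope.
Local Open Scope quotient_scope.
Local Open Scope ring_scope.

(** An element of [U ⊗ V] is a finite formal sum of pairs; two formal sums are
    identified when every bilinear map takes the same value on them, which is
    the universal property of the tensor product. *)

Section TensorQuotient.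
Variables (k : fieldType) (U V : lmodType k).

Definition tens_eval (W : lmodType k) (b : U -> V -> W) (s : seq (U * V)) : W :=
  \sum_(p <- s) b p.1 p.2.

Definition tens_rel : rel (seq (U * V)) := fun s t =>
  `[< forall (W : lmodType k) (b : {bilinear U -> V -> W}),
        tens_eval b s = tens_eval b t >].

Lemma tens_rel_refl : reflexive tens_rel.
Proof. by move=> s; apply/asboolP. Qed.

Lemma tens_rel_sym : symmetric tens_rel.
Proof. by move=> s t; apply/asboolP/asboolP => h W b; rewrite h. Qed.

Lemma tens_rel_trans : transitive tens_rel.
Proof.
by move=> t s u /asboolP h1 /asboolP h2; apply/asboolP => W b; rewrite h1 h2.
Qed.

Canonical tens_equiv :=
  EquivRel tens_rel tens_rel_refl tens_rel_sym tens_rel_trans.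

Definition tens := {eq_quot tens_rel}.

HB.instance Definition _ := Choice.on tens.

Lemma tens_eqP (s t : seq (U * V)) :
  \pi_tens s = \pi_tens t <->
  forall (W : lmodType k) (b : {bilinear U -> V -> W}),
    tens_eval b s = tens_eval b t.
Proof.
split=> [h W b|h]; last by apply/eqmodP/asboolP.
by have /eqmodP/asboolP := h; apply.
Qed.

Lemma tens_eval_repr (s : seq (U * V)) (W : lmodType k)
    (b : {bilinear U -> V -> W}) :
  tens_eval b (repr (\pi_tens s)) = tens_eval b s.
Proof. by apply: (tens_eqP _ _).1; rewrite reprK. Qed.

Definition tens0 : tens := \pi_tens [::].
Definition tens_add (x y : tens) : tens := \pi_tens (repr x ++ repr y).
Definition tens_opp (x : tens) : tens := \pi_tens [seq (- p.1, p.2) | p <- repr x].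
Definition tens_scale (a : k) (x : tens) : tens :=
  \pi_tens [seq (a *: p.1, p.2) | p <- repr x].

Lemma tens_eval_nil (W : lmodType k) (b : U -> V -> W) : tens_eval b [::] = 0.
Proof. exact: big_nil. Qed.

Lemma tens_eval_cat (W : lmodType k) (b : U -> V -> W) s t :
  tens_eval b (s ++ t) = tens_eval b s + tens_eval b t.
Proof. exact: big_cat. Qed.

Lemma tens_eval_opp (W : lmodType k) (b : {bilinear U -> V -> W}) s :
  tens_eval b [seq (- p.1, p.2) | p <- s] = - tens_eval b s.
Proof.
by rewrite /tens_eval big_map -sumrN; apply: eq_bigr => p _; rewrite linearNl.
Qed.

Lemma tens_eval_scale (W : lmodType k) (b : {bilinear U -> V -> W}) a s :
  tens_eval b [seq (a *: p.1, p.2) | p <- s] = a *: tens_eval b s.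
Proof.
rewrite /tens_eval big_map scaler_sumr.
by apply: eq_bigr => p _; rewrite linearZl_LR.
Qed.

Definition tens_evalE := (tens_eval_repr, tens_eval_cat, tens_eval_opp,
  tens_eval_scale, tens_eval_nil).

Lemma tens_addA : associative tens_add.
Proof. by move=> x y z; apply/tens_eqP => W b; rewrite !tens_evalE addrA. Qed.

Lemma tens_addC : commutative tens_add.
Proof. by move=> x y; apply/tens_eqP => W b; rewrite !tens_evalE addrC. Qed.

Lemma tens_add0 : left_id tens0 tens_add.
Proof.
move=> x; rewrite -[RHS]reprK; apply/tens_eqP => W b.
by rewrite !tens_evalE add0r.
Qed.

Lemma tens_addN : left_inverse tens0 tens_opp tens_add.
Proof. by move=> x; apply/tens_eqP => W b; rewrite !tens_evalE addNr. Qed.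

HB.instance Definition _ :=
  GRing.isZmodule.Build tens tens_addA tens_addC tens_add0 tens_addN.

Lemma tens_scaleA a c x : tens_scale a (tens_scale c x) = tens_scale (a * c) x.
Proof. by apply/tens_eqP => W b; rewrite !tens_evalE scalerA. Qed.

Lemma tens_scale1 : left_id 1 tens_scale.
Proof.
move=> x; rewrite -[RHS]reprK; apply/tens_eqP => W b.
by rewrite !tens_evalE scale1r.
Qed.

Lemma tens_scaleDr : right_distributive tens_scale +%R.
Proof.
by move=> a x y; apply/tens_eqP => W b; rewrite !tens_evalE scalerDr.
Qed.

Lemma tens_scaleDl x : {morph tens_scale^~ x : a c / a + c}.
Proof.
by move=> a c; apply/tens_eqP => W b; rewrite !tens_evalE scalerDl.
Qed.

HB.instance Definition _ := GRing.Zmodule_isLmodule.Build k tens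
  tens_scaleA tens_scale1 tens_scaleDr tens_scaleDl.

Definition pure (u : U) (v : V) : tens := \pi_tens [:: (u, v)].

Lemma pure_bilinear : bilinear_for *:%R *:%R pure.
Proof.
split=> u' a u v; apply/tens_eqP => W b;
by rewrite !tens_evalE /tens_eval !big_seq1 /= (linearPl, linearPr).
Qed.

HB.instance Definition _ :=
  bilinear_isBilinear.Build k U V tens *:%R *:%R pure pure_bilinear.

(* The linear map [u ⊗ v |-> b u v]; it only makes sense for bilinear [b]. *)
Definition tens_lift (W : lmodType k) (b : U -> V -> W) (x : tens) : W :=
  tens_eval b (repr x).

Section Lift.
Variables (W : lmodType k) (b : {bilinear U -> V -> W}).

Lemma tens_lift_linear : linear (tens_lift b).
Proof. by move=> a x y; rewrite /tens_lift !tens_evalE. Qed.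

HB.instance Definition _ :=
  GRing.isLinear.Build k tens W *:%R (tens_lift b) tens_lift_linear.

Lemma tens_lift_pure u v : tens_lift b (pure u v) = b u v.
Proof. by rewrite /tens_lift tens_evalE /tens_eval big_seq1. Qed.

End Lift.

Lemma tens_piE (s : seq (U * V)) : \pi_tens s = \sum_(p <- s) pure p.1 p.2.
Proof.
elim: s => [|p s IH]; first by rewrite big_nil.
rewrite big_cons -IH; apply/tens_eqP => W b.
by rewrite !tens_evalE /tens_eval big_seq1 big_cons.
Qed.

Lemma tens_sum_pure (x : tens) : x = \sum_(p <- repr x) pure p.1 p.2.
Proof. by rewrite -tens_piE reprK. Qed.

Lemma tens_lin_ext (W : lmodType k) (f g : {linear tens -> W}) :
  (forall u v, f (pure u v) = g (pure u v)) -> f =1 g.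
Proof.
move=> h x; rewrite [x]tens_sum_pure !linear_sum; apply: eq_bigr => p _.
exact: h.
Qed.

End TensorQuotient.

Notation "U ⊗ V" := (tens U%type V%type) (at level 40, left associativity) : type_scope.
Notation "u ⊗ v" := (pure u v) (at level 40, left associativity) : ring_scope.

Section TensorMap.
Variables (k : fieldType) (U V U' V' : lmodType k).

Definition pure_comp (f : U -> U') (g : V -> V') (u : U) (v : V) :
  (U' ⊗ V')%type := f u ⊗ g v.

Definition tens_map (f : U -> U') (g : V -> V') : U ⊗ V -> U' ⊗ V' :=
  tens_lift (pure_comp f g).

Variables (f : {linear U -> U'}) (g : {linear V -> V'}).

Lemma pure_comp_bilinear : bilinear_for *:%R *:%R (pure_comp f g).
Proof.
by split=> w a u v; rewrite /pure_comp !linearP (linearPl, linearPr).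
Qed.

HB.instance Definition _ := bilinear_isBilinear.Build k U V (U' ⊗ V')%type
  *:%R *:%R (pure_comp f g) pure_comp_bilinear.
HB.instance Definition _ := GRing.Linear.on (tens_map f g).

Lemma tens_map_pure u v : tens_map f g (u ⊗ v) = f u ⊗ g v.
Proof. exact: tens_lift_pure. Qed.

End TensorMap.

Section TensorAssoc.
Variables (k : fieldType) (U V W : lmodType k).

Definition pure3 (w : W) (u : U) (v : V) : (U ⊗ (V ⊗ W))%type := u ⊗ (v ⊗ w).

Lemma pure3_bilinear w : bilinear_for *:%R *:%R (pure3 w).
Proof.
split=> z a u v; rewrite /pure3 ?linearPl ?linearPr //.
Qed.

HB.instance Definition _ w := bilinear_isBilinear.Build k U V
  (U ⊗ (V ⊗ W))%type *:%R *:%R (pure3 w) (pure3_bilinear w).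

Definition tens_assoc_bil (x : (U ⊗ V)%type) (w : W) : (U ⊗ (V ⊗ W))%type :=
  tens_lift (pure3 w) x.

Lemma tens_assoc_bil_bilinear : bilinear_for *:%R *:%R tens_assoc_bil.
Proof.
split=> [w|x] a y z; first exact: linearP.
rewrite [x]tens_sum_pure /tens_assoc_bil !linear_sum /= scaler_sumr -big_split.
apply: eq_bigr => p _ /=.
by rewrite !tens_lift_pure /= /pure3 !linearPr.
Qed.

HB.instance Definition _ := bilinear_isBilinear.Build k (U ⊗ V)%type W
  (U ⊗ (V ⊗ W))%type *:%R *:%R tens_assoc_bil tens_assoc_bil_bilinear.

Definition tens_assoc : U ⊗ V ⊗ W -> U ⊗ (V ⊗ W) := tens_lift tens_assoc_bil.

HB.instance Definition _ := GRing.Linear.on tens_assoc.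

Lemma tens_assoc_pure u v w : tens_assoc (u ⊗ v ⊗ w) = u ⊗ (v ⊗ w).
Proof. by rewrite /tens_assoc tens_lift_pure /= /tens_assoc_bil tens_lift_pure. Qed.

End TensorAssoc.

(** The componentwise product [(a ⊗ b) (c ⊗ d) = a c ⊗ b d] on [C ⊗ C] induced
    by a bilinear product on [C]. *)

Section TensorMul.
Variables (k : fieldType) (C : lmodType k) (m : {bilinear C -> C -> C}).

Definition pure_mul (c d a b : C) : (C ⊗ C)%type := m a c ⊗ m b d.

Lemma pure_mul_bilinear c d : bilinear_for *:%R *:%R (pure_mul c d).
Proof.
by split=> w a u v; rewrite /pure_mul linearPl (linearPl, linearPr).
Qed.

HB.instance Definition _ c d := bilinear_isBilinear.Build k C C
  (C ⊗ C)%type *:%R *:%R (pure_mul c d) (pure_mul_bilinear c d).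

Definition tens_mul_bil (x : (C ⊗ C)%type) (c d : C) : (C ⊗ C)%type :=
  tens_lift (pure_mul c d) x.

Lemma tens_mul_bil_bilinear x : bilinear_for *:%R *:%R (tens_mul_bil x).
Proof.
split=> w a y z; rewrite [x]tens_sum_pure /tens_mul_bil !linear_sum;
rewrite /= scaler_sumr -big_split; apply: eq_bigr => p _ /=;
by rewrite !tens_lift_pure /= /pure_mul linearPr (linearPl, linearPr).
Qed.

HB.instance Definition _ x := bilinear_isBilinear.Build k C C
  (C ⊗ C)%type *:%R *:%R (tens_mul_bil x) (tens_mul_bil_bilinear x).

Definition tens_mul (x y : (C ⊗ C)%type) : (C ⊗ C)%type :=
  tens_lift (tens_mul_bil x) y.

Lemma tens_mul_pure a b c d :
  tens_mul (a ⊗ b) (c ⊗ d) = m a c ⊗ m b d.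
Proof. by rewrite /tens_mul tens_lift_pure /= /tens_mul_bil tens_lift_pure. Qed.

End TensorMul.

Section CounitMaps.
Variables (k : fieldType) (C : lmodType k) (e : {scalar C}).

Definition scale_fst (u v : C) : C := e u *: v.
Definition scale_snd (u v : C) : C := e v *: u.

Lemma scale_fst_bilinear : bilinear_for *:%R *:%R scale_fst.
Proof.
split=> w a u v; rewrite /scale_fst ?linearP //= scalerDl scalerA //.
Qed.

Lemma scale_snd_bilinear : bilinear_for *:%R *:%R scale_snd.
Proof.
split=> w a u v; rewrite /scale_snd ?linearP //= scalerDl scalerA //.
Qed.

HB.instance Definition _ :=
  bilinear_isBilinear.Build k C C C *:%R *:%R scale_fst scale_fst_bilinear.
HB.instance Definition _ :=
  bilinear_isBilinear.Build k C C C *:%R *:%R scale_snd scale_snd_bilinear.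

End CounitMaps.

Record coalgebra (k : fieldType) := Coalgebra {
  coalg_space :> lmodType k;
  comul : {linear coalg_space -> (coalg_space ⊗ coalg_space)%type};
  counit : {scalar coalg_space};
  comul_coassoc : forall x : coalg_space,
    tens_assoc (tens_map comul idfun (comul x)) =
    tens_map idfun comul (comul x);
  counit_comul : forall x : coalg_space,
    tens_lift (scale_fst counit) (comul x) = x;
  comul_counit : forall x : coalg_space,
    tens_lift (scale_snd counit) (comul x) = x
}.

Section Filtration.
Variables (k : fieldType).

Definition subspace (V : lmodType k) (D : set V) : Prop :=
  D 0 /\ forall (a : k) (x y : V), D x -> D y -> D (a *: x + y).

(* The image of [D ⊗ E] in [U ⊗ V], for subspaces [D] of [U] and [E] of [V]. *)
Definition tens_set (U V : lmodType k) (D : set U) (E : set V) :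
    set (U ⊗ V)%type :=
  [set t | exists2 s : seq (U * V),
     (forall p, p \in s -> D p.1 /\ E p.2) & t = \sum_(p <- s) p.1 ⊗ p.2].

Variable C : coalgebra k.

Definition subcoalgebra (D : set C) : Prop :=
  subspace D /\ forall x, D x -> tens_set D D (comul C x).

Definition simple_subcoalgebra (D : set C) : Prop :=
  [/\ subcoalgebra D, D <> [set 0] &
      forall E : set C, subcoalgebra E -> E `<=` D -> E = [set 0] \/ E = D].

Definition pointed : Prop :=
  forall D : set C, simple_subcoalgebra D ->
    exists2 g : C, g <> 0 & D = [set a *: g | a in [set: k]].

(* The sum of all simple subcoalgebras. *)
Definition coradical : set C :=
  [set x | exists2 s : seq C,
     (forall y, y \in s -> exists2 D : set C, simple_subcoalgebra D & D y) &
     x = \sum_(y <- s) y].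

(* [C_(n+1)] is the preimage under [comul] of [C ⊗ C_n + C_0 ⊗ C]. *)
Fixpoint coradical_filtration (n : nat) : set C :=
  if n is m.+1 then
    [set x | exists t1 t2 : (C ⊗ C)%type,
       [/\ tens_set setT (coradical_filtration m) t1,
           tens_set coradical setT t2 & comul C x = t1 + t2]]
  else coradical.

End Filtration.

Arguments pointed {k} C.
Arguments coradical {k} C.
Arguments coradical_filtration {k} C n.

Record bialgebra_structure (k : fieldType) (C : coalgebra k) :=
    BialgebraStructure {
  bmul : {bilinear C -> C -> C};
  bone : C;
  bmulA : associative bmul;
  bmul1l : left_id bone bmul;
  bmul1r : right_id bone bmul;
  comul_bmul : forall x y,
    comul C (bmul x y) = tens_mul bmul (comul C x) (comul C y);
  comul_bone : comul C bone = bone ⊗ bone;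
  counit_bmul : forall x y, counit C (bmul x y) = counit C x * counit C y;
  counit_bone : counit C bone = 1
}.

Record bialgebra (k : fieldType) := Bialgebra {
  bialg_coalg :> coalgebra k;
  bialg_str : bialgebra_structure bialg_coalg
}.

Section BialgebraDefs.
Variable k : fieldType.

Definition mulb (B : bialgebra k) : B -> B -> B := bmul (bialg_str B).
Definition oneb (B : bialgebra k) : B := bone (bialg_str B).

Record bialgebra_morphism (A B : bialgebra k) (f : {linear A -> B}) : Prop := {
  morph_mul : forall x y, f (mulb x y) = mulb (f x) (f y);
  morph_one : f (oneb A) = oneb B;
  morph_comul : forall x, comul B (f x) = tens_map f f (comul A x);
  morph_counit : forall x, counit B (f x) = counit A x
}.

Definition direct_sum (V : lmodType k) (D : nat -> set V) : Prop :=
  [/\ forall n, subspace (D n),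
      forall x, exists (n : nat) (f : nat -> V),
        (forall i, D i (f i)) /\ x = \sum_(i < n) f i &
      forall (n : nat) (f : nat -> V), (forall i, D i (f i)) ->
        \sum_(i < n) f i = 0 -> forall i, (i < n)%N -> f i = 0].

(* [A], with the grading [gr], is [⊕_n B_n / B_(n-1)] (where [B_(-1) = 0]) with
   the operations induced from [B]: [sym n], used on [B_n] only, is the quotient
   map from [B_n] onto the component [gr n].  Since [comul] maps [B_n] into the
   sum of the [B_i ⊗ B_(n-i)] and, for pointed [B], the product maps
   [B_m × B_n] into [B_(m+n)], the conditions below determine all the
   operations of [A]. *)
Record is_associated_graded (B A : bialgebra k)
    (gr : nat -> set A) (sym : nat -> B -> A) : Prop := {
  gr_direct : direct_sum gr;
  sym_linear : forall n (a : k) (x y : B),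
    coradical_filtration B n x -> coradical_filtration B n y ->
    sym n (a *: x + y) = a *: sym n x + sym n y;
  sym_image : forall n, sym n @` coradical_filtration B n = gr n;
  sym_ker0 : forall x, coradical_filtration B 0 x -> sym 0%N x = 0 -> x = 0;
  sym_kerS : forall n x, coradical_filtration B n.+1 x ->
    (sym n.+1 x = 0 <-> coradical_filtration B n x);
  sym_mul : forall m n x y,
    coradical_filtration B m x -> coradical_filtration B n y ->
    mulb (sym m x) (sym n y) = sym (m + n)%N (mulb x y);
  sym_one : oneb A = sym 0%N (oneb B);
  sym_comul : forall n x (s : seq (nat * (B * B))),
    coradical_filtration B n x ->
    (forall z, z \in s -> [/\ (z.1 <= n)%N,
       coradical_filtration B z.1 z.2.1 &
       coradical_filtration B (n - z.1) z.2.2]) ->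
    comul B x = \sum_(z <- s) z.2.1 ⊗ z.2.2 ->
    comul A (sym n x) = \sum_(z <- s) sym z.1 z.2.1 ⊗ sym (n - z.1)%N z.2.2;
  sym_counit0 : forall x, coradical_filtration B 0 x ->
    counit A (sym 0%N x) = counit B x;
  sym_counitS : forall n x, coradical_filtration B n.+1 x ->
    counit A (sym n.+1 x) = 0
}.

End BialgebraDefs.

(* Classically every type carries a [choiceType] structure, so arbitrary sets of
   vertices and arrows are allowed. *)
Record quiver := Quiver {
  vertex : choiceType;
  arrow : choiceType;
  src : arrow -> vertex;
  tgt : arrow -> vertex
}.

Record quiver_iso (Q Q' : quiver) (f0 : vertex Q -> vertex Q')
    (f1 : arrow Q -> arrow Q') : Prop := {
  quiver_iso_vertex : bijective f0;
  quiver_iso_arrow : bijective f1;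
  quiver_iso_src : forall a, src (f1 a) = f0 (src a);
  quiver_iso_tgt : forall a, tgt (f1 a) = f0 (tgt a)
}.

Section Paths.
Variable Q : quiver.

(* [walk x [:: a_1; ...; a_n]] says that the path [a_n ... a_1] starts at [x]:
   arrows are listed in the order in which they are traversed. *)
Fixpoint walk (x : vertex Q) (s : seq (arrow Q)) : bool :=
  if s is a :: s' then (src a == x) && walk (tgt a) s' else true.

Definition walk_end (x : vertex Q) (s : seq (arrow Q)) : vertex Q :=
  last x [seq tgt a | a <- s].

(* A path is given by its source and its arrows; the paths without arrows are
   the vertices. *)
Record qpath := QPath {
  qpath_val : vertex Q * seq (arrow Q);
  qpathP : walk qpath_val.1 qpath_val.2
}.

HB.instance Definition _ := [isSub for qpath_val].
HB.instance Definition _ := [Choice of qpath by <:].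

Definition qlength (p : qpath) : nat := size (qpath_val p).2.

Lemma walk_cat x s t : walk x (s ++ t) = walk x s && walk (walk_end x s) t.
Proof. by elim: s x => //= a s IH x; rewrite IH andbA. Qed.

Lemma walk_end_cat x s t : walk_end x (s ++ t) = walk_end (walk_end x s) t.
Proof. by rewrite /walk_end map_cat last_cat. Qed.

Lemma qtake_subproof i (p : qpath) :
  walk (qpath_val p).1 (take i (qpath_val p).2).
Proof. by have := qpathP p; rewrite -{1}(cat_take_drop i _.2) walk_cat => /andP[]. Qed.

Lemma qdrop_subproof i (p : qpath) :
  walk (walk_end (qpath_val p).1 (take i (qpath_val p).2))
    (drop i (qpath_val p).2).
Proof. by have := qpathP p; rewrite -{1}(cat_take_drop i _.2) walk_cat => /andP[]. Qed.

(* For [p = a_n ... a_1], [qtake i p] is [a_i ... a_1] and [qdrop i p] is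
   [a_n ... a_(i+1)]. *)
Definition qtake i (p : qpath) : qpath :=
  @QPath ((qpath_val p).1, take i (qpath_val p).2) (qtake_subproof i p).

Definition qdrop i (p : qpath) : qpath :=
  @QPath (walk_end (qpath_val p).1 (take i (qpath_val p).2),
          drop i (qpath_val p).2) (qdrop_subproof i p).

Lemma qlength_take i p : (i <= qlength p)%N -> qlength (qtake i p) = i.
Proof. by move=> h; rewrite /qlength /= size_takel. Qed.

Lemma qlength_drop i p : qlength (qdrop i p) = (qlength p - i)%N.
Proof. by rewrite /qlength /= size_drop. Qed.

Lemma qtake0 p : qlength (qtake 0 p) = 0%N.
Proof. by rewrite /qlength /= take0. Qed.

Lemma qtake_size p : qtake (qlength p) p = p.
Proof. by apply: val_inj; rewrite /= take_size -surjective_pairing. Qed.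

Lemma qdrop0 p : qdrop 0 p = p.
Proof. by apply: val_inj; rewrite /= take0 drop0 -surjective_pairing. Qed.

Lemma qdrop_drop i j p : qdrop j (qdrop i p) = qdrop (j + i) p.
Proof.
apply: val_inj => /=; rewrite drop_drop; congr (_, _).
by rewrite -walk_end_cat [(j + i)%N]addnC takeD.
Qed.

Lemma qtake_take i j p : qtake i (qtake (j + i) p) = qtake i p.
Proof. by apply: val_inj; rewrite /= take_takel // leq_addl. Qed.

Lemma qdrop_take i j p : qdrop i (qtake (j + i) p) = qtake j (qdrop i p).
Proof.
apply: val_inj => /=; rewrite take_takel ?leq_addl //; congr (_, _).
by rewrite take_drop.
Qed.

End Paths.

Section PathSpace.
Variables (k : fieldType) (Q : quiver).

(* The vector space with basis the paths of [Q]. *)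
Definition path_space : Type := {freeg (qpath Q) / k}.

HB.instance Definition _ := GRing.Lmodule.on path_space.

Definition path_vec (p : qpath Q) : path_space := << p >>.

Definition path_lift (M : lmodType k) (f : qpath Q -> M) (x : path_space) : M :=
  fglift f x.

Lemma path_sumE (x : path_space) :
  x = \sum_(p <- dom x) coeff p x *: path_vec p.
Proof.
rewrite -[LHS]freeg_sumE; apply: eq_bigr => p _.
apply/eqP/freeg_eqP => q.
by rewrite coeffZ !coeffU mul1r.
Qed.

Section Lift.
Variables (M : lmodType k) (f : qpath Q -> M).

HB.instance Definition _ := GRing.isZmodMorphism.Build path_space M
  (path_lift f) (lift_is_additive f).

Lemma path_lift_vec p : path_lift f (path_vec p) = f p.
Proof. by rewrite /path_lift liftU scale1r. Qed.

Lemma path_liftZ1 a p : path_lift f (a *: path_vec p) = a *: f p.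
Proof.
have -> : a *: path_vec p = << a *g p >>.
  by apply/eqP/freeg_eqP => q; rewrite coeffZ !coeffU mul1r.
by rewrite /path_lift liftU.
Qed.

Lemma path_lift_scalable : scalable (path_lift f).
Proof.
move=> a x; rewrite [x]path_sumE (@scaler_sumr k path_space). 
rewrite !raddf_sum /=.
by apply: eq_bigr => p _; rewrite scalerA !path_liftZ1 scalerA.
Qed.

HB.instance Definition _ := GRing.isScalable.Build k path_space M *:%R
  (path_lift f) path_lift_scalable.

End Lift.

Lemma path_lin_ext (M : lmodType k) (f g : {linear path_space -> M}) :
  (forall p, f (path_vec p) = g (path_vec p)) -> f =1 g.
Proof.
move=> h x; rewrite [x]path_sumE !linear_sum; apply: eq_bigr => p _.
by rewrite !linearZ h.
Qed.

(* The span of the paths of length [n]. *)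
Definition path_degree (n : nat) : set path_space :=
  [set x | forall p, p \in dom x -> qlength p = n].

End PathSpace.

Lemma sum_triangle (V : nmodType) n (F : nat -> nat -> V) :
  \sum_(0 <= i < n.+1) \sum_(0 <= j < (n - i).+1) F i j =
  \sum_(0 <= m < n.+1) \sum_(0 <= i < m.+1) F i (m - i)%N.
Proof.
elim: n => [|n IH]; first by rewrite !big_nat1.
rewrite [RHS]big_nat_recr //= -IH [X in _ = _ + X]big_nat_recr //= addrA.
rewrite -big_split /= big_nat_recr //= subnn big_nat1; congr (_ + _).
rewrite !big_nat; apply: eq_bigr => i /andP[_ hi].
by rewrite subSn // [LHS]big_nat_recr.
Qed.

Section PathCoalgebra.
Variables (k : fieldType) (Q : quiver).
Local Notation kQ := (path_space k Q).
Local Notation vec := (@path_vec k Q).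

(* The terms [i = 0] and [i = n] are [p ⊗ s(a_1)] and [t(a_n) ⊗ p]; on a vertex
   the sum has the single term [g ⊗ g]. *)
Definition path_comul_vec (p : qpath Q) : (kQ ⊗ kQ)%type :=
  \sum_(i < (qlength p).+1) vec (qdrop i p) ⊗ vec (qtake i p).

Definition path_counit_vec (p : qpath Q) : k^o := (qlength p == 0%N)%:R.

Definition path_comul : kQ -> (kQ ⊗ kQ)%type := path_lift path_comul_vec.

HB.instance Definition _ := GRing.Linear.on path_comul.

Definition path_counit : kQ -> k := path_lift path_counit_vec.

Lemma path_counit_linear : linear_for *%R path_counit.
Proof. exact: (linearP (path_lift path_counit_vec)). Qed.

HB.instance Definition _ := GRing.isLinear.Build k kQ k *%R
  path_counit path_counit_linear.

Lemma path_comul_vecE p : path_comul (vec p) =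
  \sum_(0 <= i < (qlength p).+1) vec (qdrop i p) ⊗ vec (qtake i p).
Proof. by rewrite /path_comul path_lift_vec big_mkord. Qed.

Lemma path_counit_vecE p : path_counit (vec p) = (qlength p == 0%N)%:R.
Proof. by rewrite /path_counit path_lift_vec. Qed.

Lemma path_coassoc (x : kQ) :
  tens_assoc (tens_map path_comul idfun (path_comul x)) =
  tens_map idfun path_comul (path_comul x).
Proof.
pose f : {linear kQ -> _} := @tens_assoc _ _ _ _ \o
  (tens_map path_comul idfun \o path_comul).
pose g : {linear kQ -> _} := tens_map idfun path_comul \o path_comul.
apply: (@path_lin_ext k Q _ f g) => p; rewrite /= {x f g}.
rewrite path_comul_vecE !(linear_sum (tens_map _ _)) linear_sum.
transitivity (\sum_(0 <= i < (qlength p).+1)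
    \sum_(0 <= j < (qlength p - i).+1)
      vec (qdrop j (qdrop i p)) ⊗ (vec (qtake j (qdrop i p)) ⊗ vec (qtake i p))).
  apply: eq_bigr => i _; rewrite /= tens_map_pure /= path_comul_vecE qlength_drop.
  rewrite linear_sumlz (linear_sum (@tens_assoc _ _ _ _)); apply: eq_bigr => j _.
  by rewrite /= tens_assoc_pure.
rewrite sum_triangle !big_nat; apply: eq_bigr => m /andP[_ hm].
rewrite /= tens_map_pure /= path_comul_vecE linear_sumr qlength_take //.
rewrite !big_nat; apply: eq_bigr => i /andP[_ hi].
by rewrite qdrop_drop -qdrop_take -(qtake_take i (m - i)%N p) subnK.
Qed.

Lemma path_counitl (x : kQ) :
  tens_lift (scale_fst path_counit) (path_comul x) = x.
Proof.
pose f : {linear kQ -> _} := tens_lift (scale_fst path_counit) \o path_comul.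
apply: (@path_lin_ext k Q _ f idfun) => p; rewrite /= {x f}.
rewrite path_comul_vecE linear_sum big_nat_recr //= big_nat big1.
  rewrite add0r tens_lift_pure /= /scale_fst /= path_counit_vecE.
  by rewrite qlength_drop subnn scale1r qtake_size.
move=> i /andP[_ hi].
rewrite tens_lift_pure /= /scale_fst /= path_counit_vecE qlength_drop.
by rewrite subn_eq0 leqNgt hi scale0r.
Qed.

Lemma path_counitr (x : kQ) :
  tens_lift (scale_snd path_counit) (path_comul x) = x.
Proof.
pose f : {linear kQ -> _} := tens_lift (scale_snd path_counit) \o path_comul.
apply: (@path_lin_ext k Q _ f idfun) => p; rewrite /= {x f}.
rewrite path_comul_vecE linear_sum big_nat_recl //= big_nat big1 ?addr0.
  rewrite tens_lift_pure /= /scale_snd /= path_counit_vecE qtake0 scale1r.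
  by rewrite qdrop0.
move=> i /andP[_ hi].
rewrite tens_lift_pure /= /scale_snd /= path_counit_vecE qlength_take //.
by rewrite scale0r.
Qed.

Definition path_coalgebra : coalgebra k :=
  Coalgebra path_coassoc path_counitl path_counitr.

End PathCoalgebra.

Arguments is_associated_graded {k} B A gr sym.

Section Realization.
Variable k : fieldType.

Definition graded_structure (Q : quiver)
    (M : bialgebra_structure (path_coalgebra k Q)) : Prop :=
  (forall m n (x y : path_coalgebra k Q),
     path_degree m x -> path_degree n y -> path_degree (m + n) (bmul M x y)) /\
  path_degree 0 (bone M).

(* Through [f], the bialgebra [A] is a sub-bialgebra of [kQ], with the structure
   [M], which contains [kQ_0 ⊕ kQ_1]. *)
Record realization (A : bialgebra k) (Q : quiver)
    (M : bialgebra_structure (path_coalgebra k Q))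
    (f : {linear A -> path_coalgebra k Q}) : Prop := {
  realization_inj : injective f;
  realization_morph : bialgebra_morphism (B := Bialgebra M) f;
  realization_deg01 : forall x0 x1 : path_coalgebra k Q,
    path_degree 0 x0 -> path_degree 1 x1 -> range f (x0 + x1)
}.

Definition quiver_isomorphic (Q Q' : quiver) : Prop :=
  exists (f0 : vertex Q -> vertex Q') (f1 : arrow Q -> arrow Q'),
    quiver_iso f0 f1.

Definition graded_bialgebra_isomorphic (Q Q' : quiver)
    (M : bialgebra_structure (path_coalgebra k Q))
    (M' : bialgebra_structure (path_coalgebra k Q')) : Prop :=
  exists f : {linear path_coalgebra k Q -> path_coalgebra k Q'},
    [/\ bijective f,
        bialgebra_morphism (A := Bialgebra M) (B := Bialgebra M') f &
        forall n x, path_degree n x -> path_degree n (f x)].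

End Realization.

(* Main.v *)
(* A coalgebra map [C -> kQ] is determined by its coefficients on vertices and
   arrows, because its coefficient on a longer path is the convolution product
   of the coefficients on the arrows; conversely, functionals on a graded
   coalgebra [C] with the obvious convolution relations are the coefficients of
   a coalgebra map.

   For [A = gr B], take as vertices the group-like elements of degree [0] and as
   arrows a basis of [gr 1] consisting of skew-primitive elements.  The dual
   functionals give a coalgebra map [f : A -> kQ], which is injective since
   [gr (n + 1) -> gr 1 ⊗ gr n] is injective for every [n >= 1], by definition of
   the coradical filtration.  The product of [A] in degrees [0] and [1] gives
   functionals on [kQ ⊗ kQ], hence a product on [kQ]; associativity, the unit
   laws and the multiplicativity of [f] are equalities between coalgebra maps
   into [kQ], and can be checked in degrees [0] and [1].

   Given two realizations [f] and [f'], the map [f' \o f^-1] in degrees [0] and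
   [1] extends in the same way to an isomorphism [kQ -> kQ'] of graded
   bialgebras.  It permutes the group-like elements, which are the vertices, and
   maps the span of the arrows between two vertices isomorphically to the span
   of the corresponding arrows of [Q'], so that these sets of arrows, possibly
   infinite, are equipotent. *)

Require Import Defs.
From HB Require Import structures.
From mathcomp Require Import all_boot all_order all_algebra.
From mathcomp Require Import boolp classical_sets.
From mathcomp Require Import functions cardinality.
From mathcomp Require wochoice.
From mathcomp.multinomials Require Import freeg.

Set Implicit Arguments.
Unset Strict Implicit.
Unset Printing Implicit Defensive.

Import GRing.Theory.
Local Open Scope classical_set_scope.
Local Open Scope ring_scope.

(** * Linear algebra *)

Section LinearAlgebra.
Variables (k : fieldType).
Implicit Types (U V : lmodType k).

(** An identity between tensors is mostly tested by contracting a leg with functionals, so a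
    coalgebra is handled as a bimodule over its dual algebra. For pointed [B], the term [B_n]
    consists of the elements that every functional killing the coradical contracts into [B_(n-1)]
    ([sfiltSP]); the splitting of the comultiplication over the filtration, its compatibility with
    products and the injectivity behind [f] all come from this. The quiver remembers only degrees 0
    and 1, so the product is transported along a linear section [sect] of [f] that is zero on longer
    paths. In general it is not a coalgebra map, but functionals of degree at most 1 cannot see
    where it fails, because degrees add up. A realization is not assumed to preserve degrees, which
    shapes the uniqueness part: if [Δ(x) = g ⊗ x + x ⊗ h], then [x + c (g - h)] satisfies the same
    equation, so two embeddings may differ by such terms. Comparison maps keep only the arrow
    coefficients and carry the discrepancy as a correction of degree 0. *)

Definition linear_of U V (f : U -> V) (Hf : linear f) : {linear U -> V} :=
  HB.pack f (GRing.isLinear.Build k U V *:%R f Hf).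

Definition bilinear_of U V (W : lmodType k) (f : U -> V -> W)
    (Hf : bilinear_for *:%R *:%R f) : {bilinear U -> V -> W} :=
  HB.pack f (bilinear_isBilinear.Build k U V W *:%R *:%R f Hf).

Lemma subspace0 V (D : set V) : subspace D -> D 0.
Proof. by case. Qed.

Lemma subspaceZ V (D : set V) a x : subspace D -> D x -> D (a *: x).
Proof. by move=> [D0 DP] Dx; rewrite -[_ *: _]addr0; apply: DP. Qed.

Lemma subspaceD V (D : set V) x y : subspace D -> D x -> D y -> D (x + y).
Proof. by move=> [D0 DP] Dx Dy; rewrite -[x]scale1r; apply: DP. Qed.

Lemma subspaceN V (D : set V) x : subspace D -> D x -> D (- x).
Proof. by move=> sD Dx; rewrite -scaleN1r; apply: subspaceZ. Qed.

Lemma subspaceB V (D : set V) x y : subspace D -> D x -> D y -> D (x - y).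
Proof. by move=> sD Dx Dy; apply: subspaceD => //; apply: subspaceN. Qed.

Lemma subspace_sum V (D : set V) (I : Type) (r : seq I) (P : pred I) (F : I -> V) :
  subspace D -> (forall i, P i -> D (F i)) -> D (\sum_(i <- r | P i) F i).
Proof.
move=> sD DF; apply: (big_ind D) => //; first exact: subspace0.
by move=> x y; apply: subspaceD.
Qed.

Lemma subspace_sum_seq V (D : set V) (I : eqType) (r : seq I) (P : pred I)
    (F : I -> V) :
  subspace D -> (forall i, i \in r -> P i -> D (F i)) ->
  D (\sum_(i <- r | P i) F i).
Proof.
move=> sD DF; rewrite big_seq_cond; apply: subspace_sum => // i /andP[ri Pi].
exact: DF.
Qed.

Lemma subspace_preimage U V (f : {linear U -> V}) (D : set V) :
  subspace D -> subspace (f @^-1` D).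
Proof.
move=> [D0 DP]; split; rewrite /preimage /=; first by rewrite linear0.
by move=> a x y; rewrite linearP; apply: DP.
Qed.

Lemma subspace_zero V : subspace [set (0 : V)].
Proof. by split=> // a x y /= -> ->; rewrite scaler0 addr0. Qed.

(** Impredicative, so that induction over a span consists in exhibiting one subspace containing the
    generators ([span_min]), with no finite combinations to index. *)
Definition span V (S : set V) : set V :=
  [set x | forall D : set V, subspace D -> S `<=` D -> D x].

Lemma subspace_span V (S : set V) : subspace (span S).
Proof.
split=> [D sD _|a x y hx hy D sD SD]; first exact: subspace0.
by apply: sD.2; [apply: hx|apply: hy].
Qed.

Lemma span0 V (S : set V) : span S 0.
Proof. exact: subspace0 (subspace_span S). Qed.

Lemma spanZ V (S : set V) a x : span S x -> span S (a *: x).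
Proof. exact: subspaceZ (subspace_span S). Qed.

Lemma spanD V (S : set V) x y : span S x -> span S y -> span S (x + y).
Proof. exact: subspaceD (subspace_span S). Qed.

Lemma spanN V (S : set V) x : span S x -> span S (- x).
Proof. exact: subspaceN (subspace_span S). Qed.

Lemma spanB V (S : set V) x y : span S x -> span S y -> span S (x - y).
Proof. exact: subspaceB (subspace_span S). Qed.

Lemma span_sub V (S : set V) : S `<=` span S.
Proof. by move=> x Sx D _; apply. Qed.

Lemma span_min V (S D : set V) : subspace D -> S `<=` D -> span S `<=` D.
Proof. by move=> sD SD x; apply. Qed.

Lemma span_mono V (S T : set V) : S `<=` T -> span S `<=` span T.
Proof.
by move=> ST; apply: span_min (subspace_span T) _ => x /ST; apply: span_sub.
Qed.

Lemma span_setU1 V (S : set V) x y :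
  span (S `|` [set x]) y -> exists c : k, span S (y - c *: x).
Proof.
apply: (span_min (D := [set y | exists c : k, span S (y - c *: x)])).
  have sS := subspace_span S.
  split=> [|a u v [c hc] [d hd]] /=.
    by exists 0; rewrite scale0r subr0; exact: span0.
  exists (a * c + d); rewrite scalerDl -scalerA opprD addrACA -scalerBr.
  by apply: sS.2.
move=> z [Sz|->] /=.
  by exists 0; rewrite scale0r subr0; apply: span_sub.
by exists 1; rewrite scale1r subrr; exact: span0.
Qed.

(** A linear combination uses finitely many vectors, hence lives in one member of the chain: this
    feeds Zorn's lemma. An empty [Z] serves complements, a singleton serves independence; the case
    [x = 0] absorbs the empty chain. *)
Lemma span_bigcup_chain V (F : set (set V)) (Z : set V) x :
  total_on F subset -> span ((\bigcup_(X in F) X) `\` Z) x ->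
  x = 0 \/ exists2 S, F S & span (S `\` Z) x.
Proof.
move=> totF; apply: (span_min (D := [set x | x = 0 \/
  exists2 S, F S & span (S `\` Z) x])).
  split=> [|a u v]; first by left.
  case=> [-> |[S FS uS]] [->|[T FT vT]] /=.
  - by left; rewrite scaler0 addr0.
  - by right; exists T => //; rewrite scaler0 add0r.
  - right; exists S => //; rewrite addr0; exact: spanZ.
  - have [ST|TS] := totF _ _ FS FT.
    + right; exists T => //; apply: (subspace_span _).2 => //.
      exact: span_mono (setSD ST) _ uS.
    + right; exists S => //; apply: (subspace_span _).2 => //.
      exact: span_mono (setSD TS) _ vT.
move=> z [[S FS Sz] nZ] /=; right; exists S => //; exact: span_sub.
Qed.

Lemma ex_complement V (D : set V) : subspace D ->
  exists W : set V, [/\ subspace W, forall x, W x -> D x -> x = 0 &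
    forall x, exists2 d, D d & W (x - d)].
Proof.
move=> sD; pose P (S : set V) := forall x, span S x -> D x -> x = 0.
have [|S [PS maxS]] := @Zorn_bigcup V P.
  move=> F FP totF x; rewrite -(setD0 (\bigcup_(X in F) X)).
  move=> /(span_bigcup_chain totF) [//|[S FS]].
  by rewrite setD0; apply: FP.
exists (span S); split; [exact: subspace_span|exact: PS|move=> x].
apply: contrapT => hx; apply: (maxS (S `|` [set x])).
  split; first by move=> y; left.
  move=> /(_ x) Sx; apply: hx; exists 0; first exact: subspace0.
  by rewrite subr0; apply: span_sub; apply: Sx; right.
(* A vector of [D] in the enlarged span either has no [x] component, or expresses [x] modulo
   [span S], against the choice of [x]. *)
move=> y /span_setU1 [c hc] Dy; have [c0|c0] := eqVneq c 0.
  by apply: PS Dy; rewrite -[y]subr0 -(scale0r x) -c0.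
case: hx; exists (c^-1 *: y); first exact: subspaceZ.
rewrite -[x](scalerK c0) -scalerBr; apply: spanZ.
by rewrite -opprB; exact: spanN.
Qed.

Lemma ex_projection V (D : set V) : subspace D ->
  exists E : {linear V -> V}, (forall x, D (E x)) /\ forall x, D x -> E x = x.
Proof.
move=> sD; have [W [sW WD0 WD]] := ex_complement sD.
have /choice [e he] : forall x, exists y, D y /\ W (x - y).
  by move=> x; have [d] := WD x; exists d.
have uniq x d : D d -> W (x - d) -> d = e x.
  move=> Dd Wd; have [De We] := he x; apply/eqP; rewrite -subr_eq0; apply/eqP.
  apply: WD0; last exact: subspaceB.
  by rewrite -[d - _](subrKA x) addrC -[d - x]opprB; apply: subspaceB.
have lin_e : linear e.
  move=> a x y; have [Dx Wx] := he x; have [Dy Wy] := he y.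
  apply/esym/uniq; first exact: sD.2.
  by rewrite opprD addrACA -scalerBr; apply: sW.2.
exists (linear_of lin_e); split=> [x|x Dx] /=; first by case: (he x).
by apply/esym/uniq; rewrite // subrr; apply: subspace0.
Qed.

(** [y] is the component of [x] outside [D]; the functional is the coordinate along the line of [y],
    read after projecting away from [D]. *)
Lemma ex_functional V (D : set V) x : subspace D -> ~ D x ->
  exists phi : {linear V -> k^o}, (forall d, D d -> phi d = 0) /\ phi x = 1.
Proof.
move=> sD nDx; have [E [ED EK]] := ex_projection sD.
pose y := x - E x.
have y0 : y != 0 by apply: contra_notN nDx; rewrite subr_eq0 => /eqP ->.
have sL : subspace [set a *: y | a in [set: k]].
  split=> [|a _ _ [b _ <-] [c _ <-]]; first by exists 0; rewrite ?scale0r.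
  by exists (a * b + c); rewrite // scalerDl scalerA.
have [G [GL GK]] := ex_projection sL.
have /choice [c hc] : forall v, exists a : k, a *: y = G v.
  by move=> v; have [a _ <-] := GL v; exists a.
have cy_inj a b : a *: y = b *: y -> a = b.
  move=> /eqP; rewrite -subr_eq0 -scalerBl scaler_eq0 (negPf y0) orbF.
  by rewrite subr_eq0 => /eqP.
have lin_c : linear (fun v => c (v - E v) : k^o).
  move=> a u v; apply: cy_inj; rewrite hc.
  rewrite scalerDl -scalerA !hc linearP opprD addrACA -scalerBr.
  by rewrite linearP.
exists (linear_of lin_c); split=> [d Dd|] /=; apply: cy_inj; rewrite hc.
  by rewrite EK // subrr linear0 scale0r.
by rewrite GK ?scale1r //; exists 1; rewrite ?scale1r.
Qed.

Lemma functional_eq0 V (x : V) :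
  (forall phi : {linear V -> k^o}, phi x = 0) -> x = 0.
Proof.
move=> h; apply: contrapT => x0.
have [phi [_]] := ex_functional (subspace_zero V) x0.
by rewrite h => /eqP; rewrite eq_sym oner_eq0.
Qed.

Lemma functional_ext V (x y : V) :
  (forall phi : {linear V -> k^o}, phi x = phi y) -> x = y.
Proof.
move=> h; apply/eqP; rewrite -subr_eq0; apply/eqP/functional_eq0 => phi.
by rewrite linearB /= h subrr.
Qed.

Lemma functional_mem V (D : set V) x : subspace D ->
  (forall phi : {linear V -> k^o}, (forall d, D d -> phi d = 0) -> phi x = 0) ->
  D x.
Proof.
move=> sD h; apply: contrapT => /(ex_functional sD)[phi [phiD phix]].
by have := h _ phiD; rewrite phix => /eqP; rewrite oner_eq0.
Qed.

Definition independent V (S : set V) := forall s, S s -> ~ span (S `\ s) s.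

Lemma ex_basis V (X : set V) :
  exists S, [/\ S `<=` X, independent S & X `<=` span S].
Proof.
pose P S := S `<=` X /\ independent S.
have [|S [[SX indS] maxS]] := @Zorn_bigcup V P.
  move=> F FP totF; split=> [x [S /FP[SX _]]|s [S FS Ss]]; first exact: SX.
  move=> /(span_bigcup_chain totF) [s0|[T FT hs]].
    have [_ /(_ _ Ss)] := FP _ FS; apply.
    by rewrite [X in span _ X]s0; exact: span0.
  have [ST|TS] := totF _ _ FS FT.
    by have [_ /(_ _ (ST _ Ss))] := FP _ FT; apply.
  by have [_ /(_ _ Ss)] := FP _ FS; apply; apply: span_mono hs; apply: setSD.
exists S; split=> // x Xx; apply: contrapT => nx.
have nSx : ~ S x by move=> /span_sub.
apply: (maxS (S `|` [set x])).
  by split=> [y|/(_ x) h]; [left|apply/nSx/h; right].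
split=> [y [/SX//|-> //]|s [Ss|->]].
  have sx : s <> x by move=> sx; apply: nSx; rewrite -sx.
  have sub : (S `|` [set x]) `\ s `<=` (S `\ s) `|` [set x].
    by move=> y [[Sy|->] ys]; [left|right].
  move=> /(span_mono sub) /span_setU1 [c hc].
  have [c0|c0] := eqVneq c 0.
    by apply: (indS s Ss); rewrite -[X in span _ X]subr0 -(scale0r x) -c0.
  apply: nx; rewrite -[x](scalerK c0); apply: spanZ.
  rewrite -[c *: x](subKr s); apply: spanB.
    exact: span_sub.
  by apply: span_mono hc => y [].
move=> hx; apply: nx; apply: span_mono hx => y [[//|->]]; by case.
Qed.

(** Separate [s] from the span of [D] and the rest of [S]. With [D] the span of the other degrees of
    a grading, this extends the dual coordinates of one degree by zero. *)
Lemma independent_dual V (S : set V) s (D : set V) :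
  independent S -> subspace D -> (forall x, span S x -> D x -> x = 0) -> S s ->
  exists phi : {linear V -> k^o},
    [/\ phi s = 1, forall s', S s' -> s' <> s -> phi s' = 0 &
        forall d, D d -> phi d = 0].
Proof.
move=> indS sD SD Ss.
have [|phi [h1 h2]] := @ex_functional V (span ((S `\ s) `|` D)) s
  (subspace_span _).
  move=> hs; apply: (indS s Ss).
  have : exists2 d, D d & span (S `\ s) (s - d).
    move: hs; apply: (span_min (D := [set x | exists2 d, D d &
      span (S `\ s) (x - d)])).
      split=> [|a x y [d Dd hd] [d' Dd' hd']] /=.
        by exists 0; rewrite ?subr0; [exact: subspace0|exact: span0].
      exists (a *: d + d'); first exact: sD.2.
      by rewrite opprD addrACA -scalerBr; apply: (subspace_span _).2.
    move=> x [hx|Dx] /=.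
      by exists 0; rewrite ?subr0; [exact: subspace0|exact: span_sub].
    by exists x => //; rewrite subrr; exact: span0.
  move=> [d Dd hd]; suff d0 : d = 0 by rewrite -[X in span _ X]subr0 -d0.
  apply: SD => //; rewrite -(subKr s d); apply: spanB.
  - exact: span_sub.
  - by apply: span_mono hd => y [].
exists phi; split=> // [s' Ss' s's|d Dd]; apply: h1; apply: span_sub.
  by left; split.
by right.
Qed.

End LinearAlgebra.

(** * Cardinality of independent families *)

Section Cardinality.

Lemma ex_strict_well_order (T : eqType) : exists lt : rel T,
  [/\ transitive lt, irreflexive lt, forall x y, x <> y -> lt x y \/ lt y x &
      forall P : T -> Prop, (forall x, (forall y, lt y x -> P y) -> P x) ->
        forall x, P x].
Proof.
have [R Rwo] := wochoice.well_ordering_principle T.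
have Rwoc : wochoice.wo_chain R predT.
  by move=> A _; apply: Rwo.
have Rtot x y : R x y || R y x by apply: (wochoice.wo_chainW Rwoc).
have Ranti x y : R x y -> R y x -> x = y.
  by move=> xy yx; apply: (wochoice.wo_chain_antisymmetric Rwoc) => //; apply/andP.
have Rmin (P : T -> Prop) x : P x -> exists2 y, P y & forall z, P z -> R y z.
  move=> Px; have [|y [[Py miny] _]] := Rwo [pred z | `[< P z >]].
    by exists x; exact/asboolP.
  exists y; first exact/asboolP.
  by move=> z Pz; apply: miny; exact/asboolP.
have Rtrans : transitive R.
  move=> y x z xy yz.
  have [w] := Rmin (fun w => w = x \/ w = y \/ w = z) x (or_introl erefl).
  case=> [->|[->|->]] hw; first by apply: hw; right; right.
  - have yx := hw x (or_introl erefl).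
    by rewrite (Ranti _ _ xy yx).
  - have zy := hw y (or_intror (or_introl erefl)).
    by rewrite -(Ranti _ _ yz zy).
(* For a total antisymmetric [R] this is its strict part; induction then follows from a minimal
   counterexample. *)
exists (fun x y => ~~ R y x); split.
- move=> y x z nyx nzy; apply/negP => zx.
  have := Rtot x y; rewrite (negPf nyx) orbF => xy.
  by rewrite (Rtrans _ _ _ zx xy) in nzy.
- by move=> x; have := Rtot x x; rewrite orbb => ->.
- move=> x y xy; have [yx|] := boolP (R y x); last by left.
  by right; apply/negP => /Ranti -/(_ yx).
- move=> P IH x; apply: contrapT => nPx.
  have [y nPy miny] := Rmin (fun y => ~ P y) x nPx.
  by apply/nPy/IH => z; apply: contraNP => /miny.
Qed.

Lemma ex_maximal_seq (T : eqType) (lt : rel T) (P : T -> Prop) (s : seq T) x :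
  transitive lt -> irreflexive lt -> (forall y, P y -> y \in s) -> P x ->
  exists2 y, P y & forall z, P z -> ~ lt y z.
Proof.
move=> tr ir; elim: s P x => [|a s IH] P x Ps Px; first by have := Ps _ Px.
have [Pa|nPa] := pselect (P a); last first.
  apply: (IH _ x) => // y Py; have := Ps _ Py; rewrite inE => /orP[/eqP ya|//].
  by case: nPa; rewrite -ya.
have [[y [Py ay]]|no] := pselect (exists y, P y /\ lt a y); last first.
  by exists a => // z Pz az; apply: no; exists z.
have [||z [Pz az] zmax] := IH (fun y => P y /\ lt a y) y.
- move=> z [Pz az]; have := Ps _ Pz; rewrite inE => /orP[/eqP za|//].
  by rewrite za ir in az.
- by [].
exists z => // w Pw zw; apply: (zmax w) => //; split=> //; exact: tr zw.
Qed.

(* Order [I] and [J] well.  When [v i] is adjoined to the span of the previous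
   vectors a new leading coordinate appears, and these are distinct. *)
Lemma independent_le_coordinates (k : fieldType) (V : lmodType k)
    (I J : choiceType) (v : I -> V) (e : J -> {linear V -> k^o}) (Y : set V) :
  (forall i, ~ span (v @` [set i' | i' <> i]) (v i)) ->
  subspace Y -> (forall i, Y (v i)) ->
  (forall x, Y x -> (forall j, e j x = 0) -> x = 0) ->
  (forall x, Y x -> exists s : seq J, forall j, e j x <> 0 -> j \in s) ->
  exists f : I -> J, injective f.
Proof.
move=> ind sY Yv sep fin.
have [ltI [trI irI totI _]] := ex_strict_well_order I.
have [ltJ [trJ irJ totJ indJ]] := ex_strict_well_order J.
pose lead j x := e j x <> 0 /\ forall j', ltJ j j' -> e j' x = 0.
have ex_lead x : Y x -> x <> 0 -> exists j, lead j x.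
  move=> Yx x0; have [s hs] := fin x Yx.
  have [j ej] : exists j, e j x <> 0.
    by apply: contrapT => no; apply: x0; apply: sep => // j; apply: contrapT => ?;
      apply: no; exists j.
  have [j' ej' maxj'] := ex_maximal_seq trJ irJ hs ej.
  exists j'; split=> // j'' lt_; apply: contrapT => nz; exact: maxj' nz lt_.
pose Ld U j := exists2 x, U x & lead j x.
(* Gaussian elimination along a well-order: subtracting a multiple of some [y] in [U] with the same
   leading coordinate lowers the leading coordinate, so induction on it terminates. *)
have lead_sub (U U' : set V) : subspace U -> subspace U' -> U `<=` U' ->
    U' `<=` Y -> Ld U' `<=` Ld U -> U' `<=` U.
  move=> sU sU' UU' U'Y LL x U'x.
  have [->|x0] := pselect (x = 0); first exact: subspace0.
  have [j lj] := ex_lead x (U'Y _ U'x) x0.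
  elim/indJ: j x U'x lj {x0} => j IH x U'x lj.
  have [y Uy ly] : Ld U j by apply: LL; exists x.
  pose c : k := e j x / e j y; pose z := x - c *: y.
  have Uc : U (c *: y) by apply: subspaceZ.
  rewrite -[x](subrK (c *: y)) -/z; apply: subspaceD => //.
  have U'z : U' z by apply: subspaceB => //; apply: UU'.
  have [->|z0] := pselect (z = 0); first exact: subspace0.
  have [j' lj'] := ex_lead z (U'Y _ U'z) z0.
  have ejz i : e i z = e i x - c * e i y by rewrite linearB linearZ.
  apply: (IH j') => //; have jj' : j' <> j.
    move=> jj'; apply: lj'.1; rewrite jj' ejz /c divfK ?subrr //.
    by apply/eqP; exact: ly.1.
  have [//|jj''] := totJ _ _ jj'; case: lj'.1.
  by rewrite ejz lj.2 // ly.2 // mulr0 subr0.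
pose L i := span (v @` [set i' | ltI i' i]).
pose L' i := span (v @` [set i' | i' = i \/ ltI i' i]).
have LL' i : L i `<=` L' i.
  by apply: span_mono => _ [i' lt_ <-]; exists i' => //; right.
have L'L i i' : ltI i i' -> L' i `<=` L i'.
  move=> ii'; apply: span_mono => _ [j [->|ji] <-]; first by exists i.
  by exists j => //; apply: trI ji ii'.
have L'Y i : L' i `<=` Y by apply: span_min => // _ [i' _ <-].
(* If adjoining [v i] created no new leading coordinate, [L' i] would equal [L i] and [v i] would
   depend on its predecessors. *)
have /choice[f hf] : forall i, exists j, Ld (L' i) j /\ ~ Ld (L i) j.
  move=> i; apply: contrapT => no; apply: (ind i).
  have : L i (v i).
    apply: (lead_sub _ (L' i)); [exact: subspace_span|exact: subspace_span|
      exact: LL'|exact: L'Y|move=> j hj|].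
      by apply: contrapT => nj; apply: no; exists j.
    by apply: span_sub; exists i => //; left.
  apply: span_mono => _ [i' lt_ <-]; exists i' => //= ii'.
  by move: lt_; rewrite /= ii' irI.
exists f => i i' ff; apply: contrapT => ii'.
have key a b : ltI a b -> f a = f b -> False.
  move=> ab fab; have [_ nb] := hf b; apply: nb; rewrite -fab.
  by have [[x Lx lx] _] := hf a; exists x => //; apply: L'L Lx.
by have [h|h] := totI _ _ ii'; apply: key h _.
Qed.

End Cardinality.

(** * Contractions and convolution *)

Section TensorLinear.
Variables (k : fieldType) (U V W : lmodType k) (f : {linear (U ⊗ V)%type -> W}).

(* The generic lemmas on linear maps do not unify with the structure carried by
   a tensor product unless the map is given; linear maps are locked so that
   simplification keeps them packed. *)
Lemma tlinD x y : f (x + y) = f x + f y. Proof. exact: linearD. Qed.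
Lemma tlinB x y : f (x - y) = f x - f y. Proof. exact: linearB. Qed.
Lemma tlin_sum (I : Type) (r : seq I) (P : pred I) (F : I -> (U ⊗ V)%type) :
  f (\sum_(i <- r | P i) F i) = \sum_(i <- r | P i) f (F i).
Proof. exact: linear_sum. Qed.

Definition tlift (b : {bilinear U -> V -> W}) : {linear (U ⊗ V)%type -> W} :=
  locked (tens_lift b : {linear (U ⊗ V)%type -> W}).

Lemma tliftE b x : tlift b x = tens_lift b x.
Proof. by rewrite /tlift -lock. Qed.

Lemma tlift_pure b u v : tlift b (u ⊗ v) = b u v.
Proof. by rewrite tliftE tens_lift_pure. Qed.

End TensorLinear.

Lemma tens_map_sum (k : fieldType) (U V U' V' : lmodType k)
    (f : {linear U -> U'}) (g : {linear V -> V'}) (I : Type) (r : seq I)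
    (P : pred I) (F : I -> (U ⊗ V)%type) :
  tens_map f g (\sum_(i <- r | P i) F i) =
  \sum_(i <- r | P i) tens_map f g (F i).
Proof. exact: (tlin_sum (tens_map f g)). Qed.

Lemma tens_assoc_sum (k : fieldType) (U V W : lmodType k) (I : Type) (r : seq I)
    (P : pred I) (F : I -> (U ⊗ V ⊗ W)%type) :
  tens_assoc (\sum_(i <- r | P i) F i) = \sum_(i <- r | P i) tens_assoc (F i).
Proof. exact: (tlin_sum (@tens_assoc _ _ _ _)). Qed.

Section Contraction.
Variables (k : fieldType) (U V : lmodType k).

Lemma contract_fst_bilinear (phi : {linear U -> k^o}) :
  bilinear_for *:%R *:%R (fun (u : U) (v : V) => (phi u : k) *: v).
Proof.
by split=> w a u v; rewrite ?linearP //= scalerDl scalerA.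
Qed.

Lemma contract_snd_bilinear (psi : {linear V -> k^o}) :
  bilinear_for *:%R *:%R (fun (u : U) (v : V) => (psi v : k) *: u).
Proof.
by split=> w a u v; rewrite ?linearP //= scalerDl scalerA.
Qed.

Definition lfst (phi : {linear U -> k^o}) : {linear (U ⊗ V)%type -> V} :=
  tlift (bilinear_of (contract_fst_bilinear phi)).

Definition lsnd (psi : {linear V -> k^o}) : {linear (U ⊗ V)%type -> U} :=
  tlift (bilinear_of (contract_snd_bilinear psi)).

Lemma lfst_pure phi u v : lfst phi (u ⊗ v) = (phi u : k) *: v.
Proof. exact: tlift_pure. Qed.

Lemma lsnd_pure psi u v : lsnd psi (u ⊗ v) = (psi v : k) *: u.
Proof. exact: tlift_pure. Qed.

Lemma lfst_lsnd (phi : {linear U -> k^o}) (psi : {linear V -> k^o}) t :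
  psi (lfst phi t) = phi (lsnd psi t).
Proof.
apply: (@tens_lin_ext _ _ _ k^o (psi \o lfst phi) (phi \o lsnd psi)) => u v /=.
by rewrite lfst_pure lsnd_pure !linearZ; apply: mulrC.
Qed.

Lemma eq_lfst (phi phi' : {linear U -> k^o}) t :
  phi =1 phi' -> lfst phi t = lfst phi' t.
Proof.
move=> h; apply: (@tens_lin_ext _ _ _ _ (lfst phi) (lfst phi')) => u v.
by rewrite !lfst_pure h.
Qed.

Lemma eq_lsnd (psi psi' : {linear V -> k^o}) t :
  psi =1 psi' -> lsnd psi t = lsnd psi' t.
Proof.
move=> h; apply: (@tens_lin_ext _ _ _ _ (lsnd psi) (lsnd psi')) => u v.
by rewrite !lsnd_pure h.
Qed.

(* If [psi v = 1] for a term [u ⊗ v], the relation [lsnd psi t = 0] expresses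
   [u] through the other left factors, so that the number of terms of [t] can
   be decreased. *)
Lemma lsnd_eq0 (t : (U ⊗ V)%type) :
  (forall psi : {linear V -> k^o}, lsnd psi t = 0) -> t = 0.
Proof.
rewrite [t]tens_sum_pure; move: {t}(repr t) => s.
move: {2}(size s) (erefl (size s)) => n; elim: n s => [|n IH] [|p s] //=.
  by rewrite big_nil.
move=> [sz] h; rewrite big_cons.
have [v0|v0] := eqVneq p.2 0.
  rewrite v0 linear0r add0r; apply: IH => // psi; rewrite -[RHS](h psi).
  by rewrite big_cons v0 linear0r add0r.
have [|psi [_ psi1]] := ex_functional (x := p.2) (subspace_zero V).
  by move=> /= e; rewrite e eqxx in v0.
have := h psi; rewrite big_cons linearD lsnd_pure psi1 scale1r.
rewrite linear_sum => /eqP; rewrite addr_eq0 => /eqP p1.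
have E : p.1 ⊗ p.2 + \sum_(q <- s) q.1 ⊗ q.2 =
    \sum_(q <- [seq (q.1, q.2 - (psi q.2 : k) *: p.2) | q <- s]) q.1 ⊗ q.2.
  rewrite big_map /= p1 linearNl linear_sumlz /= -sumrN -big_split /=.
  apply: eq_bigr => q _; rewrite lsnd_pure linearBr addrC; congr (_ - _).
  by rewrite linearZl_LR linearZr_LR.
rewrite E; apply: IH; first by rewrite size_map.
by move=> th; rewrite -E -(h th) big_cons.
Qed.

Lemma lfst_eq0 (t : (U ⊗ V)%type) :
  (forall phi : {linear U -> k^o}, lfst phi t = 0) -> t = 0.
Proof.
move=> h; apply: lsnd_eq0 => psi; apply: functional_eq0 => phi.
by rewrite -lfst_lsnd h linear0.
Qed.

Lemma tens_separated (I J : Type) (e : I -> {linear U -> k^o})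
    (e' : J -> {linear V -> k^o}) (t t' : (U ⊗ V)%type) :
  (forall u, (forall i, e i u = 0) -> u = 0) ->
  (forall v, (forall j, e' j v = 0) -> v = 0) ->
  (forall i j, e' j (lfst (e i) t) = e' j (lfst (e i) t')) -> t = t'.
Proof.
move=> sepU sepV h; apply/eqP; rewrite -subr_eq0; apply/eqP.
apply: lsnd_eq0 => psi; apply: sepU => i; rewrite -lfst_lsnd.
suff -> : lfst (e i) (t - t') = 0 by rewrite linear0.
by apply: sepV => j; rewrite !linearB /= h subrr.
Qed.

Lemma tens_set_pure (D : set U) (E : set V) u v :
  D u -> E v -> tens_set D E (u ⊗ v).
Proof.
move=> Du Ev; exists [:: (u, v)]; last by rewrite big_seq1.
by move=> p; rewrite inE => /eqP ->.
Qed.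

End Contraction.

Arguments lfst {k U V} phi.
Arguments lsnd {k U V} psi.

Lemma lfst_map (k : fieldType) (U V U' V' : lmodType k) (f : {linear U -> U'})
    (g : {linear V -> V'}) (phi : {linear U' -> k^o}) t :
  lfst phi (tens_map f g t) = g (lfst (phi \o f) t).
Proof.
apply: (@tens_lin_ext _ _ _ _ (lfst phi \o tens_map f g)
  (g \o lfst (phi \o f))) => u v /=.
by rewrite tens_map_pure !lfst_pure linearZ.
Qed.

Lemma lsnd_map (k : fieldType) (U V U' V' : lmodType k) (f : {linear U -> U'})
    (g : {linear V -> V'}) (psi : {linear V' -> k^o}) t :
  lsnd psi (tens_map f g t) = f (lsnd (psi \o g) t).
Proof.
apply: (@tens_lin_ext _ _ _ _ (lsnd psi \o tens_map f g)
  (f \o lsnd (psi \o g))) => u v /=.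
by rewrite tens_map_pure !lsnd_pure linearZ.
Qed.

Section Convolution.
Variables (k : fieldType) (C : coalgebra k).
Implicit Types phi psi chi : {linear C -> k^o}.

(** With [actr], the bimodule structure of [C] over its dual algebra, in which [conv] is the
    convolution product. Coassociativity becomes the associativity and the commutation of these
    actions. *)
Definition actl phi : {linear C -> C} := 
  locked (lfst phi \o comul C : {linear C -> C}).
Definition actr psi : {linear C -> C} := 
  locked (lsnd psi \o comul C : {linear C -> C}).
Definition conv phi psi : {linear C -> k^o} := 
  locked (psi \o actl phi : {linear C -> k^o}).

Lemma actlE phi x : actl phi x = lfst phi (comul C x).
Proof. by rewrite /actl -lock. Qed.

Lemma actrE psi x : actr psi x = lsnd psi (comul C x).
Proof. by rewrite /actr -lock. Qed.

Lemma convEl phi psi x : conv phi psi x = psi (actl phi x).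
Proof. by rewrite /conv -lock. Qed.

Lemma convEr phi psi x : conv phi psi x = phi (actr psi x).
Proof. by rewrite convEl actlE actrE lfst_lsnd. Qed.

Lemma conv_sum phi psi x (s : seq (C * C)) :
  comul C x = \sum_(p <- s) p.1 ⊗ p.2 ->
  conv phi psi x = \sum_(p <- s) (phi p.1 : k) * psi p.2.
Proof.
move=> e; rewrite convEl actlE e !linear_sum /=.
by apply: eq_bigr => p _; rewrite lfst_pure linearZ.
Qed.

(** Coassociativity with [phi] contracting the first leg and [psi] the second, the third being left
    free. *)
Lemma actl_actl phi psi x : actl psi (actl phi x) = actl (conv phi psi) x.
Proof.
have := congr1 (lfst psi \o lfst phi) (comul_coassoc x) => /=.
rewrite lfst_map (@eq_lfst _ _ _ (phi \o idfun) phi) // !actlE => <-.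
rewrite {1}[comul C x]tens_sum_pure [in RHS](tens_sum_pure (comul C x)).
rewrite tens_map_sum tens_assoc_sum !tlin_sum; apply: eq_bigr => -[u w] _ /=.
rewrite tens_map_pure lfst_pure convEl actlE.
rewrite (tens_sum_pure (comul C u)) linear_sumlz tens_assoc_sum !tlin_sum linear_sum /= scaler_suml.
apply: eq_bigr => -[a b] _ /=.
by rewrite tens_assoc_pure !lfst_pure !linearZ /= lfst_pure scalerA.
Qed.

(** Coassociativity with both outer legs contracted. *)
Lemma actl_actr phi psi x : actl psi (actr phi x) = actr phi (actl psi x).
Proof.
have := congr1 (lsnd phi \o lfst psi) (comul_coassoc x) => /=.
rewrite lfst_map (@eq_lfst _ _ _ (psi \o idfun) psi) // !actlE !actrE => <-.
rewrite (tens_sum_pure (comul C x)).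
rewrite tens_map_sum tens_assoc_sum !tlin_sum !linear_sum.
apply: eq_bigr => -[u w] _ /=.
rewrite tens_map_pure lsnd_pure !linearZ /=.
rewrite (tens_sum_pure (comul C u)) linear_sumlz tens_assoc_sum !tlin_sum.
rewrite scaler_sumr; apply: eq_bigr => -[a b] _ /=.
by rewrite tens_assoc_pure !lfst_pure !linearZ /= lsnd_pure !scalerA mulrC.
Qed.

Lemma conv_assoc phi psi chi x :
  conv phi (conv psi chi) x = conv (conv phi psi) chi x.
Proof. by rewrite !convEl actl_actl. Qed.

Lemma actr_actr phi psi x : actr phi (actr psi x) = actr (conv phi psi) x.
Proof.
apply: functional_ext => th.
by rewrite -(convEr th phi) -(convEr (conv th phi) psi) -conv_assoc convEr.
Qed.

Lemma eq_conv phi psi phi' psi' x :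
  phi =1 phi' -> psi =1 psi' -> conv phi psi x = conv phi' psi' x.
Proof. by move=> h1 h2; rewrite !convEl h2 !actlE (eq_lfst _ h1). Qed.

Lemma counit_linear : linear (counit C : C -> k^o).
Proof. exact: (linearP (counit C)). Qed.

Definition counit_dual : {linear C -> k^o} :=
  locked (linear_of counit_linear).

Lemma counit_dualE x : counit_dual x = counit C x.
Proof. by rewrite /counit_dual -lock. Qed.

Lemma actl_counit x : actl counit_dual x = x.
Proof.
rewrite -[RHS](counit_comul x) actlE.
apply: (@tens_lin_ext _ _ _ _ _ (tens_lift (scale_fst (counit C)))) => u v.
by rewrite lfst_pure counit_dualE [RHS]tens_lift_pure.
Qed.

Lemma actr_counit x : actr counit_dual x = x.
Proof.
rewrite -[RHS](comul_counit x) actrE.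
apply: (@tens_lin_ext _ _ _ _ _ (tens_lift (scale_snd (counit C)))) => u v.
by rewrite lsnd_pure counit_dualE [RHS]tens_lift_pure.
Qed.

End Convolution.

(** * Tensor products of coalgebras *)

Section Shuffle.
Variables (k : fieldType) (U V U' V' : lmodType k).

Lemma pure_linear_r (U0 V0 : lmodType k) (u : U0) :
  linear (fun v : V0 => u ⊗ v : (U0 ⊗ V0)%type).
Proof. by move=> a x y; rewrite linearPr. Qed.

(** [shuffle] exchanges the two middle factors and is linear in four arguments, whereas [tlift]
    takes two. Fixed [u] and [v] are treated here, [shuffle_bil] replaces them by a tensor, and a
    last lift turns the pair of tensors into one argument. *)
Definition shuffle_map (u : U) (v : V) (y : (U' ⊗ V')%type) :
    (U ⊗ U' ⊗ (V ⊗ V'))%type :=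
  tens_map (linear_of (@pure_linear_r U U' u)) (linear_of (@pure_linear_r V V' v)) y.

Lemma shuffle_map_sum u v (s : seq (U' * V')) :
  shuffle_map u v (\sum_(p <- s) p.1 ⊗ p.2) =
  \sum_(p <- s) (u ⊗ p.1) ⊗ (v ⊗ p.2).
Proof.
rewrite /shuffle_map tens_map_sum; apply: eq_bigr => p _.
by rewrite tens_map_pure.
Qed.

Lemma shuffle_map_bilinear y :
  bilinear_for *:%R *:%R (fun u v => shuffle_map u v y).
Proof.
by split=> w a u v; rewrite /= (tens_sum_pure y) !shuffle_map_sum scaler_sumr
  -big_split; apply: eq_bigr => p _ /=; rewrite linearPl ?linearPr ?linearPl.
Qed.

Definition shuffle_bil (x : (U ⊗ V)%type) (y : (U' ⊗ V')%type) :
    (U ⊗ U' ⊗ (V ⊗ V'))%type :=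
  tlift (bilinear_of (shuffle_map_bilinear y)) x.

Lemma shuffle_bil_sum (s : seq (U * V)) (s' : seq (U' * V')) :
  shuffle_bil (\sum_(p <- s) p.1 ⊗ p.2) (\sum_(q <- s') q.1 ⊗ q.2) =
  \sum_(p <- s) \sum_(q <- s') (p.1 ⊗ q.1) ⊗ (p.2 ⊗ q.2).
Proof.
rewrite /shuffle_bil tlin_sum; apply: eq_bigr => p _.
by rewrite tlift_pure /= shuffle_map_sum.
Qed.

Lemma shuffle_bil_bilinear : bilinear_for *:%R *:%R shuffle_bil.
Proof.
split=> w a x y; first exact: (linearP (tlift _)).
rewrite /= (tens_sum_pure w) /shuffle_bil !tlin_sum.
rewrite -big_split; apply: eq_bigr => p _ /=.
by rewrite !tlift_pure /= /shuffle_map (linearP (tens_map _ _)).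
Qed.

Definition shuffle : {linear ((U ⊗ V) ⊗ (U' ⊗ V'))%type ->
    (U ⊗ U' ⊗ (V ⊗ V'))%type} :=
  tlift (bilinear_of shuffle_bil_bilinear).

Lemma shuffle_sum (s : seq (U * V)) (s' : seq (U' * V')) :
  shuffle ((\sum_(p <- s) p.1 ⊗ p.2) ⊗ (\sum_(q <- s') q.1 ⊗ q.2)) =
  \sum_(p <- s) \sum_(q <- s') (p.1 ⊗ q.1) ⊗ (p.2 ⊗ q.2).
Proof. by rewrite [LHS]tlift_pure /= shuffle_bil_sum. Qed.

Lemma shuffle_pure u v u' v' :
  shuffle ((u ⊗ v) ⊗ (u' ⊗ v')) = (u ⊗ u') ⊗ (v ⊗ v').
Proof.
by have := shuffle_sum [:: (u, v)] [:: (u', v')]; rewrite !big_seq1.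
Qed.

Lemma shuffle_expand x y : shuffle (x ⊗ y) =
  \sum_(p <- repr x) \sum_(q <- repr y) (p.1 ⊗ q.1) ⊗ (p.2 ⊗ q.2).
Proof. by rewrite {1}[x]tens_sum_pure {1}[y]tens_sum_pure shuffle_sum. Qed.

End Shuffle.

Arguments shuffle {k U V U' V'}.

Section TensorCoalgebra.
Variables (k : fieldType) (C D : coalgebra k).

Definition tens_comul : {linear (C ⊗ D)%type -> ((C ⊗ D) ⊗ (C ⊗ D))%type} :=
  locked (@shuffle k C C D D \o tens_map (comul C) (comul D)
    : {linear (C ⊗ D)%type -> ((C ⊗ D) ⊗ (C ⊗ D))%type}).

Lemma tens_comul_pure c d :
  tens_comul (c ⊗ d) = shuffle (comul C c ⊗ comul D d).
Proof. by rewrite /tens_comul -lock /= tens_map_pure. Qed.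

Lemma tens_counit_bilinear :
  bilinear_for *:%R *:%R (fun c d => counit C c * counit D d : k^o).
Proof.
split=> w a u v; rewrite linearP /= (mulrDl, mulrDr); congr (_ + _).
  by rewrite -[LHS]mulrA.
exact: mulrCA.
Qed.

Lemma tens_counit_linear :
  linear_for *%R (tlift (bilinear_of tens_counit_bilinear) : (C ⊗ D)%type -> k).
Proof. exact: (linearP (tlift (bilinear_of tens_counit_bilinear))). Qed.

Definition tens_counit : {scalar (C ⊗ D)%type} :=
  locked (HB.pack_for {scalar (C ⊗ D)%type}
    (tlift (bilinear_of tens_counit_bilinear) : (C ⊗ D)%type -> k)
    (GRing.isLinear.Build k (C ⊗ D)%type k *%R _ tens_counit_linear)).

Lemma tens_counit_pure c d : tens_counit (c ⊗ d) = counit C c * counit D d.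
Proof. by rewrite /tens_counit -lock [LHS]tlift_pure. Qed.

Lemma tens_comul_coassoc x :
  tens_assoc (tens_map tens_comul idfun (tens_comul x)) =
  tens_map idfun tens_comul (tens_comul x).
Proof.
pose f : {linear (C ⊗ D)%type -> _} := @tens_assoc _ _ _ _ \o
  (tens_map tens_comul idfun \o tens_comul).
pose g : {linear (C ⊗ D)%type -> _} := tens_map idfun tens_comul \o tens_comul.
apply: (@tens_lin_ext _ _ _ _ f g) => c d; rewrite /f /g /= {x f g}.
rewrite tens_comul_pure shuffle_expand.
(* [T] regroups a pair of triple tensors leg by leg. Both sides become [T] of an iterated
   comultiplication of [c] and one of [d], and coassociativity applies in each argument
   separately. *)
pose T x y := tens_map idfun (@shuffle k C C D D)
  (@shuffle k C (C ⊗ C)%type D (D ⊗ D)%type (x ⊗ y)).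
have T_sum (I J : Type) (r : seq I) (r' : seq J) F G :
    T (\sum_(i <- r) F i) (\sum_(j <- r') G j) =
    \sum_(i <- r) \sum_(j <- r') T (F i) (G j).
  rewrite /T linear_sumlz tlin_sum tens_map_sum; apply: eq_bigr => i' _.
  by rewrite linear_sumr tlin_sum tens_map_sum.
have T_pure u x v y : T (u ⊗ x) (v ⊗ y) = (u ⊗ v) ⊗ shuffle (x ⊗ y).
  by rewrite /T shuffle_pure tens_map_pure.
transitivity (T (tens_assoc (tens_map (comul C) idfun (comul C c)))
                (tens_assoc (tens_map (comul D) idfun (comul D d)))).
  rewrite [X in T (_ (_ X)) _]tens_sum_pure [X in T _ (_ (_ X))]tens_sum_pure.
  rewrite !tens_map_sum !tens_assoc_sum T_sum; apply: eq_bigr => p _.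
  rewrite tens_map_sum tens_assoc_sum; apply: eq_bigr => q _.
  rewrite !tens_map_pure tens_comul_pure shuffle_expand.
  rewrite [X in T (_ (X ⊗ _))]tens_sum_pure [X in T _ (_ (X ⊗ _))]tens_sum_pure.
  rewrite !linear_sumlz !tens_assoc_sum T_sum; apply: eq_bigr => a _.
  rewrite linear_sumlz tens_assoc_sum; apply: eq_bigr => b _.
  by rewrite !tens_assoc_pure T_pure shuffle_pure.
rewrite !comul_coassoc [X in T (_ X)]tens_sum_pure [X in T _ (_ X)]tens_sum_pure.
rewrite !tens_map_sum T_sum; apply: eq_bigr => p _.
rewrite tens_map_sum; apply: eq_bigr => q _.
by rewrite !tens_map_pure T_pure tens_comul_pure.
Qed.

Lemma tens_counitl x : tens_lift (scale_fst tens_counit) (tens_comul x) = x.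
Proof.
rewrite -(tliftE (scale_fst tens_counit)).
pose f : {linear (C ⊗ D)%type -> _} := tlift (scale_fst tens_counit) \o tens_comul.
apply: (@tens_lin_ext _ _ _ _ f idfun) => c d; rewrite /f /= {x f}.
rewrite tens_comul_pure shuffle_expand tlin_sum.
rewrite -[c in RHS](counit_comul c) -[d in RHS](counit_comul d).
rewrite -!(tliftE (scale_fst (counit _))).
rewrite [in RHS](tens_sum_pure (comul C c)) [in RHS](tens_sum_pure (comul D d)).
rewrite !tlin_sum linear_sumlz; apply: eq_bigr => p _.
rewrite tlin_sum linear_sumr; apply: eq_bigr => q _.
rewrite (tlift_pure (scale_fst tens_counit)) !(tlift_pure (scale_fst (counit _))).
rewrite /= /scale_fst tens_counit_pure.
by rewrite linearZl_LR linearZr_LR; symmetry; apply: scalerA.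
Qed.

Lemma tens_counitr x : tens_lift (scale_snd tens_counit) (tens_comul x) = x.
Proof.
rewrite -(tliftE (scale_snd tens_counit)).
pose f : {linear (C ⊗ D)%type -> _} := tlift (scale_snd tens_counit) \o tens_comul.
apply: (@tens_lin_ext _ _ _ _ f idfun) => c d; rewrite /f /= {x f}.
rewrite tens_comul_pure shuffle_expand tlin_sum.
rewrite -[c in RHS](comul_counit c) -[d in RHS](comul_counit d).
rewrite -!(tliftE (scale_snd (counit _))).
rewrite [in RHS](tens_sum_pure (comul C c)) [in RHS](tens_sum_pure (comul D d)).
rewrite !tlin_sum linear_sumlz; apply: eq_bigr => p _.
rewrite tlin_sum linear_sumr; apply: eq_bigr => q _.
rewrite (tlift_pure (scale_snd tens_counit)) !(tlift_pure (scale_snd (counit _))).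
rewrite /= /scale_snd tens_counit_pure.
by rewrite linearZl_LR linearZr_LR; symmetry; apply: scalerA.
Qed.

Definition tens_coalgebra : coalgebra k :=
  Coalgebra tens_comul_coassoc tens_counitl tens_counitr.

End TensorCoalgebra.

(** * Coalgebra maps into a path coalgebra *)

Definition coalgebra_map (k : fieldType) (C D : coalgebra k)
    (h : {linear C -> D}) : Prop :=
  forall x, comul D (h x) = tens_map h h (comul C x).

Lemma conv_map (k : fieldType) (C D : coalgebra k) (h : {linear C -> D})
    (phi psi : {linear D -> k^o}) x : coalgebra_map h ->
  conv phi psi (h x) = conv (phi \o h) (psi \o h) x.
Proof. by move=> hh; rewrite !convEl !actlE hh lfst_map. Qed.

Section PathCoefficients.
Variables (k : fieldType) (Q : quiver).
Local Notation kQ := (path_coalgebra k Q).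
Local Notation vec := (@path_vec k Q : qpath Q -> kQ).

Lemma coeff_linear (p : qpath Q) : linear (coeff p : kQ -> k^o).
Proof. by move=> a x y; rewrite coeffD coeffZ. Qed.

Definition pcoef (p : qpath Q) : {linear kQ -> k^o} :=
  locked (linear_of (coeff_linear p)).

Lemma pcoefE p x : pcoef p x = coeff p x.
Proof. by rewrite /pcoef -lock. Qed.

Lemma pcoef_vec p q : pcoef p (vec q) = (q == p)%:R.
Proof. by rewrite pcoefE /path_vec coeffU mul1r. Qed.

Lemma pcoef_eq (x y : kQ) : (forall p, pcoef p x = pcoef p y) -> x = y.
Proof. by move=> h; apply/eqP/freeg_eqP => p; have := h p; rewrite !pcoefE. Qed.

Lemma pcoef_eq0 (x : kQ) : (forall p, pcoef p x = 0) -> x = 0.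
Proof. by move=> h; apply: pcoef_eq => p; rewrite h linear0. Qed.

Lemma path_expand (x : kQ) : x = \sum_(p <- dom x) (pcoef p x : k) *: vec p.
Proof.
by rewrite {1}[x]path_sumE; apply: eq_bigr => p _; rewrite pcoefE.
Qed.

Lemma mem_dom_pcoef p (x : kQ) : (p \in dom x) = (pcoef p x != 0).
Proof. by rewrite mem_dom pcoefE. Qed.

Lemma path_degreeP n (x : kQ) :
  path_degree n x <-> forall p, qlength p <> n -> pcoef p x = 0.
Proof.
split=> [h p pn|h p].
  by apply/eqP; apply: contra_notT pn; rewrite -mem_dom_pcoef => /h.
by rewrite mem_dom_pcoef => /eqP px; apply: contrapT => /h.
Qed.

(** Indexed by arbitrary words, with value zero off the walks, so that inductions on the word carry
    no proof of composability. *)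
Definition wcoef (x : vertex Q) (s : seq (arrow Q)) : {linear kQ -> k^o} :=
  if insub (x, s) is Some p then pcoef p else [the {linear kQ -> k^o} of \0].

Lemma wcoef_vec x s p : wcoef x s (vec p) = (qpath_val p == (x, s))%:R.
Proof.
rewrite /wcoef; case: insubP => [q _ <-|nw]; first by rewrite pcoef_vec.
by case: eqP => // e; rewrite -e qpathP in nw.
Qed.

Lemma wcoef_path p : wcoef (qpath_val p).1 (qpath_val p).2 = pcoef p.
Proof. by rewrite /wcoef -surjective_pairing valK. Qed.

Lemma wcoef_nwalk x s y : ~~ walk x s -> wcoef x s y = 0.
Proof. by move=> h; rewrite /wcoef insubN. Qed.

(** Only the cut after [s] contributes. The left tensor factor is the part traversed last, whence
    [s ++ t]; words that do not compose give zero on both sides. *)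
Lemma conv_wcoef z t x s y : conv (wcoef z t) (wcoef x s) y =
  (z == walk_end x s)%:R * wcoef x (s ++ t) y.
Proof.
pose f : {linear kQ -> k^o} := (z == walk_end x s)%:R \*: wcoef x (s ++ t).
rewrite -[RHS]/(f y).
apply: (@path_lin_ext k Q k^o (conv (wcoef z t) (wcoef x s)) f) => p.
rewrite /f /= convEl actlE [comul kQ _]path_comul_vecE.
rewrite tlin_sum linear_sum wcoef_vec.
transitivity (\sum_(0 <= i < (qlength p).+1)
   ((qpath_val (qdrop i p) == (z, t)) && (qpath_val (qtake i p) == (x, s)))%:R : k^o).
  apply: eq_bigr => i _; rewrite lfst_pure linearZ /= !wcoef_vec.
  by rewrite -mulnb natrM.
case: p => -[p1 l] pw; rewrite /qlength /= !xpair_eqE.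
have [/andP[/eqP-> /eqP ->]|neq] := boolP ((p1 == x) && (l == s ++ t)).
  rewrite (bigD1_seq (size s)) ?mem_index_iota ?iota_uniq ?ltnS ?size_cat
    ?leq_addr //= take_size_cat // drop_size_cat // !xpair_eqE !eqxx andbT.
  rewrite big_seq_cond big1 ?addr0 ?andbT /= ?(eq_sym z).
    by symmetry; apply: mulr1.
  move=> i /andP[]; rewrite mem_index_iota ltnS => ile /eqP neq.
  rewrite !xpair_eqE.
  case: eqP => //= _; case: eqP => //= ht; case: eqP => //= hs.
  case: eqP => // /(congr1 size); rewrite size_takel ?size_cat // => e.
rewrite [RHS]mulr0 big1 // => i _; rewrite !xpair_eqE.
case: eqP => //= _; case: eqP => //= ht; case: eqP => //= px.
case: eqP => //= hs; move: neq; rewrite px eqxx -ht -hs cat_take_drop.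
by rewrite eqxx.
Qed.

(* A coalgebra map into a path coalgebra is determined by its components of
   degree [0] and [1]: the coefficient of a longer path is a convolution
   product of coefficients of shorter ones. *)
Lemma path_map_unique (C : coalgebra k) (h h' : {linear C -> kQ}) :
  coalgebra_map h -> coalgebra_map h' ->
  (forall v x, wcoef v [::] (h x) = wcoef v [::] (h' x)) ->
  (forall a x, wcoef (src a) [:: a] (h x) = wcoef (src a) [:: a] (h' x)) ->
  h =1 h'.
Proof.
move=> hh hh' h0 h1 y; apply: pcoef_eq => p; rewrite -wcoef_path.
case: p => -[/= x s] _; elim: s x y => [|a s IH] x y; first exact: h0.
have split g : coalgebra_map g -> wcoef x (a :: s) (g y) =
    conv (wcoef (tgt a) s \o g) (wcoef x [:: a] \o g) y :> k.
  move=> hg; rewrite -conv_map // conv_wcoef.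
  by rewrite eqxx mul1r.
rewrite !split //; apply: eq_conv => u /=; first exact: IH.
have [<-|nx] := eqVneq (src a) x; first exact: h1.
by rewrite !wcoef_nwalk //= (negPf nx).
Qed.


(** Elements of the path space have finite support, so coefficients can be prescribed when only
    finitely many of them are nonzero at each [y]. *)
Lemma ex_path_map (V : lmodType k) (lam : qpath Q -> {linear V -> k^o}) :
  (forall y, exists l : seq (qpath Q), forall p, lam p y <> 0 -> p \in l) ->
  exists h : {linear V -> kQ}, forall p y, pcoef p (h y) = lam p y.
Proof.
move=> fin.
have /choice[h hh] : forall y, exists x : kQ, forall p, pcoef p x = lam p y.
  move=> y; have [l hl] := fin y.
  exists (\sum_(p <- undup l) (lam p y : k) *: vec p) => q.
  have [ql|nql] := boolP (q \in l); last first.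
    have -> : lam q y = 0 by apply: contrapT => /hl ql; rewrite ql in nql.
    rewrite linear_sum big_seq big1 // => p; rewrite mem_undup => pl.
    rewrite linearZ /= pcoef_vec; case: eqP => [pq|_]; last exact: mulr0.
    by rewrite -pq pl in nql.
  rewrite linear_sum (bigD1_seq q) ?undup_uniq ?mem_undup //= big1.
    by rewrite addr0 linearZ /= pcoef_vec eqxx; apply: mulr1.
  move=> p /negPf pq; rewrite linearZ /= pcoef_vec pq; exact: mulr0.
have lin_h : linear h.
  by move=> a x y; apply: pcoef_eq => p; rewrite hh !linearP /= !hh.
by exists (linear_of lin_h).
Qed.

End PathCoefficients.

Arguments pcoef {k Q} p.
Arguments wcoef {k Q} x s.

(** * Existence of coalgebra maps with prescribed vertex and arrow coefficients *)

Section Existence.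
Variables (k : fieldType) (Q : quiver) (C : coalgebra k) (D : nat -> set C).
Local Notation kQ := (path_coalgebra k Q).

(** The [D n] may be sets of homogeneous generators, such as [path_grading], instead of subspaces;
    identities on tensor products of path coalgebras can then be tested on pairs of paths. *)
Definition comul_graded : Prop :=
  (forall x, span (\bigcup_n D n) x) /\
  (forall n x, D n x -> exists s : seq (nat * (C * C)),
     (forall z, z \in s -> [/\ (z.1 <= n)%N, D z.1 z.2.1 & D (n - z.1)%N z.2.2]) /\
     comul C x = \sum_(z <- s) z.2.1 ⊗ z.2.2).

Lemma graded_lin_ext (V : lmodType k) (f g : {linear C -> V}) :
  comul_graded -> (forall n x, D n x -> f x = g x) -> f =1 g.
Proof.
move=> [spanD _] h x; have := spanD x.
apply: (span_min (D := [set x | f x = g x])); last by move=> y [n _ /h].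
split=> [|a u v /= hu hv]; first by rewrite /= !linear0.
by rewrite !linearP hu hv.
Qed.

Lemma conv_graded (phi psi : {linear C -> k^o}) i j : comul_graded ->
  (forall m x, D m x -> m <> i -> phi x = 0) ->
  (forall m x, D m x -> m <> j -> psi x = 0) ->
  forall n x, D n x -> n <> (i + j)%N -> conv phi psi x = 0.
Proof.
move=> gD hphi hpsi n x gx nij; have [s [hs es]] := gD.2 _ _ gx.
rewrite convEl actlE es tlin_sum linear_sum big_seq big1 // => z /hs[z1 z2 z3].
rewrite lfst_pure linearZ /=; have [zi|/eqP zi] := eqVneq z.1 i; last first.
  by rewrite (hphi _ _ z2) // scale0r.
rewrite (hpsi _ _ z3) ?scaler0 // => e; apply: nij.
by rewrite -zi -e subnKC.
Qed.

(* The relations between the vertex and arrow coefficients of a coalgebra map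
   into the path coalgebra. *)
Record dual_path_system (lv : vertex Q -> {linear C -> k^o})
    (la : arrow Q -> {linear C -> k^o}) : Prop := {
  dps_vv : forall v w n x, D n x ->
    conv (lv v) (lv w) x = (w == v)%:R * (lv v x : k);
  dps_va : forall v a n x, D n x ->
    conv (lv v) (la a) x = (v == tgt a)%:R * (la a x : k);
  dps_av : forall v a n x, D n x ->
    conv (la a) (lv v) x = (v == src a)%:R * (la a x : k);
  dps_deg_v : forall v n x, D n x -> n <> 0%N -> lv v x = 0;
  dps_deg_a : forall a n x, D n x -> n <> 1%N -> la a x = 0;
  dps_fin_v : forall n x, D n x ->
    exists s : seq (vertex Q), forall v, lv v x <> 0 -> v \in s;
  dps_fin_a : forall n x, D n x ->
    exists s : seq (arrow Q), forall a, la a x <> 0 -> a \in s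
}.

Lemma finite_support_ext (I : eqType) (l : I -> {linear C -> k^o}) :
  comul_graded ->
  (forall n x, D n x -> exists s : seq I, forall i, l i x <> 0 -> i \in s) ->
  forall x, exists s : seq I, forall i, l i x <> 0 -> i \in s.
Proof.
move=> [spanD _] h x; have := spanD x.
apply: (span_min (D := [set x | exists s : seq I, forall i, l i x <> 0 -> i \in s]));
  last by move=> y [n _ /h].
split=> [|a u v /= [s hs] [t ht]]; first by exists [::] => i; rewrite linear0.
exists (s ++ t) => i nz; rewrite mem_cat.
have [/hs ->//|/contrapT u0] := pselect (l i u <> 0).
rewrite ht ?orbT // => v0; apply: nz.
by rewrite linearP /= u0 v0 addr0; apply: mulr0.
Qed.

Variables (lv : vertex Q -> {linear C -> k^o}) (la : arrow Q -> {linear C -> k^o}).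

(** These are the values forced by [path_map_unique]. The first arrow traversed is the right-hand
    factor, as the comultiplication puts the later part of a path on the left. *)
Fixpoint walk_dual (x : vertex Q) (s : seq (arrow Q)) : {linear C -> k^o} :=
  if s is a :: s' then conv (walk_dual (tgt a) s') (la a) else lv x.

(** [walk_dual] satisfies the identity [conv_wcoef] of path coefficients, which makes [h]
    comultiplicative. What remains is finiteness of the support of [h y]: finitely many words of
    each length ([fin_n]), and a bound on the length which comes from the grading ([bound]). *)
Theorem ex_graded_path_map : comul_graded -> dual_path_system lv la ->
  exists h : {linear C -> kQ},
    [/\ coalgebra_map h,
        forall v x, wcoef v [::] (h x) = lv v x,
        forall a x, wcoef (src a) [:: a] (h x) = la a x &
        forall n x, D n x -> path_degree n (h x)].
Proof.
move=> gD dps.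
have vv v w x : conv (lv v) (lv w) x = (w == v)%:R * (lv v x : k).
  apply: (graded_lin_ext (g := [the {linear C -> k^o} of (w == v)%:R \*: lv v]) gD).
  by move=> n y /(dps_vv dps).
have va v a x : conv (lv v) (la a) x = (v == tgt a)%:R * (la a x : k).
  apply: (graded_lin_ext (g := [the {linear C -> k^o} of (v == tgt a)%:R \*: la a]) gD).
  by move=> n y /(dps_va dps).
have av v a x : conv (la a) (lv v) x = (v == src a)%:R * (la a x : k).
  apply: (graded_lin_ext (g := [the {linear C -> k^o} of (v == src a)%:R \*: la a]) gD).
  by move=> n y /(dps_av dps).
have finv := finite_support_ext gD (dps_fin_v dps).
have fina := finite_support_ext gD (dps_fin_a dps).
have walk_v z t v y : walk z t ->
    conv (walk_dual z t) (lv v) y = (v == z)%:R * (walk_dual z t y : k).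
  case: t => [|a t] /=; first by rewrite vv.
  by case/andP=> [/eqP <- _]; rewrite -conv_assoc convEl av -convEl.
have walk_walk z t x s y : walk z t -> walk x s ->
    conv (walk_dual z t) (walk_dual x s) y =
    (z == walk_end x s)%:R * (walk_dual x (s ++ t) y : k).
  move=> wt; elim: s x y => [|a s IH] x y /=.
    by move=> _; rewrite walk_v // eq_sym; have [->|] := eqVneq x z;
      rewrite // !mul0r.
  by case/andP=> _ ws; rewrite conv_assoc convEr IH // -convEr.
have deg s x n y : D n y -> size s <> n -> walk_dual x s y = 0.
  elim: s x n y => [|a s IH] x n y Dy /= sn.
    by apply: (dps_deg_v dps _ Dy); exact: nesym.
  have [r [hr ey]] := gD.2 _ _ Dy.
  rewrite convEl actlE ey tlin_sum linear_sum big_seq big1 // => z /hr[zn D1 D2].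
  rewrite lfst_pure linearZ /=.
  have [sz|sz] := eqVneq (size s) z.1; last first.
    by rewrite (IH _ _ _ D1) ?scale0r //; apply/eqP.
  rewrite (dps_deg_a dps _ D2); first exact: mulr0.
  by move=> e; apply: sn; rewrite sz -(subnK zn) e.
(* A nonzero value at a word of length [n.+1] needs a term of [comul C y] whose left factor meets
   the tail of the word and whose right factor meets its first arrow: finitely many choices. *)
have fin_n n y : exists l : seq (vertex Q * seq (arrow Q)), forall x s,
    size s = n -> walk x s -> walk_dual x s y <> 0 -> (x, s) \in l.
  elim: n y => [|n IH] y.
    have [l hl] := finv y; exists [seq (v, [::]) | v <- l] => x [|//] _ _ /= nz.
    by apply: map_f; apply: hl.
  have /choice[lp hlp] := IH; have /choice[lq hlq] := fina.
  pose r := repr (comul C y).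
  pose L := flatten [seq lp p.1 | p <- r]; pose M := flatten [seq lq p.2 | p <- r].
  exists [seq (src a, a :: xs.2) | xs <- L, a <- M] => x [//|a s] [sn] /=.
  case/andP=> /eqP <- ws nz.
  have [p [pr n1 n2]] : exists p, [/\ p \in r, walk_dual (tgt a) s p.1 <> 0 &
      la a p.2 <> 0].
    apply: contrapT => no; apply: nz.
    rewrite convEl actlE (tens_sum_pure (comul C y)) tlin_sum linear_sum.
    rewrite big_seq big1 // => p pr; rewrite lfst_pure linearZ /=.
    have [->|n1] := pselect (walk_dual (tgt a) s p.1 = 0); first exact: mul0r.
    have [->|n2] := pselect (la a p.2 = 0); first exact: mulr0.
    by case: no; exists p.
  apply/allpairsP; exists ((tgt a, s), a); split=> //=.
    by apply/flatten_mapP; exists p => //; apply: hlp.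
  by apply/flatten_mapP; exists p => //; apply: hlq.
have bound y : exists N, forall x s, (N <= size s)%N -> walk_dual x s y = 0.
  have := gD.1 y.
  apply: (span_min (D := [set y | exists N, forall x s, (N <= size s)%N ->
    walk_dual x s y = 0])).
    split=> [|a u v /= [M hM] [N hN]]; first by exists 0%N => x s _; rewrite linear0.
    exists (maxn M N) => x s; rewrite geq_max => /andP[/hM h1 /hN h2].
    by rewrite linearP /= h1 h2 addr0; apply: mulr0.
  move=> z [n _ Dz]; exists n.+1 => x s ns; apply: deg Dz _ => e.
  by rewrite e ltnn in ns.
have [|h hh] := @ex_path_map k Q C (fun p => walk_dual (qpath_val p).1 (qpath_val p).2).
  move=> y; have [N hN] := bound y; have /choice[l hl] := fin_n^~ y.
  exists (pmap insub (flatten [seq l n | n <- iota 0 N])) => p nz.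
  rewrite mem_pmap_sub; apply/flatten_mapP; exists (size (qpath_val p).2).
    rewrite mem_iota /= add0n ltnNge; apply/negP => /hN -/(_ (qpath_val p).1).
    exact: nz.
  rewrite [val p]surjective_pairing; apply: hl => //; exact: qpathP.
have hw x s y : walk x s -> wcoef x s (h y) = walk_dual x s y.
  by move=> ws; have := hh (@QPath Q (x, s) ws) y; rewrite -wcoef_path.
exists h; split.
- move=> y; apply: (tens_separated (@pcoef_eq0 k Q) (@pcoef_eq0 k Q)) => q r.
  have -> : pcoef r (lfst (pcoef q) (comul kQ (h y))) =
      conv (pcoef q) (pcoef r) (h y) by rewrite convEl actlE.
  have -> : pcoef r (lfst (pcoef q) (tens_map h h (comul C y))) =
      conv (walk_dual (qpath_val q).1 (qpath_val q).2)
        (walk_dual (qpath_val r).1 (qpath_val r).2) y.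
    rewrite lfst_map hh -actlE convEl actlE.
    by congr (walk_dual _ _ _); rewrite actlE; apply: eq_lfst => u /=.
  rewrite -!wcoef_path conv_wcoef walk_walk ?qpathP //.
  have [e|_] := eqVneq; last by rewrite !mul0r.
  rewrite hw // walk_cat qpathP /=; move: (qpathP q); by rewrite e.
- by move=> v x; rewrite hw.
- by move=> a x; rewrite hw /= ?eqxx // va eqxx mul1r.
- move=> n x Dx; apply/path_degreeP => p pn; rewrite hh; exact: deg Dx pn.
Qed.

End Existence.

(** * The coradical filtration of a pointed bialgebra *)

(** With projections [P] onto [D] and [R] onto [E], the defect of the two witnesses is
    [((1 - P) ⊗ (1 - R)) t]; it vanishes because functionals factoring through [1 - P] annihilate
    [D]. This turns the wedge in the coradical filtration into a condition on contractions. *)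
Lemma tens_set_sumP (k : fieldType) (U V : lmodType k) (D : set U) (E : set V)
    (t : (U ⊗ V)%type) : subspace D -> subspace E ->
  (exists t1 t2, [/\ tens_set setT E t1, tens_set D setT t2 & t = t1 + t2]) <->
  (forall phi : {linear U -> k^o}, (forall d, D d -> phi d = 0) -> E (lfst phi t)).
Proof.
move=> sD sE; split.
  move=> [t1 [t2 [[s1 h1 ->] [s2 h2 ->] ->]]] phi phiD.
  rewrite tlinD; apply: subspaceD => //; rewrite tlin_sum;
    apply: subspace_sum_seq => // p ps _; rewrite lfst_pure.
    by apply: subspaceZ => //; case: (h1 p ps).
  by case: (h2 p ps) => /phiD -> _; rewrite scale0r; apply: subspace0.
move=> h; have [P [PD PK]] := ex_projection sD; have [R [RE RK]] := ex_projection sE.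
pose r := repr t.
exists (\sum_(p <- r) (p.1 - P p.1) ⊗ R p.2), (\sum_(p <- r) P p.1 ⊗ p.2).
split.
- exists [seq (p.1 - P p.1, R p.2) | p <- r]; last by rewrite big_map.
  by move=> _ /mapP[p _ ->]; split=> //=; apply: RE.
- exists [seq (P p.1, p.2) | p <- r]; last by rewrite big_map.
  by move=> _ /mapP[p _ ->]; split=> //=; apply: PD.
apply/eqP; rewrite -subr_eq0; apply/eqP/lfst_eq0 => phi.
pose phi' : {linear U -> k^o} := phi \o [the {linear U -> U} of (idfun \- P)].
have Et : E (lfst phi' t).
  by apply: h => d Dd; rewrite /phi' /= PK // subrr linear0.
rewrite -[RHS](subrr (R (lfst phi' t))) {1}RK // (tens_sum_pure t) -/r.
rewrite tlinB tlinD !tlin_sum linear_sum /= -big_split -!sumrB.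
apply: eq_bigr => p _ /=; rewrite !lfst_pure linearZ.
rewrite {1}/phi' /= !linearB /=.
by rewrite [X in _ = X - _]scalerBl [X in _ - X = _]addrC opprD addrA.
Qed.

Section Pointed.
Variables (k : fieldType) (B : coalgebra k).

Definition grouplike (g : B) : Prop := comul B g = g ⊗ g /\ counit B g = 1.

Lemma grouplike_neq0 g : grouplike g -> g != 0.
Proof.
by move=> [_ e]; apply/eqP => g0; move: e; rewrite g0 linear0 => /eqP;
  rewrite eq_sym oner_eq0.
Qed.

Lemma subspace_coradical : subspace (coradical B).
Proof.
split=> [|a _ _ [s hs ->] [t ht ->]]; first by exists [::]; rewrite ?big_nil.
exists ([seq a *: y | y <- s] ++ t); last by rewrite big_cat big_map scaler_sumr.
move=> y; rewrite mem_cat => /orP[/mapP[z /hs[D simD Dz] ->]|/ht //].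
by exists D => //; case: simD => -[sD _] _ _; apply: subspaceZ.
Qed.

Lemma grouplike_coradical g : grouplike g -> coradical B g.
Proof.
move=> hg; have [dg eg] := hg; exists [:: g]; last by rewrite big_seq1.
move=> y; rewrite inE => /eqP ->.
exists [set a *: g | a in [set: k]]; last by exists 1; rewrite ?scale1r.
have gD a : [set a *: g | a in [set: k]] (a *: g) by exists a.
have sD : subspace [set a *: g | a in [set: k]].
  split=> [|a _ _ [b _ <-] [c _ <-]]; first by exists 0; rewrite ?scale0r.
  by exists (a * b + c); rewrite // scalerDl scalerA.
split.
- split=> // _ [a _ <-]; rewrite linearZ /= dg -linearZl_LR.
  by apply: tens_set_pure; [exact: gD|exists 1; rewrite ?scale1r].
- move=> D0; have := gD 1; rewrite D0 scale1r /= => g0.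
  by have := grouplike_neq0 hg; rewrite g0 eqxx.
move=> E [sE _] ED.
have [[x Ex x0]|no] := pselect (exists2 x, E x & x <> 0); last first.
  left; apply/seteqP; split=> [x Ex|x ->]; last exact: subspace0.
  by apply: contrapT => x0; apply: no; exists x.
right; apply/seteqP; split=> // _ [b _ <-].
have [a _ ax] := ED _ Ex; rewrite -ax in Ex x0.
have a0 : a != 0 by apply/eqP => a0; apply: x0; rewrite a0 scale0r.
by rewrite -[b](divfK a0) -scalerA; apply: subspaceZ.
Qed.

Lemma coradical_span : pointed B -> coradical B `<=` span grouplike.
Proof.
move=> hB _ [s hs ->]; apply: (subspace_sum_seq (subspace_span _)) => y /hs.
move=> [D simD Dy] _; have [g g0 DE] := hB D simD.
have [[sD comD] _ _] := simD.
have Dg : D g by rewrite DE; exists 1; rewrite ?scale1r.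
have [c dg] : exists c : k, comul B g = c *: (g ⊗ g).
  have [r hr ->] := comD g Dg.
  elim: r hr => [|p r IH] hr.
    by exists 0; rewrite big_nil scale0r.
  have [|c ec] := IH; first by move=> q qr; apply: hr; rewrite inE qr orbT.
  have [] := hr p (mem_head _ _); rewrite DE => -[a _ ea] [b _ eb].
  exists (a * b + c); rewrite big_cons ec -ea -eb linearZl_LR linearZr_LR /=.
  by rewrite scalerA -scalerDl.
(* The counit law rules out [c = 0] and makes [c *: g] group-like. *)
have ce : c * counit B g = 1.
  have := counit_comul g; rewrite dg -tliftE linearZ /= tlift_pure /= /scale_fst.
  rewrite scalerA => e; have : (c * counit B g - 1) *: g == 0.
    by rewrite scalerBl scale1r e subrr.
  by rewrite scaler_eq0 subr_eq0; move/eqP: g0 => /negPf ->; rewrite orbF => /eqP.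
have gl : grouplike (c *: g).
  split; last by rewrite linearZ.
  by rewrite linearZ /= dg linearZl_LR linearZr_LR.
have c0 : c != 0 by apply/eqP => c0; move/eqP: ce; rewrite c0 mul0r eq_sym oner_eq0.
move: Dy; rewrite DE => -[a _ <-]; apply: spanZ.
by rewrite -[g](scalerK c0); apply: spanZ; apply: span_sub.
Qed.

Hypothesis hB : pointed B.

Lemma coradical_ind (P : set B) : subspace P -> (forall g, grouplike g -> P g) ->
  forall x, coradical B x -> P x.
Proof. by move=> sP gP x /(coradical_span hB); apply: span_min. Qed.

Lemma actl_grouplike phi g : grouplike g -> actl phi g = (phi g : k) *: g.
Proof. by move=> [dg _]; rewrite actlE dg lfst_pure. Qed.

Lemma coradical_actl phi x : coradical B x -> coradical B (actl phi x).
Proof.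
apply: (coradical_ind (P := actl phi @^-1` coradical B)) => [|g hg].
  exact: (subspace_preimage (actl phi) subspace_coradical).
rewrite /preimage /= actl_grouplike //; apply: (subspaceZ _ subspace_coradical).
exact: grouplike_coradical.
Qed.

Definition corad_perp (phi : {linear B -> k^o}) : Prop :=
  forall x, coradical B x -> phi x = 0.

Lemma corad_perp_conv phi psi : corad_perp phi -> corad_perp (conv psi phi).
Proof. by move=> h x /(coradical_actl psi)/h; rewrite convEl. Qed.

(** The coradical filtration shifted by one, with zero as bottom term, so that the coradical itself
    is obtained by the recursion step [sfiltSP]. *)
Definition sfilt (n : nat) : set B :=
  if n is m.+1 then coradical_filtration B m else [set 0].

(** The two halves go together: the criterion at [n] uses that the term [n] is a subspace, and
    yields this for [n.+1]. For the coradical, group-likes are eigenvectors of every [actl phi], and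
    conversely the counit recovers [phi x] from [actl phi x]. *)
Lemma sfiltSP_subspace n : subspace (sfilt n) /\ forall x, sfilt n.+1 x <->
  forall phi, corad_perp phi -> sfilt n (actl phi x).
Proof.
have step m : subspace (sfilt m) -> forall x, sfilt m.+1 x <->
    forall phi, corad_perp phi -> sfilt m (actl phi x).
  case: m => [|m] sm x.
    split=> [Cx phi phiC|h] /=.
      apply: (coradical_ind (P := [set x | actl phi x = 0])) Cx => [|g hg].
        exact: (subspace_preimage (actl phi) (subspace_zero _)).
      by rewrite /= actl_grouplike // phiC ?scale0r //; apply: grouplike_coradical.
    apply: (functional_mem subspace_coradical) => phi phiC.
    rewrite -[x]actr_counit -convEr convEl.
    by rewrite (h phi phiC) linear0.
  have := tens_set_sumP (comul B x) subspace_coradical sm.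
  move=> H; split=> [/H h phi /h|h]; first by rewrite actlE.
  by apply/H => phi /h; rewrite actlE.
elim: n => [|n [sn IH]]; first by split; [|apply: step]; apply: subspace_zero.
have sS : subspace (sfilt n.+1).
  split; first by apply/IH => phi _; rewrite linear0; apply: subspace0.
  move=> a x y /IH hx /IH hy; apply/IH => phi hphi; rewrite linearP.
  by apply: sn.2; [apply: hx|apply: hy].
by split=> //; apply: step.
Qed.

Lemma subspace_sfilt n : subspace (sfilt n).
Proof. by case: (sfiltSP_subspace n). Qed.

Lemma sfiltSP n x : sfilt n.+1 x <->
  forall phi, corad_perp phi -> sfilt n (actl phi x).
Proof. by case: (sfiltSP_subspace n). Qed.

Lemma sfiltS n : sfilt n `<=` sfilt n.+1.
Proof.
elim: n => [|n IH] x; first by move=> ->; apply: (subspace0 (subspace_sfilt 1)).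
by move=> /sfiltSP h; apply/sfiltSP => phi /h /IH.
Qed.

Lemma sfilt_le m n : (m <= n)%N -> sfilt m `<=` sfilt n.
Proof.
move=> /subnK <-; elim: (n - m)%N => [|d IH] x; first by [].
by move=> /IH; apply: sfiltS.
Qed.

Lemma sfilt_actl n psi x : sfilt n x -> sfilt n (actl psi x).
Proof.
case: n => [->|n]; first exact: linear0.
move=> /sfiltSP h; apply/sfiltSP => phi hphi.
by rewrite actl_actl; apply: h; apply: corad_perp_conv.
Qed.

(** The criterion [sfiltSP] contracts the left leg only. Left and right contractions commute, so
    induction on [a] transfers the drop in the filtration to the right leg. *)
Lemma sfilt_actr a b (phi : {linear B -> k^o}) x : (forall d, sfilt b d -> phi d = 0) ->
  sfilt (a + b) x -> sfilt a (actr phi x).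
Proof.
move=> hphi; elim: a x => [|a IH] x hx.
  apply: functional_eq0 => psi; rewrite -convEr convEl; apply: hphi.
  exact: sfilt_actl.
apply/sfiltSP => psi hpsi; rewrite actl_actr; apply: IH.
by move/sfiltSP: hx; apply.
Qed.

(* With projections [E i] onto the terms of the filtration, [E i - E (i - 1)]
   kills the term [i - 1], so that the components of [comul x] outside the sum
   of the [B_i ⊗ B_(n - i)] vanish; no compatibility of the [E i] is needed. *)
Lemma comul_coradical_filtration n x : coradical_filtration B n x ->
  exists s : seq (nat * (B * B)),
    (forall z, z \in s -> [/\ (z.1 <= n)%N, coradical_filtration B z.1 z.2.1 &
       coradical_filtration B (n - z.1) z.2.2]) /\
    comul B x = \sum_(z <- s) z.2.1 ⊗ z.2.2.
Proof.
move=> hx; have /choice[E hE] := fun i => ex_projection (subspace_sfilt i).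
have PE i y : sfilt i (E i y) by case: (hE i).
have KE i y : sfilt i y -> E i y = y by case: (hE i) => _; apply.
pose P i : {linear B -> B} := [the {linear B -> B} of (E i.+1 \- E i)].
have PP i y : sfilt i.+1 (P i y).
  by apply: (subspaceB (subspace_sfilt i.+1)); [|apply: sfiltS]; apply: PE.
have KP i y : sfilt i y -> P i y = 0.
  move=> hy; rewrite /P /= KE ?KE ?subrr //; exact: sfiltS.
exists [seq (i, (P i p.1, E (n - i).+1 p.2)) | i <- iota 0 n.+1, p <- repr (comul B x)].
split.
  move=> z /allpairsP[[i p] [ii _ ->]].
  rewrite mem_iota add0n ltnS in ii; split=> //; first exact: PP.
  exact: (PE (n - i).+1).
transitivity (\sum_(0 <= i < n.+1) tens_map (P i) (E (n - i).+1) (comul B x)); last first.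
  rewrite big_allpairs_dep /index_iota subn0; apply: eq_bigr => i _.
  rewrite {1}(tens_sum_pure (comul B x)) tens_map_sum.
  by apply: eq_bigr => p _; rewrite tens_map_pure.
(* In the term [i] the right leg may be truncated by [E (n - i).+1]: a functional killing that term
   of the filtration contracts [x] into [sfilt i], where [P i] vanishes. *)
transitivity (\sum_(0 <= i < n.+1) tens_map (P i) idfun (comul B x)); last first.
  rewrite !big_nat; apply: eq_bigr => i /andP[_ ile].
  apply/eqP; rewrite -subr_eq0; apply/eqP/lsnd_eq0 => psi.
  rewrite tlinB !lsnd_map -linearB.
  pose psi' : {linear B -> k^o} := psi \o [the {linear B -> B} of (idfun \- E (n - i).+1)].
  have -> : lsnd (psi \o idfun) (comul B x) - lsnd (psi \o E (n - i).+1) (comul B x) =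
      actr psi' x.
    rewrite actrE (tens_sum_pure (comul B x)) !tlin_sum -sumrB.
    apply: eq_bigr => p _; rewrite !lsnd_pure -scalerBl; congr (_ *: _).
    by rewrite /psi' /= linearB.
  apply/KP/(@sfilt_actr _ (n - i).+1) => [d hd|].
    by rewrite /psi' /= KE // subrr linear0.
  by rewrite addnS subnKC.
have E1 : comul B x = tens_map (E n.+1) idfun (comul B x).
  apply/eqP; rewrite -subr_eq0; apply/eqP/lsnd_eq0 => psi.
  rewrite tlinB lsnd_map (@eq_lsnd _ _ _ (psi \o idfun) psi) // -actrE KE ?subrr //.
  by apply: (@sfilt_actr _ 0); rewrite ?addn0 // => d ->; rewrite linear0.
have E0 : tens_map (E 0%N) idfun (comul B x) = 0.
  apply/lsnd_eq0 => psi; rewrite lsnd_map; exact: (PE 0%N _).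
rewrite {1}E1; transitivity (tens_map (E n.+1) idfun (comul B x) -
    tens_map (E 0%N) idfun (comul B x)); first by rewrite E0 subr0.
(* Telescoping of [P m = E m.+1 - E m]. *)
elim: n.+1 {hx E1} => [|m IH]; first by rewrite subrr big_geq.
have eP : tens_map (P m) idfun (comul B x) =
    tens_map (E m.+1) idfun (comul B x) - tens_map (E m) idfun (comul B x).
  rewrite (tens_sum_pure (comul B x)) !tens_map_sum -sumrB.
  by apply: eq_bigr => p _; rewrite !tens_map_pure -linearBl.
by rewrite big_nat_recr // -IH /= eP addrC subrKA.
Qed.

End Pointed.

Lemma tens_mul_sum (k : fieldType) (C : lmodType k) (m : {bilinear C -> C -> C})
    (s t : seq (C * C)) :
  tens_mul m (\sum_(p <- s) p.1 ⊗ p.2) (\sum_(q <- t) q.1 ⊗ q.2) =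
  \sum_(p <- s) \sum_(q <- t) m p.1 q.1 ⊗ m p.2 q.2.
Proof.
rewrite exchange_big /tens_mul (tlin_sum (tens_lift _)); apply: eq_bigr => q _.
rewrite [LHS]tens_lift_pure /= /tens_mul_bil (tlin_sum (tens_lift _)).
by apply: eq_bigr => p _; rewrite [LHS]tens_lift_pure.
Qed.

(** * Compatibility of the coradical filtration with the product *)

Section PointedBialgebra.
Variables (k : fieldType) (B : bialgebra k).
Hypothesis hB : pointed B.

Lemma grouplike_one : grouplike (oneb B).
Proof.
by split; [exact: (comul_bone (bialg_str B))|exact: (counit_bone (bialg_str B))].
Qed.

Lemma grouplike_mul (g h : B) :
  grouplike g -> grouplike h -> grouplike (mulb g h).
Proof.
move=> [dg eg] [dh eh]; split.
  by rewrite [LHS]comul_bmul dg dh tens_mul_pure.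
by rewrite [LHS]counit_bmul eg eh mulr1.
Qed.

Lemma coradical_mul (x y : B) :
  coradical B x -> coradical B y -> coradical B (mulb x y).
Proof.
move=> hx hy; have sC := @subspace_coradical k B.
apply: (coradical_ind hB (P := [set x | coradical B (mulb x y)])) hx => [|g hg].
  split=> [|a u v /= hu hv]; first by rewrite /= /mulb linear0l; apply: subspace0.
  by rewrite /= /mulb linearPl; apply: sC.2.
apply: (coradical_ind hB (P := [set y | coradical B (mulb g y)])) hy => [|h hh].
  split=> [|a u v /= hu hv]; first by rewrite /= /mulb linear0r; apply: subspace0.
  by rewrite /= /mulb linearPr; apply: sC.2.
by apply: grouplike_coradical; apply: grouplike_mul.
Qed.

(** Contract [Δ(xy) = Δ(x) Δ(y)] on the left with a functional killing the coradical. Terms whose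
    left factors both lie in the coradical disappear, since group-likes are closed under products;
    in the others the right factors have smaller total degree, and induction on [m + n] applies. *)
Lemma coradical_filtration_mul m n (x y : B) :
  coradical_filtration B m x -> coradical_filtration B n y ->
  coradical_filtration B (m + n) (mulb x y).
Proof.
move: {2}(m + n)%N (erefl (m + n)%N) => N; elim/ltn_ind: N m n x y => N IH m n x y.
case: N IH => [|N] IH mn hx hy.
  move/eqP: mn; rewrite addn_eq0 => /andP[/eqP m0 /eqP n0].
  by move: hx hy; rewrite m0 n0; apply: coradical_mul.
have [s [hs es]] := comul_coradical_filtration hB hx.
have [t [ht et]] := comul_coradical_filtration hB hy.
rewrite mn; apply/(sfiltSP hB N.+1) => phi hphi; rewrite actlE [comul B _]comul_bmul.
have eqs : comul B x = \sum_(p <- [seq z.2 | z <- s]) p.1 ⊗ p.2 by rewrite big_map.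
have eqt : comul B y = \sum_(p <- [seq z.2 | z <- t]) p.1 ⊗ p.2 by rewrite big_map.
rewrite eqs eqt tens_mul_sum !big_map tlin_sum.
apply: (subspace_sum_seq (subspace_sfilt hB _)) => z zs _.
rewrite big_map tlin_sum; apply: (subspace_sum_seq (subspace_sfilt hB _)) => w wt _.
rewrite lfst_pure; have [z1 z2 z3] := hs z zs; have [w1 w2 w3] := ht w wt.
have [/andP[/eqP z0 /eqP w0]|nz] := boolP ((z.1 == 0%N) && (w.1 == 0%N)).
  rewrite z0 in z2; rewrite w0 in w2.
  have -> : phi (bmul (bialg_str B) z.2.1 w.2.1) = 0.
    by apply: hphi; apply: coradical_mul.
  by rewrite scale0r; apply: (subspace0 (subspace_sfilt hB _)).
apply: (subspaceZ _ (subspace_sfilt hB _)).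
have lt : (m - z.1 + (n - w.1) < N.+1)%N.
  have -> : N.+1 = (m - z.1 + (n - w.1) + (z.1 + w.1))%N.
    by rewrite addnACA !subnK.
  by rewrite -[X in (X < _)%N]addn0 ltn_add2l lt0n addn_eq0.
apply: (@sfilt_le _ _ hB (m - z.1 + (n - w.1)).+1); first exact: lt.
exact: (IH _ lt (m - z.1)%N (n - w.1)%N).
Qed.

End PointedBialgebra.

(** * Group-like elements and gradings *)

Lemma grouplike_conv (k : fieldType) (C : coalgebra k) (phi psi : {linear C -> k^o})
    (g : C) : grouplike g -> conv phi psi g = (phi g : k) * psi g.
Proof. by move=> [dg _]; rewrite convEl actlE dg lfst_pure linearZ. Qed.

Lemma actr_grouplike (k : fieldType) (C : coalgebra k) (psi : {linear C -> k^o})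
    (g : C) : grouplike g -> actr psi g = (psi g : k) *: g.
Proof. by move=> [dg _]; rewrite actrE dg lsnd_pure. Qed.

Lemma span_finite (k : fieldType) (V : lmodType k) (S : set V) x : span S x ->
  exists s : seq V, (forall y, y \in s -> S y) /\ span [set y | y \in s] x.
Proof.
apply: (span_min (D := [set x | exists s : seq V, (forall y, y \in s -> S y) /\
  span [set y | y \in s] x])).
  split=> [|a u v [s [sS hu]] [t [tS hv]]]; first by exists [::]; split=> //; apply: span0.
  exists (s ++ t); split; first by move=> y; rewrite mem_cat => /orP[/sS|/tS].
  apply: spanD; [apply: spanZ; apply: span_mono hu|apply: span_mono hv];
    by move=> y /= ys; rewrite mem_cat ys ?orbT.
move=> y Sy; exists [:: y]; split; first by move=> z; rewrite inE => /eqP ->.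
by apply: span_sub; apply: mem_head.
Qed.

(** An eigenvector argument: [actr th] multiplies a group-like [g] by [th g]. For [th] killing the
    span of [s] with [th w = 1], it sends [v - c *: w] to [c *: (v - w)], which must vanish. *)
Lemma grouplike_not_span (k : fieldType) (C : coalgebra k) (S : set C) (v : C) :
  (forall w, S w -> grouplike w) -> grouplike v -> ~ S v -> ~ span S v.
Proof.
move=> SG vG nSv /span_finite[s [sS]].
elim: s sS => [|w s IH] sS hv.
  have : [set (0 : C)] v by apply: hv => //; apply: subspace_zero.
  by move=> v0; have := grouplike_neq0 vG; rewrite v0 eqxx.
have {}IH : ~ span [set y | y \in s] v.
  by apply: IH => y ys; apply: sS; rewrite inE ys orbT.
have sw : S w by apply: sS; apply: mem_head.
have [c hc] : exists c : k, span [set y | y \in s] (v - c *: w).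
  apply: span_setU1; apply: span_mono hv => y /=; rewrite inE => /orP[/eqP ->|ys];
    by [right|left].
have [ws|nws] := pselect (span [set y | y \in s] w).
  by apply: IH; rewrite -(subrK (c *: w) v); apply: spanD => //; apply: spanZ.
have [th [th0 th1]] := ex_functional (subspace_span _) nws.
have u0 : actr th (v - c *: w) = 0.
  apply: (span_min (D := actr th @^-1` [set 0])) hc.
    exact: subspace_preimage (subspace_zero _).
  move=> y ys; rewrite /preimage /= actr_grouplike.
    by rewrite th0 ?scale0r //; apply: span_sub.
  by apply/SG/sS; rewrite inE ys orbT.
have thv : th v = c.
  have := th0 _ hc; rewrite linearB linearZ /= th1 => /eqP.
  by rewrite subr_eq0 => /eqP ->; apply: mulr1.
move/eqP: u0; rewrite linearB linearZ /= !actr_grouplike ?th1 ?thv; [|exact: SG|exact: vG].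
rewrite scale1r -scalerBr scaler_eq0 subr_eq0 => /orP[/eqP c0|/eqP vw].
  by apply: IH; rewrite -[v]subr0 -(scale0r w) -c0.
by apply: nSv; rewrite vw.
Qed.

(** * Group-like and skew-primitive elements of a path coalgebra *)

Section PathElements.
Variables (k : fieldType) (Q : quiver).
Local Notation kQ := (path_coalgebra k Q).
Local Notation vec := (@path_vec k Q : qpath Q -> kQ).

Definition vpath (v : vertex Q) : qpath Q := @QPath Q (v, [::]) isT.

Lemma apath_subproof (a : arrow Q) : walk (src a, [:: a]).1 (src a, [:: a]).2.
Proof. by rewrite /= eqxx. Qed.

Definition apath (a : arrow Q) : qpath Q := @QPath Q (src a, [:: a]) (apath_subproof a).

Lemma qlength0P (p : qpath Q) : qlength p = 0%N -> p = vpath (qpath_val p).1.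
Proof.
by case: p => -[x [|//]] pw _; apply: val_inj.
Qed.

Lemma qlength1P (p : qpath Q) : qlength p = 1%N -> exists a, p = apath a.
Proof.
case: p => -[x [//|a [|//]]] pw _; exists a; apply: val_inj => /=.
by move: pw => /= /andP[/eqP ->].
Qed.

Lemma vpath_inj : injective vpath.
Proof. by move=> v w []. Qed.

Lemma apath_inj : injective apath.
Proof. by move=> v w []. Qed.

Lemma path_vec_inj : injective vec.
Proof.
move=> p q /(congr1 (pcoef p)) /eqP; rewrite !pcoef_vec eqxx.
by case: (q =P p) => [->//|_]; rewrite oner_eq0.
Qed.

Lemma comul_vpath v : comul kQ (vec (vpath v)) = vec (vpath v) ⊗ vec (vpath v).
Proof.
rewrite [LHS]path_comul_vecE big_nat1; congr (_ ⊗ _); congr path_vec;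
exact: val_inj.
Qed.

Lemma comul_apath a : comul kQ (vec (apath a)) =
  vec (apath a) ⊗ vec (vpath (src a)) + vec (vpath (tgt a)) ⊗ vec (apath a).
Proof.
rewrite [LHS]path_comul_vecE /index_iota /= big_cons big_seq1.
by congr (_ ⊗ _ + _ ⊗ _); congr path_vec; apply: val_inj.
Qed.

Lemma grouplike_vpath v : grouplike (vec (vpath v)).
Proof. by split; [exact: comul_vpath|rewrite [LHS]path_counit_vecE]. Qed.

Lemma wcoef_vpath x s v :
  wcoef x s (vec (vpath v)) = ((v == x) && (s == [::]))%:R :> k.
Proof. by rewrite wcoef_vec /= xpair_eqE (eq_sym s). Qed.

Lemma path_deg_vec p : path_degree (qlength p) (vec p).
Proof.
apply/path_degreeP => q; rewrite pcoef_vec; case: eqP => // <-.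
by case.
Qed.

Lemma subspace_path_degree n : subspace (@path_degree k Q n : set kQ).
Proof.
split=> [|a x y /path_degreeP hx /path_degreeP hy]; apply/path_degreeP => p pn.
  exact: linear0.
by rewrite linearP /= hx // hy // addr0; apply: mulr0.
Qed.

(* A nonzero coefficient [c] on a path of positive length forces the path to be
   closed and all its powers to have coefficient [c ^+ n]. *)
Lemma grouplike_path (g : kQ) : grouplike g -> exists v, g = vec (vpath v).
Proof.
move=> gG; have cat z t x s : (wcoef z t g : k) * wcoef x s g =
    (z == walk_end x s)%:R * wcoef x (s ++ t) g.
  by rewrite -grouplike_conv // conv_wcoef.
have [v ev] : exists v, wcoef v [::] g <> 0.
  apply: contrapT => no; have [_] := gG.
  rewrite {1}[g]path_expand linear_sum big1 => [/eqP|p _].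
    by rewrite eq_sym oner_eq0.
  rewrite linearZ /= [path_counit _]path_counit_vecE; case: eqP => [p0|_].
    rewrite (qlength0P p0) -wcoef_path /=.
    have [->|nz] := pselect (wcoef (qpath_val p).1 [::] g = 0); first exact: mul0r.
    by case: no; exists (qpath_val p).1.
  exact: mulr0.
have ev1 : wcoef v [::] g = 1.
  have := cat v [::] v [::]; rewrite /= eqxx mul1r => e.
  by apply: (mulfI (x := (wcoef v [::] g : k))); [apply/eqP|rewrite e mulr1].
(* Coefficients of a group-like multiply under concatenation: a nonzero coefficient at [(x, t)]
   makes the vertex [x] occur, and two distinct vertices cannot both occur. *)
have src_v x t : wcoef x t g <> 0 -> x = v.
  move=> nz; have h : wcoef x [::] g <> 0.
    by move=> h; apply: nz; have := cat x t x [::]; rewrite h mulr0 eqxx mul1r.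
  have := cat v [::] x [::]; rewrite ev1 mul1r /=; case: eqP => [-> //|_].
  by rewrite mul0r => /h.
have long x a s : wcoef x (a :: s) g = 0.
  apply: contrapT => nz; have xv := src_v _ _ nz; rewrite {}xv {x} in nz.
  set w := a :: s in nz.
  have wv : walk_end v w = v.
    apply: (src_v _ [::]) => h; apply: nz.
    by have := cat (walk_end v w) [::] v w; rewrite h mul0r eqxx mul1r cats0.
  have pow n : wcoef v (flatten (nseq n w)) g <> 0.
    elim: n => [|n IH]; first exact: ev.
    move=> h; have := cat v (flatten (nseq n w)) v w; rewrite wv eqxx mul1r.
    rewrite [X in _ = wcoef v X g](_ : _ = flatten (nseq n.+1 w)) // h => /eqP.
    by rewrite mulf_eq0 => /orP[/eqP/IH|/eqP/nz].
  (* [N] exceeds every length in the support, while the [N]-th power of the nonempty word [w] has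
     length at least [N]. *)
  pose N := (\max_(p <- dom g) qlength p).+1.
  have := pow N; rewrite /wcoef; case: insubP => [p _ ep|//].
  move/eqP; rewrite -mem_dom_pcoef => pd.
  have : (qlength p < N)%N by rewrite ltnS; apply: leq_bigmax_seq.
  have -> : qlength p = size (flatten (nseq N w)) by rewrite /qlength ep.
  by rewrite size_flatten /shape map_nseq sumn_nseq ltnNge leq_pmull.
exists v; apply: pcoef_eq => p; rewrite -wcoef_path wcoef_vpath.
case: p => -[x [|a s]] _ /=; last by rewrite long andbF.
rewrite andbT eq_sym; case: eqP => [->|xv]; first exact: ev1.
by apply: contrapT => /src_v.
Qed.

(** Cut the path after its first arrow: both pieces have positive length, whereas each term of
    [comul kQ y] has a vertex as one factor. *)
Lemma skew_primitive_path (g h : vertex Q) (y : kQ) :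
  comul kQ y = vec (vpath g) ⊗ y + y ⊗ vec (vpath h) ->
  forall p, (1 < qlength p)%N -> pcoef p y = 0.
Proof.
move=> dy p; rewrite -wcoef_path; case: p => -[x [//|a [//|b s]]] _ /= _.
have := conv_wcoef (tgt a) (b :: s) x [:: a] y.
rewrite eqxx mul1r /= => <-; rewrite convEl actlE dy tlinD !lfst_pure.
by rewrite linearD !linearZ /= !wcoef_vpath !andbF scale0r scaler0 addr0.
Qed.

Definition path_grading (n : nat) : set kQ := [set vec p | p in [set p | qlength p = n]].

Lemma path_comul_graded : comul_graded path_grading.
Proof.
split=> [x|_ _ [p /= <- <-]].
  rewrite [x]path_expand; apply: (subspace_sum _ (subspace_span _)) => p _.
  by apply: spanZ; apply: span_sub; exists (qlength p) => //; exists p.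
exists [seq ((qlength p - i)%N, (vec (qdrop i p), vec (qtake i p))) | i <- iota 0 (qlength p).+1].
split; last by rewrite [LHS]path_comul_vecE big_map /index_iota subn0.
move=> z /mapP[i ii ->]; move: ii; rewrite mem_iota add0n ltnS => /andP[_ ip] /=.
rewrite leq_subr subKn //; split=> //.
  by exists (qdrop i p) => //=; rewrite qlength_drop.
by exists (qtake i p) => //=; rewrite qlength_take.
Qed.

End PathElements.

Section TensorGrading.
Variables (k : fieldType) (C C' : coalgebra k) (D : nat -> set C) (D' : nat -> set C').

Definition tens_grading (n : nat) : set (tens_coalgebra C C') :=
  [set t | exists i j x y, [/\ (i + j)%N = n, D i x, D' j y & t = x ⊗ y]].

Lemma tens_comul_graded :
  comul_graded D -> comul_graded D' -> comul_graded tens_grading.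
Proof.
move=> [spD cD] [spD' cD']; split=> [t|n _ [i [j [x [y [<- Dx Dy ->]]]]]].
  rewrite [t]tens_sum_pure; apply: (subspace_sum _ (subspace_span _)) => -[x y] _ /=.
  have := spD x.
  apply: (span_min (D := [set x | span (\bigcup_n tens_grading n) (x ⊗ y : tens_coalgebra C C')])).
    split=> [|a u v /= hu hv]; first by rewrite /= linear0l; apply: span0.
    by rewrite /= linearPl; apply: (subspace_span _).2.
  move=> {}x [i _ Dx] /=; have := spD' y.
  apply: (span_min (D := [set y | span (\bigcup_n tens_grading n) (x ⊗ y : tens_coalgebra C C')])).
    split=> [|a u v /= hu hv]; first by rewrite /= linear0r; apply: span0.
    by rewrite /= linearPr; apply: (subspace_span _).2.
  move=> {}y [j _ Dy] /=; apply: span_sub; exists (i + j)%N => //.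
  by exists i, j, x, y.
have [s [hs es]] := cD _ _ Dx; have [t [ht et]] := cD' _ _ Dy.
exists [seq ((z.1 + w.1)%N, (z.2.1 ⊗ w.2.1, z.2.2 ⊗ w.2.2)) | z <- s, w <- t]; split.
  move=> _ /allpairsP[[z w] /= [/hs[z1 z2 z3] /ht[w1 w2 w3] ->]] /=.
  split; first exact: leq_add.
    by exists z.1, w.1, z.2.1, w.2.1.
  exists (i - z.1)%N, (j - w.1)%N, z.2.2, w.2.2; split=> //.
  apply/eqP; rewrite -(eqn_add2r (z.1 + w.1)) addnACA !subnK //.
  exact: leq_add.
rewrite [LHS]tens_comul_pure big_allpairs_dep es et.
have := shuffle_sum [seq z.2 | z <- s] [seq w.2 | w <- t].
rewrite !big_map => ->; apply: eq_bigr => z _.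
by rewrite big_map.
Qed.

End TensorGrading.

(** * The associated graded bialgebra *)

(* [pg_strict] says that the component [gr (n + 2) -> gr 1 ⊗ gr (n + 1)] of the
   comultiplication is injective, in terms of families of functionals which
   separate the elements of [gr 1] and of [gr (n + 1)]. *)
Record pointed_graded (k : fieldType) (A : bialgebra k) (gr : nat -> set A) : Prop := {
  pg_direct : direct_sum gr;
  pg_comul : comul_graded gr;
  pg_mul : forall m n x y, gr m x -> gr n y -> gr (m + n)%N (mulb x y);
  pg_one : gr 0%N (oneb A);
  pg_counit : forall n x, gr n.+1 x -> counit A x = 0;
  pg_gr0 : forall x, gr 0%N x -> span [set g | grouplike g /\ gr 0%N g] x;
  pg_strict : forall n (E1 E2 : set {linear A -> k^o}) x,
    (forall phi, E1 phi -> forall m u, gr m u -> m <> 1%N -> phi u = 0) ->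
    (forall u, gr 1%N u -> (forall phi, E1 phi -> phi u = 0) -> u = 0) ->
    (forall u, gr n.+1 u -> (forall psi, E2 psi -> psi u = 0) -> u = 0) ->
    gr n.+2 x -> (forall phi psi, E1 phi -> E2 psi -> conv phi psi x = 0) ->
    x = 0
}.

Section AssociatedGraded.
Variables (k : fieldType) (B : bialgebra k).
Hypothesis hB : pointed B.
Variables (A : bialgebra k) (gr : nat -> set A) (sym : nat -> B -> A).
Hypothesis hA : is_associated_graded B A gr sym.
Local Notation filt := (coradical_filtration B).

Lemma sym_gr n y : filt n y -> gr n (sym n y).
Proof. by move=> hy; rewrite -(sym_image hA); exists y. Qed.

Lemma gr_sym n x : gr n x -> exists2 y, filt n y & x = sym n y.
Proof. by rewrite -(sym_image hA) => -[y hy <-]; exists y. Qed.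

Lemma subspace_filt n : subspace (filt n).
Proof. exact: (subspace_sfilt hB n.+1). Qed.

Lemma filt_le m n : (m <= n)%N -> filt m `<=` filt n.
Proof. by move=> mn; apply: (sfilt_le hB (m := m.+1) (n := n.+1)). Qed.

Lemma sym0 n : sym n 0 = 0.
Proof.
have h0 := subspace0 (subspace_filt n).
have := sym_linear hA 1 h0 h0; rewrite !scale1r addr0 => e.
by apply: (addrI (sym n 0)); rewrite addr0 -e.
Qed.

Lemma sym_sum n (I : eqType) (r : seq I) (P : pred I) (c : I -> k) (F : I -> B) :
  (forall i, i \in r -> P i -> filt n (F i)) ->
  filt n (\sum_(i <- r | P i) c i *: F i) /\
  sym n (\sum_(i <- r | P i) c i *: F i) = \sum_(i <- r | P i) c i *: sym n (F i).
Proof.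
elim: r => [|i r IH] hF.
  by rewrite !big_nil sym0; split=> //; apply: (subspace0 (subspace_filt n)).
have [|h1 h2] := IH; first by move=> j jr; apply: hF; rewrite inE jr orbT.
rewrite !big_cons; case: ifP => // Pi; have hi := hF i (mem_head _ _) Pi.
split; first exact: (subspace_filt n).2.
by rewrite (sym_linear hA) // h2.
Qed.

Lemma comul_sym n y (s : seq (nat * (B * B))) : filt n y ->
  (forall z, z \in s -> [/\ (z.1 <= n)%N, filt z.1 z.2.1 & filt (n - z.1) z.2.2]) ->
  comul B y = \sum_(z <- s) z.2.1 ⊗ z.2.2 ->
  forall phi psi, conv phi psi (sym n y) =
    \sum_(z <- s) (phi (sym z.1 z.2.1) : k) * psi (sym (n - z.1)%N z.2.2).
Proof.
move=> hy hs es phi psi; have := sym_comul hA hy hs es => e.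
rewrite (@conv_sum _ _ _ _ _ [seq (sym z.1 z.2.1, sym (n - z.1)%N z.2.2) | z <- s]).
  by rewrite big_map.
by rewrite e big_map.
Qed.

Lemma associated_graded_strict n (E1 E2 : set {linear A -> k^o}) x :
  (forall phi, E1 phi -> forall m u, gr m u -> m <> 1%N -> phi u = 0) ->
  (forall u, gr 1%N u -> (forall phi, E1 phi -> phi u = 0) -> u = 0) ->
  (forall u, gr n.+1 u -> (forall psi, E2 psi -> psi u = 0) -> u = 0) ->
  gr n.+2 x -> (forall phi psi, E1 phi -> E2 psi -> conv phi psi x = 0) ->
  x = 0.
Proof.
move=> E1deg E1sep E2sep /gr_sym[y hy ->] h.
have [s [hs es]] := comul_coradical_filtration hB hy.
(* It has to be shown that [y] drops to [filt n.+1]. Under [th], left degree 0 dies and left degree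
   at least 2 leaves a right factor already in [filt n], so only left degree 1 matters. *)
apply/(sym_kerS hA hy); apply/(sfiltSP hB n.+1) => th hth.
rewrite actlE es tlin_sum; under eq_bigr do rewrite lfst_pure.
rewrite (bigID (fun z => z.1 == 1%N)) /=; apply: (subspaceD (subspace_filt n)); last first.
  apply: (subspace_sum_seq (subspace_filt n)) => z /hs[z1 z2 z3] /eqP n1.
  have [z0|nz0] := eqVneq z.1 0%N.
    rewrite (hth z.2.1) ?scale0r; first exact: (subspace0 (subspace_filt n)).
    by move: z2; rewrite z0.
  apply: (subspaceZ _ (subspace_filt n)); apply: filt_le z3.
  by move: n1 nz0; case: (z.1) => [//|[//|m]] _ _; rewrite !subSS leq_subr.
have s1 z : z \in s -> z.1 == 1%N -> filt n.+1 z.2.2.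
  by move=> /hs[_ _ z3] /eqP z1; move: z3; rewrite z1 subSS subn0.
have s2 z : z \in s -> z.1 == 1%N -> filt 1%N z.2.1.
  by move=> /hs[_ z2 _] /eqP z1; move: z2; rewrite z1.
have [w1 w2] := sym_sum (fun z => th z.2.1) s1.
apply/(sym_kerS hA w1); apply: E2sep; first exact: sym_gr.
move=> psi E2psi; rewrite w2 linear_sum.
have [c1 c2] := sym_sum (fun z => psi (sym n.+1 z.2.2)) s2.
(* The legs exchange roles: contracting the right leg with [psi] leaves an element of [filt 1],
   which [th] kills once it lies in the coradical. Testing its symbol against [E1] produces exactly
   the convolutions that vanish by [h]. *)
have : filt 0%N (\sum_(z <- s | z.1 == 1%N) (psi (sym n.+1 z.2.2) : k) *: z.2.1).
  apply/(sym_kerS hA c1); apply: E1sep; first exact: sym_gr.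
  move=> phi E1phi; rewrite c2 -[RHS](h phi psi) // (comul_sym hy hs es).
  rewrite [RHS](bigID (fun z => z.1 == 1%N)) /= [X in _ = _ + X]big_seq_cond.
  rewrite [X in _ = _ + X]big1 ?addr0 => [|z /andP[zs /eqP z1]]; last first.
    by rewrite (E1deg _ E1phi z.1) ?mul0r //; apply: sym_gr; case: (hs z zs).
  rewrite linear_sum; apply: eq_bigr => z /eqP ->.
  by rewrite linearZ /= subSS subn0; apply: mulrC.
move=> /hth e; rewrite -[RHS]e linear_sum; apply: eq_bigr => z _.
by rewrite !linearZ /=; apply: mulrC.
Qed.

Lemma associated_graded_pointed : pointed_graded gr.
Proof.
split.
- exact: gr_direct hA.
- split=> [x|n _ /gr_sym[y hy ->]].
    have [_ /(_ x)[n [f [hf ->]]] _] := gr_direct hA.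
    apply: (subspace_sum _ (subspace_span _)) => i _; apply: span_sub.
    by exists (i : nat).
  have [s [hs es]] := comul_coradical_filtration hB hy.
  exists [seq (z.1, (sym z.1 z.2.1, sym (n - z.1)%N z.2.2)) | z <- s]; split.
    by move=> _ /mapP[z /hs[z1 z2 z3] ->]; split=> //=; apply: sym_gr.
  by rewrite (sym_comul hA hy hs es) big_map.
- move=> m n _ _ /gr_sym[x hx ->] /gr_sym[y hy ->].
  rewrite (sym_mul hA) //; apply: sym_gr; exact: coradical_filtration_mul.
- rewrite (sym_one hA); apply: sym_gr; apply: grouplike_coradical.
  exact: grouplike_one.
- by move=> n _ /gr_sym[x hx ->]; apply: (sym_counitS hA).
- move=> _ /gr_sym[x hx ->].
  have [] : filt 0%N x /\ span [set g | grouplike g /\ gr 0%N g] (sym 0%N x); last by [].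
  apply: (coradical_ind hB (P := [set x | filt 0%N x /\
     span [set g | grouplike g /\ gr 0%N g] (sym 0%N x)])) hx => [|g hg].
    split=> [|a u v [hu1 hu2] [hv1 hv2]].
      by split; [exact: (subspace0 (subspace_filt 0))|rewrite sym0; apply: span0].
    split; first exact: (subspace_filt 0).2.
    by rewrite (sym_linear hA) //; apply: (subspace_span _).2.
  have g0 : filt 0%N g by apply: grouplike_coradical.
  split=> //; apply: span_sub; split; last exact: sym_gr.
  split; last by rewrite (sym_counit0 hA) //; case: hg.
  have := sym_comul hA (s := [:: (0%N, (g, g))]) g0; rewrite !big_seq1 /=; apply.
    by move=> z; rewrite inE => /eqP ->.
  by case: hg.
- exact: associated_graded_strict.
Qed.

End AssociatedGraded.

(** * The quiver of a graded bialgebra *)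

Lemma span_lin_ext (k : fieldType) (U V : lmodType k) (S : set U)
    (f g : {linear U -> V}) :
  (forall x, S x -> f x = g x) -> forall x, span S x -> f x = g x.
Proof.
move=> h x; apply: (span_min (D := [set x | f x = g x])) => //.
split=> [|a u v /= hu hv]; first by rewrite /= !linear0.
by rewrite !linearP hu hv.
Qed.

(** Quantifying over every duplicate-free list containing [s0] allows the expansions of several
    vectors to be written over a common list. *)
Lemma dual_family_expand (k : fieldType) (V : lmodType k) (I : eqType)
    (e : I -> V) (c : I -> {linear V -> k^o}) :
  (forall i j, c i (e j) = (j == i)%:R) ->
  forall x, span (range e) x -> exists s0 : seq I, forall s, uniq s ->
    {subset s0 <= s} -> x = \sum_(i <- s) (c i x : k) *: e i.
Proof.
move=> ce x; apply: (span_min (D := [set x | exists s0 : seq I, forall s, uniq s ->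
    {subset s0 <= s} -> x = \sum_(i <- s) (c i x : k) *: e i])).
  split=> [|a u v [s hs] [t ht]].
    by exists [::] => s _ _; rewrite big1 // => i _; rewrite linear0 scale0r.
  exists (s ++ t) => r ur sr.
  rewrite {1}(hs r) // => [|i si]; last by apply: sr; rewrite mem_cat si.
  rewrite {1}(ht r) // => [|i ti]; last by apply: sr; rewrite mem_cat ti orbT.
  rewrite scaler_sumr -big_split; apply: eq_bigr => i _ /=.
  by rewrite linearP /= scalerDl scalerA.
move=> _ [j _ <-]; exists [:: j] => s us js.
rewrite (bigD1_seq j) ?js ?mem_head //= big1 => [|i ij].
  by rewrite ce eqxx scale1r addr0.
by rewrite ce eq_sym (negPf ij) scale0r.
Qed.

Lemma dual_family_eq0 (k : fieldType) (V : lmodType k) (I : eqType)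
    (e : I -> V) (c : I -> {linear V -> k^o}) :
  (forall i j, c i (e j) = (j == i)%:R) ->
  forall x, span (range e) x -> (forall i, c i x = 0) -> x = 0.
Proof.
move=> ce x /(dual_family_expand ce)[s hs] cx.
rewrite (hs (undup s)) ?undup_uniq => // [|i]; last by rewrite mem_undup.
by apply: big1 => i _; rewrite cx scale0r.
Qed.

Lemma dual_family_finite (k : fieldType) (V : lmodType k) (I : eqType)
    (e : I -> V) (c : I -> {linear V -> k^o}) :
  (forall i j, c i (e j) = (j == i)%:R) ->
  forall x, span (range e) x -> exists s : seq I, forall i, c i x <> 0 -> i \in s.
Proof.
move=> ce x /(dual_family_expand ce)[s hs]; exists (undup s) => i nz.
apply: contrapT => ni; apply: nz.
rewrite (hs (undup s)) ?undup_uniq => // [|j]; last by rewrite mem_undup.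
rewrite linear_sum big_seq big1 // => j js; rewrite linearZ /= ce.
by case: eqP => [ji|_]; [rewrite -ji js in ni|apply: mulr0].
Qed.

Lemma counit_path_degree (k : fieldType) (Q : quiver) n (x : path_coalgebra k Q) :
  path_degree n.+1 x -> counit (path_coalgebra k Q) x = 0.
Proof.
move=> hx; rewrite [x]path_expand linear_sum big_seq big1 // => p /hx pn.
by rewrite linearZ /= [path_counit _]path_counit_vecE pn; apply: mulr0.
Qed.

Section QuiverOfGraded.
Variables (k : fieldType) (A : bialgebra k) (gr : nat -> set A).
Hypothesis hP : pointed_graded gr.

Lemma subspace_gr n : subspace (gr n).
Proof. by case: (pg_direct hP) => h _ _; apply: h. Qed.

(** If [x] of degree [n] is also a sum of terms of other degrees, putting [- x] in place of the zero
    [n]-th term gives a vanishing sum of homogeneous terms. The sums are asserted for all large [N]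
    so that two of them can be added. *)
Lemma gr_disjoint n x : gr n x ->
  span (\bigcup_(m in [set m | m <> n]) gr m) x -> x = 0.
Proof.
have [_ _ uniq] := pg_direct hP.
move=> gx hx; have [N0 [f [hf fn hN]]] : exists N0 f, [/\ forall i, gr i (f i),
    f n = 0 & forall N, (N0 <= N)%N -> x = \sum_(i < N) f i].
  move: hx; apply: (span_min (D := [set x | exists N0 f, [/\ forall i, gr i (f i),
    f n = 0 & forall N, (N0 <= N)%N -> x = \sum_(i < N) f i]])).
    split=> [|a u v [N [f [hf fn hN]]] [M [g [hg gn hM]]]].
      exists 0%N, (fun=> 0); split=> // [i|N _]; last by rewrite big1.
      exact: (subspace0 (subspace_gr i)).
    exists (maxn N M), (fun i => a *: f i + g i); split=> [i||L].
    - exact: (subspace_gr i).2.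
    - by rewrite fn gn scaler0 addr0.
    rewrite geq_max => /andP[/hN eu /hM ev]; rewrite big_split -scaler_sumr.
    by rewrite -eu -ev.
  move=> u [m mn gu]; exists m.+1, (fun i => if i == m then u else 0); split.
  - move=> i; case: eqP => [->//|_]; exact: (subspace0 (subspace_gr i)).
  - by case: eqP => // nm; case: mn.
  move=> N mN; rewrite (bigD1 (Ordinal mN)) //= eqxx big1 ?addr0 // => i.
  by rewrite -val_eqE /= => /negPf ->.
pose g i := if i == n then - x else f i.
have gg i : gr i (g i).
  rewrite /g; case: eqP => [->|_]; last exact: hf.
  exact: (subspaceN (subspace_gr n)).
pose N := maxn N0 n.+1; have nN : (n < N)%N by rewrite leq_maxr.
have sum0 : \sum_(i < N) g i = 0.
  rewrite (bigD1 (Ordinal nN)) //= {1}/g eqxx {1}(hN N) ?leq_maxl //.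
  rewrite (bigD1 (Ordinal nN)) //= fn add0r; apply/eqP; rewrite addrC subr_eq0.
  apply/eqP/eq_bigr => i; rewrite -val_eqE /= /g => /negPf -> //.
by have := uniq N g gg sum0 n nN; rewrite /g eqxx => /eqP; rewrite oppr_eq0 => /eqP.
Qed.

Definition vset : set A := [set g | grouplike g /\ gr 0%N g].

Lemma ex_grouplike_dual g : vset g -> exists phi : {linear A -> k^o},
  [/\ phi g = 1, forall h, vset h -> h <> g -> phi h = 0 &
      forall m x, gr m x -> m <> 0%N -> phi x = 0].
Proof.
move=> hg.
have [||phi [h1 h2 h3]] := @independent_dual k A vset g
  (span (\bigcup_(m in [set m | m <> 0%N]) gr m)) _ (subspace_span _) _ hg.
- move=> h [hG _]; apply: grouplike_not_span => // [w [[]]//|[_]]; exact.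
- move=> x hx; apply: gr_disjoint; apply: (span_min (subspace_gr 0)) hx.
  by move=> ? [].
exists phi; split=> // m x gx m0; apply: h3; apply: span_sub; by exists m.
Qed.

Definition gvertex : choiceType := {g : A | `[< vset g >]}.

Lemma gvertexP (v : gvertex) : vset (val v).
Proof. exact/asboolP/(valP v). Qed.

Lemma ex_vdual : exists chi : gvertex -> {linear A -> k^o},
  (forall v w, chi v (val w) = (w == v)%:R) /\
  (forall v m x, gr m x -> m <> 0%N -> chi v x = 0).
Proof.
have /choice[chi h] := fun v : gvertex => ex_grouplike_dual (gvertexP v).
exists chi; split=> [v w|v]; have [h1 h2 h3] := h v; last exact: h3.
by have [->|/eqP wv] := eqVneq; rewrite ?h1 // h2 //; [exact: gvertexP|move/val_inj].
Qed.

Lemma gr0_span x : gr 0%N x -> span (range (val : gvertex -> A)) x.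
Proof.
move=> /(pg_gr0 hP); apply: span_mono => g hg.
by exists (Sub g (asboolT hg)); rewrite ?SubK.
Qed.

Variable chi : gvertex -> {linear A -> k^o}.
Hypothesis chi_dual : forall v w, chi v (val w) = (w == v)%:R.
Hypothesis chi_deg : forall v m x, gr m x -> m <> 0%N -> chi v x = 0.

(** The [chi v] are orthogonal idempotents of the dual algebra; both sides live in degree 0, which
    the group-likes span. *)
Lemma chi_vv v w x : conv (chi v) (chi w) x = (w == v)%:R * (chi v x : k).
Proof.
apply: (graded_lin_ext (g := [the {linear A -> k^o} of (w == v)%:R \*: chi v])
  (pg_comul hP)) => n {}x gx /=.
have [n0|/eqP n0] := eqVneq n 0%N; last first.
  by rewrite (chi_deg _ gx n0) (conv_graded (pg_comul hP) (chi_deg v) (chi_deg w) gx n0) scaler0.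
rewrite n0 in gx; move: (gr0_span gx).
apply: (span_lin_ext (g := [the {linear A -> k^o} of (w == v)%:R \*: chi v])).
move=> _ [g _ <-] /=; have [gG _] := gvertexP g.
rewrite grouplike_conv // !chi_dual.
have [<-|] := eqVneq w v; first by rewrite -natrM mulnb andbb; symmetry; apply: mul1r.
move=> wv; rewrite -natrM mulnb scale0r; have [->|//] := eqVneq g v.
by rewrite eq_sym (negPf wv).
Qed.

(** Degree 1 splits only as [0 + 1] or [1 + 0], and the factor of degree 0 expands in group-likes;
    contracting with the dual [chi] recovers the cofactors. *)
Lemma gr1_comul y : gr 1%N y -> exists s0 : seq gvertex, forall s, uniq s ->
  {subset s0 <= s} -> comul A y = \sum_(w <- s) (val w ⊗ actl (chi w) y) +
    \sum_(v <- s) (actr (chi v) y ⊗ val v).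
Proof.
move=> gy; have [r [hr er]] := (pg_comul hP).2 _ _ gy.
have /choice[E hE] : forall x, exists s0 : seq gvertex, gr 0%N x -> forall s,
    uniq s -> {subset s0 <= s} -> x = \sum_(w <- s) (chi w x : k) *: val w.
  move=> x; have [/gr0_span/(dual_family_expand chi_dual)[s hs]|no] := pselect (gr 0%N x).
    by exists s.
  by exists [::].
exists (flatten [seq E z.2.1 ++ E z.2.2 | z <- r]) => s us sub.
have subE z : z \in r -> {subset E z.2.1 <= s} /\ {subset E z.2.2 <= s}.
  by move=> zr; split=> i iE; apply: sub; apply/flatten_mapP; exists z;
    rewrite // mem_cat iE ?orbT.
have lr z : z \in r -> z.2.1 ⊗ z.2.2 =
    \sum_(w <- s) (val w ⊗ ((chi w z.2.1 : k) *: z.2.2)) +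
    \sum_(v <- s) (((chi v z.2.2 : k) *: z.2.1) ⊗ val v).
  move=> zr; have [z1 z2 z3] := hr z zr; have [sub1 sub2] := subE z zr.
  have [z0|/eqP z0] := eqVneq z.1 0%N.
    rewrite [X in _ + X]big1 => [|v _]; last first.
      by rewrite (chi_deg v z3) ?z0 // scale0r linear0l.
    rewrite addr0 {1}(hE z.2.1 _ s) // -?z0 // linear_sumlz.
    by apply: eq_bigr => w _; rewrite linearZl_LR linearZr_LR.
  have z11 : z.1 = 1%N by move: z1 z0; case: (z.1) => [//|[|]].
  rewrite [X in X + _]big1 => [|v _]; last first.
    by rewrite (chi_deg v z2) // scale0r linear0r.
  rewrite add0r {1}(hE z.2.2 _ s) //; last by move: z3; rewrite z11.
  rewrite linear_sumr; apply: eq_bigr => w _.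
  by rewrite linearZl_LR linearZr_LR.
rewrite er big_seq (eq_bigr _ lr) -big_seq big_split exchange_big.
rewrite [X in _ + X = _]exchange_big; congr (_ + _); apply: eq_bigr => w _ /=.
  rewrite actlE er tlin_sum linear_sumr; apply: eq_bigr => z _.
  by rewrite lfst_pure.
rewrite actrE er tlin_sum linear_sumlz; apply: eq_bigr => z _.
by rewrite lsnd_pure.
Qed.

Lemma gr_actl v n x : gr n x -> gr n (actl (chi v) x).
Proof.
move=> gx; have [s [hs es]] := (pg_comul hP).2 _ _ gx.
rewrite actlE es tlin_sum; apply: (subspace_sum_seq (subspace_gr n)) => z /hs[z1 z2 z3] _.
rewrite lfst_pure; have [z0|/eqP z0] := eqVneq z.1 0%N.
  by apply: (subspaceZ _ (subspace_gr n)); rewrite z0 subn0 in z3.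
by rewrite (chi_deg v z2) // scale0r; apply: (subspace0 (subspace_gr n)).
Qed.

Lemma gr_actr v n x : gr n x -> gr n (actr (chi v) x).
Proof.
move=> gx; have [s [hs es]] := (pg_comul hP).2 _ _ gx.
rewrite actrE es tlin_sum; apply: (subspace_sum_seq (subspace_gr n)) => z /hs[z1 z2 z3] _.
rewrite lsnd_pure; have [z0|/eqP z0] := eqVneq (n - z.1)%N 0%N.
  apply: (subspaceZ _ (subspace_gr n)).
  by have -> : n = z.1 by apply/eqP; rewrite eqn_leq z1 -subn_eq0 z0.
by rewrite (chi_deg v z3) // scale0r; apply: (subspace0 (subspace_gr n)).
Qed.

Definition skew_set : set A := [set x | gr 1%N x /\
  exists w v : gvertex, comul A x = val w ⊗ x + x ⊗ val v].

(** Peirce decomposition of [gr 1] under the two actions of the idempotents [chi]. Applying the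
    counit, which vanishes in degree 1, to [gr1_comul] shows that finitely many components sum to
    [x]; the same formula makes each component skew-primitive. *)
Lemma gr1_span x : gr 1%N x -> span skew_set x.
Proof.
move=> gx.
have suml y : gr 1%N y -> exists s : seq gvertex, y = \sum_(w <- s) actl (chi w) y.
  move=> gy; have [s0 h] := gr1_comul gy; exists (undup s0).
  have {}h := h (undup s0) (undup_uniq _) (fun i => etrans (mem_undup _ _)).
  rewrite -[LHS]actl_counit actlE h tlinD !tlin_sum.
  rewrite [X in _ + X]big1 ?addr0 => [|v _]; last first.
    by rewrite lfst_pure counit_dualE (pg_counit hP (gr_actr v gy)) scale0r.
  apply: eq_bigr => w _; rewrite lfst_pure counit_dualE.
  by have [[_ ->] _] := gvertexP w; rewrite scale1r.
have sumr y : gr 1%N y -> exists s : seq gvertex, y = \sum_(w <- s) actr (chi w) y.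
  move=> gy; have [s0 h] := gr1_comul gy; exists (undup s0).
  have {}h := h (undup s0) (undup_uniq _) (fun i => etrans (mem_undup _ _)).
  rewrite -[LHS]actr_counit actrE h tlinD !tlin_sum.
  rewrite [X in X + _]big1 ?add0r => [|v _]; last first.
    by rewrite lsnd_pure counit_dualE (pg_counit hP (gr_actl v gy)) scale0r.
  apply: eq_bigr => w _; rewrite lsnd_pure counit_dualE.
  by have [[_ ->] _] := gvertexP w; rewrite scale1r.
have [s ->] := suml x gx; apply: (subspace_sum _ (subspace_span _)) => w _.
have gw := gr_actl w gx.
have [t ->] := sumr _ gw; apply: (subspace_sum _ (subspace_span _)) => v _.
apply: span_sub; set y := actr _ _; have gy : gr 1%N y by apply: gr_actr.
split=> //; exists w, v.
have actl_y w' : actl (chi w') y = (w' == w)%:R *: y.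
  rewrite /y actl_actr actl_actl; have -> : actl (conv (chi w) (chi w')) x =
      (w' == w)%:R *: actl (chi w) x.
    rewrite !actlE (@eq_lfst _ _ _ _ [the {linear A -> k^o} of (w' == w)%:R \*: chi w]).
      rewrite (tens_sum_pure (comul A x)) !tlin_sum scaler_sumr.
      by apply: eq_bigr => p _; rewrite !lfst_pure scalerA.
    by move=> u /=; rewrite chi_vv.
  by rewrite linearZ.
have actr_y v' : actr (chi v') y = (v' == v)%:R *: y.
  rewrite /y actr_actr !actrE.
  rewrite (@eq_lsnd _ _ _ _ [the {linear A -> k^o} of (v' == v)%:R \*: chi v]).
    rewrite (tens_sum_pure (comul A _)) !tlin_sum scaler_sumr.
    by apply: eq_bigr => p _; rewrite !lsnd_pure scalerA.
  by move=> u /=; rewrite chi_vv eq_sym; have [->|_] := eqVneq v' v; rewrite ?mul0r ?scale0r.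
have [s0 h] := gr1_comul gy.
have {}h := h (undup (w :: v :: s0)) (undup_uniq _).
rewrite h => [|i si]; last by rewrite mem_undup !inE si !orbT.
congr (_ + _).
  rewrite (bigD1_seq w) ?undup_uniq ?mem_undup ?mem_head //= big1 => [|w' ww'].
    by rewrite actl_y eqxx scale1r addr0.
  by rewrite actl_y (negPf ww') scale0r linear0r.
rewrite (bigD1_seq v) ?undup_uniq ?mem_undup ?inE ?eqxx ?orbT //= big1 => [|w' ww'].
  by rewrite actr_y eqxx scale1r addr0.
by rewrite actr_y (negPf ww') scale0r linear0l.
Qed.

End QuiverOfGraded.

Record graded_quiver (k : fieldType) (A : bialgebra k) (gr : nat -> set A)
    (Q : quiver) (ev : vertex Q -> A) (ea : arrow Q -> A)
    (cv : vertex Q -> {linear A -> k^o}) (ca : arrow Q -> {linear A -> k^o}) :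
    Prop := {
  gq_v : forall v, grouplike (ev v) /\ gr 0%N (ev v);
  gq_a : forall a, gr 1%N (ea a) /\
    comul A (ea a) = ev (tgt a) ⊗ ea a + ea a ⊗ ev (src a);
  gq_cv : forall v w, cv v (ev w) = (w == v)%:R;
  gq_ca : forall a b, ca a (ea b) = (b == a)%:R;
  gq_cv_deg : forall v m x, gr m x -> m <> 0%N -> cv v x = 0;
  gq_ca_deg : forall a m x, gr m x -> m <> 1%N -> ca a x = 0;
  gq_span0 : forall x, gr 0%N x -> span (range ev) x;
  gq_span1 : forall x, gr 1%N x -> span (range ea) x;
  gq_vv : forall v w x, conv (cv v) (cv w) x = (w == v)%:R * (cv v x : k)
}.

Lemma ex_graded_quiver (k : fieldType) (A : bialgebra k) (gr : nat -> set A) :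
  pointed_graded gr -> exists Q ev ea cv ca, @graded_quiver k A gr Q ev ea cv ca.
Proof.
move=> hP; have [chi [chi_dual chi_deg]] := ex_vdual hP.
(* The basis is extracted from the skew-primitive elements themselves, so that each basis vector has
   a source and a target. *)
have [S [SX indS XS]] := ex_basis (skew_set gr).
pose garrow : choiceType := {x : A | `[< S x >]}.
have garrowP (a : garrow) : S (val a) by apply/asboolP/(valP a).
have /choice[st hst] : forall a : garrow, exists p : gvertex gr * gvertex gr,
    comul A (val a) = val p.2 ⊗ val a + val a ⊗ val p.1.
  by move=> a; have [_ [w [v e]]] := SX _ (garrowP a); exists (v, w).
have sp1 x : gr 1%N x -> span S x.
  move=> /(gr1_span hP chi_dual chi_deg).
  by apply: span_min; [apply: subspace_span|].
have /choice[ca hca] : forall a : garrow, exists phi : {linear A -> k^o},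
    [/\ phi (val a) = 1, forall s, S s -> s <> val a -> phi s = 0 &
      forall d, span (\bigcup_(m in [set m | m <> 1%N]) gr m) d -> phi d = 0].
  move=> a; apply: independent_dual => //; first exact: subspace_span.
  move=> x hx; apply: (gr_disjoint hP).
  by apply: (span_min (subspace_gr hP 1)) hx => y /SX [].
exists (Quiver (fun a => (st a).1) (fun a => (st a).2)), val, val, chi, ca.
split=> //=.
- exact: gvertexP.
- by move=> a; split; [case: (SX _ (garrowP a))|exact: hst].
- move=> a b; have [h1 h2 _] := hca a; have [->|/eqP ba] := eqVneq b a; first exact: h1.
  by apply: h2; [exact: garrowP|move/val_inj].
- move=> a m x gx m1; have [_ _ h3] := hca a; apply: h3; apply: span_sub.
  by exists m.
- exact: gr0_span.
- move=> x /sp1; apply: span_mono => s Ss.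
  by exists (Sub s (asboolT Ss) : garrow); rewrite ?SubK.
- by move=> v w x; rewrite (chi_vv hP chi_dual chi_deg).
Qed.

(** * The embedding of the graded bialgebra into the path coalgebra *)

Section Embedding.
Variables (k : fieldType) (A : bialgebra k) (gr : nat -> set A).
Hypothesis hP : pointed_graded gr.
Variables (Q : quiver) (ev : vertex Q -> A) (ea : arrow Q -> A)
  (cv : vertex Q -> {linear A -> k^o}) (ca : arrow Q -> {linear A -> k^o}).
Hypothesis hQ : graded_quiver gr ev ea cv ca.
Local Notation kQ := (path_coalgebra k Q).
Local Notation vec := (@path_vec k Q : qpath Q -> kQ).

Lemma ca_scaled (phi : {linear A -> k^o}) (c : k) a :
  (forall b, phi (ea b) = c * (b == a)%:R) ->
  (forall n x, gr n x -> n <> 1%N -> phi x = 0) ->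
  forall x, phi x = c * (ca a x : k).
Proof.
move=> h1 h2; apply: (graded_lin_ext (g := [the {linear A -> k^o} of c \*: ca a])
  (pg_comul hP)) => n x gx /=.
have [n1|/eqP n1] := eqVneq n 1%N; last first.
  by rewrite (h2 _ _ gx n1) (gq_ca_deg hQ a gx n1) scaler0.
rewrite n1 in gx; move: (gq_span1 hQ gx).
apply: (span_lin_ext (g := [the {linear A -> k^o} of c \*: ca a])).
by move=> _ [b _ <-] /=; rewrite h1 (gq_ca hQ).
Qed.

Lemma gq_va v a x : conv (cv v) (ca a) x = (v == tgt a)%:R * (ca a x : k).
Proof.
apply: ca_scaled => [b|n {}x gx n1]; last first.
  exact: (conv_graded (pg_comul hP) (gq_cv_deg hQ v) (gq_ca_deg hQ a) gx n1).
have [gb db] := gq_a hQ b.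
rewrite convEl actlE db tlinD !lfst_pure linearD !linearZ /= !(gq_cv hQ, gq_ca hQ).
rewrite (gq_cv_deg hQ v gb) // scale0r addr0 (eq_sym v).
have [->|_] := eqVneq b a; first by [].
by rewrite mulr0 scaler0.
Qed.

Lemma gq_av v a x : conv (ca a) (cv v) x = (v == src a)%:R * (ca a x : k).
Proof.
apply: ca_scaled => [b|n {}x gx n1]; last first.
  by apply: (conv_graded (pg_comul hP) (gq_ca_deg hQ a) (gq_cv_deg hQ v) gx); rewrite addn0.
have [gb db] := gq_a hQ b.
rewrite convEl actlE db tlinD !lfst_pure linearD !linearZ /= !(gq_cv hQ, gq_ca hQ).
rewrite (gq_cv_deg hQ v gb) // scaler0 add0r (eq_sym v).
have [->|_] := eqVneq b a; first by rewrite mulr1 scale1r.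
by rewrite mulr0 scale0r.
Qed.

Lemma gq_dps : dual_path_system gr cv ca.
Proof.
split.
- by move=> v w n x _; apply: gq_vv hQ _ _ _.
- by move=> v a n x _; apply: gq_va.
- by move=> v a n x _; apply: gq_av.
- exact: gq_cv_deg hQ.
- exact: gq_ca_deg hQ.
- move=> n x gx; have [n0|/eqP n0] := eqVneq n 0%N.
    by rewrite n0 in gx; apply: (dual_family_finite (gq_cv hQ) (gq_span0 hQ gx)).
  by exists [::] => v; rewrite (gq_cv_deg hQ v gx n0).
- move=> n x gx; have [n0|/eqP n0] := eqVneq n 1%N.
    by rewrite n0 in gx; apply: (dual_family_finite (gq_ca hQ) (gq_span1 hQ gx)).
  by exists [::] => v; rewrite (gq_ca_deg hQ v gx n0).
Qed.

Variable f : {linear A -> kQ}.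
Hypothesis f_comul : coalgebra_map f.
Hypothesis f_v : forall v x, wcoef v [::] (f x) = cv v x.
Hypothesis f_a : forall a x, wcoef (src a) [:: a] (f x) = ca a x.
Hypothesis f_deg : forall n x, gr n x -> path_degree n (f x).

Lemma f_ev v : f (ev v) = vec (vpath v).
Proof.
apply: pcoef_eq => p; rewrite pcoef_vec; have [gG g0] := gq_v hQ v.
have [/qlength0P ->|p0] := eqVneq (qlength p) 0%N.
  rewrite -wcoef_path f_v (gq_cv hQ) (inj_eq (@vpath_inj Q)) //.
have /path_degreeP -> := f_deg g0; last exact/eqP.
by case: eqP => // e; rewrite -e in p0.
Qed.

Lemma f_ea a : f (ea a) = vec (apath a).
Proof.
apply: pcoef_eq => p; rewrite pcoef_vec; have [g1 _] := gq_a hQ a.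
have [/qlength1P[b ->]|p0] := eqVneq (qlength p) 1%N.
  by rewrite -wcoef_path f_a (gq_ca hQ) (inj_eq (@apath_inj Q)).
have /path_degreeP -> := f_deg g1; last exact/eqP.
by case: eqP => // e; rewrite -e in p0.
Qed.

Lemma f_counit x : counit kQ (f x) = counit A x.
Proof.
pose cA := counit_dual A; pose cQ : {linear A -> k^o} := counit_dual kQ \o f.
suff: cQ x = cA x by rewrite /cQ /= !counit_dualE.
apply: (graded_lin_ext (pg_comul hP)) => -[|n] {}x gx; last first.
  by rewrite /cQ /= !counit_dualE (counit_path_degree (f_deg gx)) (pg_counit hP gx).
apply: span_lin_ext (gq_span0 hQ gx) => _ [v _ <-].
have [[_ ge] _] := gq_v hQ v.
by rewrite /cQ /= !counit_dualE f_ev ge [LHS]path_counit_vecE.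
Qed.

Lemma f_injective : injective f.
Proof.
have inj_gr n x : gr n x -> f x = 0 -> x = 0.
  elim/ltn_ind: n x => -[|[|n]] IH x gx fx.
  - apply: (dual_family_eq0 (gq_cv hQ) (gq_span0 hQ gx)) => v.
    by rewrite -f_v fx linear0.
  - apply: (dual_family_eq0 (gq_ca hQ) (gq_span1 hQ gx)) => a.
    by rewrite -f_a fx linear0.
  (* Arrow coordinates separate [gr 1], and coefficients on paths of length [n.+1] separate
     [gr n.+1] by induction. Their convolutions at [x] are convolutions at [f x], which is zero. *)
  apply: (pg_strict hP (n := n) (E1 := range ca)
    (E2 := [set phi | exists2 p, qlength p = n.+1 &
      phi = [the {linear A -> k^o} of pcoef p \o f]])) gx _.
  - by move=> _ [a _ <-]; apply: gq_ca_deg hQ a.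
  - move=> u gu hu; apply: (dual_family_eq0 (gq_ca hQ) (gq_span1 hQ gu)) => a.
    by apply: hu; exists a.
  - move=> u gu hu; apply: (IH _ _ _ gu) => //; apply: pcoef_eq0 => p.
    have [pn|/eqP pn] := eqVneq (qlength p) n.+1; last first.
      by have /path_degreeP -> := f_deg gu.
    by apply: (hu (pcoef p \o f)); exists p.
  move=> _ _ [a _ <-] [p _ ->].
  transitivity (conv (wcoef (src a) [:: a] \o f) (pcoef p \o f) x).
    by apply: eq_conv => u //=; rewrite f_a.
  by rewrite -conv_map // fx linear0.
move=> x y fxy; apply/eqP; rewrite -subr_eq0; apply/eqP.
have : f (x - y) = 0 by rewrite linearB fxy subrr.
move: (x - y) => {fxy x y} z; have [_ /(_ z)[n [h [hh ->]]] _] := pg_direct hP.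
(* [f] preserves degrees, so the homogeneous components of an element of the kernel lie in the
   kernel. *)
move=> e; apply: big1 => i _; apply: inj_gr (hh i) _; apply: pcoef_eq0 => p.
have [pi|/eqP pi] := eqVneq (qlength p) i; last first.
  by have /path_degreeP -> := f_deg (hh i).
rewrite -[RHS](linear0 (pcoef p)) -e !linear_sum (bigD1 i) //= big1 ?addr0 //.
move=> j ji; have /path_degreeP -> // := f_deg (hh j).
by rewrite pi => ij; move: ji; rewrite -val_eqE /= ij eqxx.
Qed.

End Embedding.

(** * The product on the path coalgebra *)

Section CoalgebraMaps.
Variable k : fieldType.

Lemma tens_map_comp (U V U' V' U2 V2 : lmodType k) (f : {linear U -> U'})
    (g : {linear V -> V'}) (f' : {linear U' -> U2}) (g' : {linear V' -> V2})
    (t : (U ⊗ V)%type) :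
  tens_map (f' \o f) (g' \o g) t = tens_map f' g' (tens_map f g t).
Proof.
rewrite (tens_sum_pure t) !tens_map_sum; apply: eq_bigr => p _.
by rewrite !tens_map_pure.
Qed.

Lemma eq_tens_map (U V U' V' : lmodType k) (f f' : {linear U -> U'})
    (g g' : {linear V -> V'}) (t : (U ⊗ V)%type) :
  f =1 f' -> g =1 g' -> tens_map f g t = tens_map f' g' t.
Proof.
move=> hf hg; rewrite (tens_sum_pure t) !tens_map_sum; apply: eq_bigr => p _.
by rewrite !tens_map_pure hf hg.
Qed.

Lemma coalgebra_map_comp (C D E : coalgebra k) (f : {linear C -> D})
    (g : {linear D -> E}) :
  coalgebra_map f -> coalgebra_map g -> coalgebra_map (g \o f).
Proof. by move=> hf hg x; rewrite /= hg hf -tens_map_comp. Qed.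

Lemma coalgebra_map_id (C : coalgebra k) :
  coalgebra_map [the {linear C -> C} of idfun].
Proof.
move=> x; apply: (@tens_lin_ext _ _ _ _ idfun
  (tens_map [the {linear C -> C} of idfun] [the {linear C -> C} of idfun])).
by move=> u v; rewrite [RHS]tens_map_pure.
Qed.

Lemma shuffle_nat (U V W X U' V' W' X' : lmodType k) (f : {linear U -> U'})
    (g : {linear V -> V'}) (h : {linear W -> W'}) (i : {linear X -> X'}) s t :
  shuffle (tens_map f g s ⊗ tens_map h i t) =
  tens_map (tens_map f h) (tens_map g i) (shuffle (s ⊗ t)).
Proof.
rewrite [shuffle (s ⊗ t)]shuffle_expand tens_map_sum.
rewrite [X in shuffle (tens_map _ _ X ⊗ _)]tens_sum_pure.
rewrite [X in shuffle (_ ⊗ tens_map _ _ X)]tens_sum_pure.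
rewrite !tens_map_sum linear_sumlz tlin_sum; apply: eq_bigr => p _.
rewrite linear_sumr tlin_sum tens_map_sum; apply: eq_bigr => q _.
by rewrite !tens_map_pure shuffle_pure /= !tens_map_pure.
Qed.

Definition tensor_map (C D C' D' : coalgebra k) (h : {linear C -> C'})
    (h' : {linear D -> D'}) :
    {linear tens_coalgebra C D -> tens_coalgebra C' D'} :=
  locked [the {linear (C ⊗ D)%type -> (C' ⊗ D')%type} of tens_map h h'].

Lemma tensor_mapE (C D C' D' : coalgebra k) (h : {linear C -> C'})
    (h' : {linear D -> D'}) t : tensor_map h h' t = tens_map h h' t.
Proof. by rewrite /tensor_map -lock. Qed.

Lemma tensor_map_pure (C D C' D' : coalgebra k) (h : {linear C -> C'})
    (h' : {linear D -> D'}) x y : tensor_map h h' (x ⊗ y) = h x ⊗ h' y.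
Proof. by rewrite tensor_mapE tens_map_pure. Qed.

Lemma coalgebra_map_tensor (C D C' D' : coalgebra k) (h : {linear C -> C'})
    (h' : {linear D -> D'}) :
  coalgebra_map h -> coalgebra_map h' -> coalgebra_map (tensor_map h h').
Proof.
move=> hh hh' t.
apply: (@tens_lin_ext _ _ _ _ (comul _ \o tensor_map h h')
  (tens_map (tensor_map h h') (tensor_map h h') \o comul _)) => x y /=.
rewrite tensor_map_pure !tens_comul_pure hh hh' shuffle_nat.
by apply: eq_tens_map => u; rewrite tensor_mapE.
Qed.

Definition tensor_assoc (C D E : coalgebra k) :
    {linear tens_coalgebra (tens_coalgebra C D) E ->
      tens_coalgebra C (tens_coalgebra D E)} :=
  locked [the {linear (C ⊗ D ⊗ E)%type -> (C ⊗ (D ⊗ E))%type} of @tens_assoc k C D E].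

Lemma tensor_assoc_pure (C D E : coalgebra k) (x : C) (y : D) (z : E) :
  tensor_assoc C D E (x ⊗ y ⊗ z) = x ⊗ (y ⊗ z).
Proof. by rewrite /tensor_assoc -lock [LHS]tens_assoc_pure. Qed.

Lemma coalgebra_map_assoc (C D E : coalgebra k) : coalgebra_map (tensor_assoc C D E).
Proof.
move=> t.
apply: (@tens_lin_ext _ _ _ _ (comul _ \o tensor_assoc C D E)
  (tens_map (tensor_assoc C D E) (tensor_assoc C D E) \o comul _)) => xy z /=.
rewrite (tens_sum_pure xy) linear_sumlz !linear_sum.
apply: eq_bigr => -[x y] _ /=; rewrite tensor_assoc_pure !tens_comul_pure.
have -> : shuffle (comul D y ⊗ comul E z) =
  \sum_(p <- [seq (q.1 ⊗ r.1, q.2 ⊗ r.2) | q <- repr (comul D y), r <- repr (comul E z)])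
    p.1 ⊗ p.2 by rewrite shuffle_expand big_allpairs_dep.
have -> : shuffle (comul C x ⊗ comul D y) =
  \sum_(p <- [seq (q.1 ⊗ r.1, q.2 ⊗ r.2) | q <- repr (comul C x), r <- repr (comul D y)])
    p.1 ⊗ p.2 by rewrite shuffle_expand big_allpairs_dep.
rewrite [X in shuffle (X ⊗ _) = _]tens_sum_pure.
rewrite [X in _ = tens_map _ _ (shuffle (_ ⊗ X))]tens_sum_pure.
rewrite !shuffle_sum tens_map_sum big_allpairs_dep; apply: eq_bigr => p _.
rewrite big_allpairs_dep; apply: eq_bigr => q _.
rewrite tens_map_sum; apply: eq_bigr => r _.
by rewrite tens_map_pure !tensor_assoc_pure.
Qed.

(** Through this identity [comul_bmul] says that the product is a coalgebra map on the tensor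
    square, the form to which [path_map_unique] applies. *)
Lemma tens_map_shuffle (C : lmodType k) (b : {bilinear C -> C -> C})
    (m : {linear (C ⊗ C)%type -> C}) s t : (forall x y, m (x ⊗ y) = b x y) ->
  tens_map m m (shuffle (s ⊗ t)) = tens_mul b s t.
Proof.
move=> mb; rewrite shuffle_expand [in RHS](tens_sum_pure s) [in RHS](tens_sum_pure t).
rewrite tens_mul_sum tens_map_sum; apply: eq_bigr => p _.
rewrite tens_map_sum; apply: eq_bigr => q _.
by rewrite tens_map_pure !mb.
Qed.

Definition mul_map (C : coalgebra k) (M : bialgebra_structure C) :
  {linear tens_coalgebra C C -> C} := tlift (bmul M).

Lemma mul_map_pure (C : coalgebra k) (M : bialgebra_structure C) x y :
  mul_map M (x ⊗ y) = bmul M x y.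
Proof. exact: tlift_pure. Qed.

Lemma coalgebra_map_mul (C : coalgebra k) (M : bialgebra_structure C) :
  coalgebra_map (mul_map M).
Proof.
move=> t; apply: (@tens_lin_ext _ _ _ _ (comul _ \o mul_map M)
  (tens_map (mul_map M) (mul_map M) \o comul _)) => x y /=.
rewrite mul_map_pure comul_bmul tens_comul_pure.
by rewrite (tens_map_shuffle (b := bmul M)) // => u v; rewrite mul_map_pure.
Qed.

Lemma pure_linear_l (U V : lmodType k) (v : V) :
  linear (fun u : U => u ⊗ v : (U ⊗ V)%type).
Proof. by move=> a x y; rewrite linearPl. Qed.

(** A coalgebra map when [g] is group-like; composing the product with it lets the unit law be
    compared with the identity. *)
Definition insert_l (C D : coalgebra k) (g : C) : {linear D -> tens_coalgebra C D} :=
  locked (linear_of (@pure_linear_r k C D g)).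

Lemma insert_lE (C D : coalgebra k) (g : C) (x : D) : insert_l D g x = g ⊗ x.
Proof. by rewrite /insert_l -lock. Qed.

Definition insert_r (C D : coalgebra k) (g : D) : {linear C -> tens_coalgebra C D} :=
  locked (linear_of (@pure_linear_l C D g)).

Lemma insert_rE (C D : coalgebra k) (g : D) (x : C) : insert_r C g x = x ⊗ g.
Proof. by rewrite /insert_r -lock. Qed.

Lemma coalgebra_map_insert_l (C D : coalgebra k) (g : C) :
  grouplike g -> coalgebra_map (insert_l D g).
Proof.
move=> [dg _] x; rewrite insert_lE [LHS]tens_comul_pure dg.
rewrite (tens_sum_pure (comul D x)) linear_sumr tlin_sum tens_map_sum.
by apply: eq_bigr => p _; rewrite shuffle_pure tens_map_pure ?insert_lE ?insert_rE.
Qed.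

Lemma coalgebra_map_insert_r (C D : coalgebra k) (g : D) :
  grouplike g -> coalgebra_map (insert_r C g).
Proof.
move=> [dg _] x; rewrite insert_rE [LHS]tens_comul_pure dg.
rewrite (tens_sum_pure (comul C x)) linear_sumlz tlin_sum tens_map_sum.
by apply: eq_bigr => p _; rewrite shuffle_pure tens_map_pure ?insert_lE ?insert_rE.
Qed.

End CoalgebraMaps.

(** * Transport of the product to the path coalgebra *)

Section Structure.
Variables (k : fieldType) (A : bialgebra k) (gr : nat -> set A).
Hypothesis hP : pointed_graded gr.
Variables (Q : quiver) (ev : vertex Q -> A) (ea : arrow Q -> A)
  (cv : vertex Q -> {linear A -> k^o}) (ca : arrow Q -> {linear A -> k^o}).
Hypothesis hQ : graded_quiver gr ev ea cv ca.
Local Notation kQ := (path_coalgebra k Q).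
Local Notation vec := (@path_vec k Q : qpath Q -> kQ).
Variable f : {linear A -> kQ}.
Hypothesis f_comul : coalgebra_map f.
Hypothesis f_v : forall v x, wcoef v [::] (f x) = cv v x.
Hypothesis f_a : forall a x, wcoef (src a) [:: a] (f x) = ca a x.
Hypothesis f_deg : forall n x, gr n x -> path_degree n (f x).

(** A right inverse of [f] in degrees 0 and 1. Longer paths need not lie in the image of [f]; the
    value 0 keeps the section homogeneous there. *)
Definition section_vec (p : qpath Q) : A :=
  match qpath_val p with
  | (v, [::]) => ev v
  | (_, [:: a]) => ea a
  | _ => 0
  end.

Definition sect : {linear kQ -> A} :=
  locked [the {linear path_space k Q -> A} of path_lift section_vec].

Lemma sect_vec p : sect (vec p) = section_vec p.
Proof. by rewrite /sect -lock [LHS]path_lift_vec. Qed.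

Lemma sect_vpath v : sect (vec (vpath v)) = ev v.
Proof. exact: sect_vec. Qed.

Lemma sect_apath a : sect (vec (apath a)) = ea a.
Proof. exact: sect_vec. Qed.

Lemma sect_long p : (1 < qlength p)%N -> sect (vec p) = 0.
Proof. by rewrite sect_vec; case: p => -[x [|a [|b s]]]. Qed.

Lemma qlength_le1 (p : qpath Q) : (qlength p <= 1)%N ->
  (exists v, p = vpath v) \/ (exists a, p = apath a).
Proof.
rewrite leq_eqVlt ltnS leqn0 => /orP[/eqP/qlength1P|/eqP/qlength0P ->].
  by right.
by left; eexists.
Qed.

Lemma gr_sect p : gr (qlength p) (sect (vec p)).
Proof.
have [/qlength_le1[[v ->]|[a ->]]|p1] := leqP (qlength p) 1.
- by rewrite sect_vpath; case: (gq_v hQ v).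
- by rewrite sect_apath; case: (gq_a hQ a).
by rewrite sect_long //; apply: (subspace0 (subspace_gr hP _)).
Qed.

Lemma f_sect p : (qlength p <= 1)%N -> f (sect (vec p)) = vec p.
Proof.
move=> /qlength_le1[[v ->]|[a ->]].
  by rewrite sect_vpath (f_ev hQ f_v f_deg).
by rewrite sect_apath (f_ea hQ f_a f_deg).
Qed.

Lemma f_sect_deg n y : path_degree n y -> (n <= 1)%N -> f (sect y) = y.
Proof.
move=> hy n1; rewrite [y]path_expand !linear_sum !big_seq.
apply: eq_bigr => p /hy pn; rewrite !linearZ /=; congr (_ *: _).
by apply: f_sect; rewrite pn.
Qed.

Lemma sect_f n x : gr n x -> (n <= 1)%N -> sect (f x) = x.
Proof.
move=> gx n1; apply: (f_injective hP hQ f_comul f_v f_a f_deg).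
exact: f_sect_deg (f_deg gx) n1.
Qed.

Lemma sect_deg n y : path_degree n y -> (1 < n)%N -> sect y = 0.
Proof.
move=> hy n1; rewrite [y]path_expand linear_sum big_seq big1 // => p /hy pn.
by rewrite linearZ /= sect_long ?scaler0 // pn.
Qed.

Lemma comul_sect p : (qlength p <= 1)%N ->
  comul A (sect (vec p)) = tens_map sect sect (comul kQ (vec p)).
Proof.
move=> /qlength_le1[[v ->]|[a ->]].
  by rewrite comul_vpath tens_map_pure sect_vpath; case: (gq_v hQ v) => -[].
rewrite comul_apath (tlinD (tens_map sect sect)) /= !tens_map_pure !sect_vpath !sect_apath.
by case: (gq_a hQ a) => _ ->; apply: addrC.
Qed.

Definition sect_mul : {linear tens_coalgebra kQ kQ -> A} :=
  locked [the {linear tens_coalgebra kQ kQ -> A} of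
    mul_map (bialg_str A) \o tensor_map sect sect].

Lemma sect_mul_pure x y : sect_mul (x ⊗ y) = mulb (sect x) (sect y).
Proof. by rewrite /sect_mul -lock /= tensor_map_pure mul_map_pure. Qed.

Local Notation pgrad := (@path_grading k Q).
Local Notation tgrad := (tens_grading pgrad pgrad).

Lemma tgrad_graded : comul_graded tgrad.
Proof. exact: tens_comul_graded (path_comul_graded k Q) (path_comul_graded k Q). Qed.

Lemma tgradP n t : tgrad n t -> exists p q,
  (qlength p + qlength q)%N = n /\ t = vec p ⊗ vec q.
Proof. by move=> [i [j [_ [_ [<- [p /= <- <-] [q /= <- <-] ->]]]]]; exists p, q. Qed.

Lemma gr_sect_mul n t : tgrad n t -> gr n (sect_mul t).
Proof.
move=> /tgradP[p [q [<- ->]]]; rewrite sect_mul_pure.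
by apply: (pg_mul hP); apply: gr_sect.
Qed.

(** On pairs of paths of length at most 1, [sect_mul] is compatible with the comultiplications; on
    all other pairs the total degree exceeds [i + j] and both convolutions vanish. *)
Lemma conv_sect_mul (phi psi : {linear A -> k^o}) i j :
  (forall m x, gr m x -> m <> i -> phi x = 0) ->
  (forall m x, gr m x -> m <> j -> psi x = 0) -> (i + j <= 1)%N ->
  forall n t, tgrad n t ->
    conv (phi \o sect_mul) (psi \o sect_mul) t = conv phi psi (sect_mul t).
Proof.
move=> hphi hpsi ij n t gt; have [p [q [pqn et]]] := tgradP gt.
have [/andP[p1 q1]|long] := boolP ((qlength p <= 1) && (qlength q <= 1))%N.
  rewrite !convEl !actlE /= -lfst_map; congr (psi (lfst phi _)).
  rewrite et sect_mul_pure /mulb -(mul_map_pure (bialg_str A)) coalgebra_map_mul.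
  rewrite [comul (tens_coalgebra A A) _]tens_comul_pure !comul_sect // shuffle_nat.
  rewrite [comul (tens_coalgebra kQ kQ) _]tens_comul_pure -tens_map_comp.
  by apply: eq_tens_map => u; rewrite /sect_mul -lock /= tensor_mapE.
have n2 : n <> (i + j)%N.
  move=> e; move: ij long; rewrite -e -pqn => h.
  by rewrite (leq_trans (leq_addr _ _) h) (leq_trans (leq_addl _ _) h).
rewrite (conv_graded tgrad_graded (i := i) (j := j) _ _ gt n2) => [|m u gu mi|m u gu mj].
- by rewrite (conv_graded (pg_comul hP) hphi hpsi (gr_sect_mul gt) n2).
- by rewrite /= (hphi _ _ (gr_sect_mul gu)).
- by rewrite /= (hpsi _ _ (gr_sect_mul gu)).
Qed.

Lemma sect_mul_dps : dual_path_system tgrad (fun v => cv v \o sect_mul)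
  (fun a => ca a \o sect_mul).
Proof.
have dps := gq_dps hP hQ.
split.
- move=> v w n t gt; rewrite (conv_sect_mul (gq_cv_deg hQ v) (gq_cv_deg hQ w) _ gt) //.
  exact: gq_vv hQ _ _ _.
- move=> v a n t gt; rewrite (conv_sect_mul (gq_cv_deg hQ v) (gq_ca_deg hQ a) _ gt) //.
  by rewrite /= (gq_va hP hQ).
- move=> v a n t gt; rewrite (conv_sect_mul (gq_ca_deg hQ a) (gq_cv_deg hQ v) _ gt) //.
  by rewrite /= (gq_av hP hQ).
- by move=> v n t /gr_sect_mul; apply: (gq_cv_deg hQ).
- by move=> v n t /gr_sect_mul; apply: (gq_ca_deg hQ).
- by move=> n t /gr_sect_mul; apply: (dps_fin_v dps).
- by move=> n t /gr_sect_mul; apply: (dps_fin_a dps).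
Qed.

Variable m : {linear tens_coalgebra kQ kQ -> kQ}.
Hypothesis m_comul : coalgebra_map m.
Hypothesis m_v : forall v t, wcoef v [::] (m t) = cv v (sect_mul t).
Hypothesis m_a : forall a t, wcoef (src a) [:: a] (m t) = ca a (sect_mul t).
Hypothesis m_deg : forall n t, tgrad n t -> path_degree n (m t).

Lemma m_small n t : tgrad n t -> (n <= 1)%N -> m t = f (sect_mul t).
Proof.
move=> gt n1; apply: pcoef_eq => p.
have [pn|/eqP pn] := eqVneq (qlength p) n; last first.
  have /path_degreeP -> // := m_deg gt.
  by have /path_degreeP -> := f_deg (gr_sect_mul gt).
rewrite -pn in n1; case: (qlength_le1 n1) => [[v ->]|[a ->]].
  by rewrite -wcoef_path m_v f_v.
by rewrite -wcoef_path m_a f_a.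
Qed.

Lemma sect_m n t : tgrad n t -> (n <= 1)%N -> sect (m t) = sect_mul t.
Proof.
move=> gt n1; rewrite (m_small gt n1) (sect_f _ n1) //; exact: gr_sect_mul.
Qed.

Lemma sect_m0 n t : tgrad n t -> (1 < n)%N -> sect (m t) = 0.
Proof. by move=> /m_deg; apply: sect_deg. Qed.

Lemma tgrad_vec p q : tgrad (qlength p + qlength q) (vec p ⊗ vec q).
Proof. by exists (qlength p), (qlength q), (vec p), (vec q); split=> //; [exists p|exists q]. Qed.

Lemma m_deg_mul i j x y : path_degree i x -> path_degree j y ->
  path_degree (i + j) (m (x ⊗ y)).
Proof.
move=> hx hy; rewrite [x]path_expand [y]path_expand linear_sumlz linear_sum.
have sD := @subspace_path_degree k Q (i + j).
apply: (subspace_sum_seq sD) => p /hx pi _; rewrite linear_sumr linear_sum.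
apply: (subspace_sum_seq sD) => q /hy qj _; rewrite linearZl_LR linearZr_LR !linearZ.
apply: (subspaceZ _ sD); apply: (subspaceZ _ sD); apply: m_deg.
by rewrite -pi -qj; apply: tgrad_vec.
Qed.

Lemma m_bilinear : bilinear_for *:%R *:%R (fun x y : kQ => m (x ⊗ y)).
Proof.
by split=> w a x y; rewrite /= ?linearPl ?linearPr linearP.
Qed.

Definition path_mul : {bilinear kQ -> kQ -> kQ} := bilinear_of m_bilinear.

Lemma path_mulE x y : path_mul x y = m (x ⊗ y).
Proof. by []. Qed.

Lemma path_pair_ext (V : lmodType k) (h h' : {linear tens_coalgebra kQ kQ -> V}) :
  (forall p q, h (vec p ⊗ vec q) = h' (vec p ⊗ vec q)) -> h =1 h'.
Proof.
by move=> hh; apply: (graded_lin_ext tgrad_graded) => n t /tgradP[p [q [_ ->]]].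
Qed.

Lemma comul_path_mul x y :
  comul kQ (path_mul x y) = tens_mul path_mul (comul kQ x) (comul kQ y).
Proof.
rewrite path_mulE m_comul [comul (tens_coalgebra kQ kQ) _]tens_comul_pure.
exact: tens_map_shuffle.
Qed.

Lemma counit_path_mul x y :
  counit kQ (path_mul x y) = counit kQ x * counit kQ y.
Proof.
pose h : {linear tens_coalgebra kQ kQ -> k^o} := counit_dual kQ \o m.
pose h' := counit_dual (tens_coalgebra kQ kQ).
suff : h (x ⊗ y) = h' (x ⊗ y).
  by rewrite /h /h' /= !counit_dualE [counit (tens_coalgebra kQ kQ) _]tens_counit_pure.
apply: path_pair_ext => p q; rewrite /h /h' /= !counit_dualE.
rewrite [counit (tens_coalgebra kQ kQ) _]tens_counit_pure.
have gpq := tgrad_vec p q; move: (erefl (qlength p + qlength q)%N).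
(* In degree 0, [m] is the product of [A] seen through [f]; in positive total degree both counits
   vanish. *)
case: {2}(qlength p + qlength q)%N => [|n] epq.
  have p1 : (qlength p <= 1)%N by rewrite (leq_trans (leq_addr (qlength q) _)) ?epq.
  have q1 : (qlength q <= 1)%N by rewrite (leq_trans (leq_addl (qlength p) _)) ?epq.
  rewrite (m_small gpq) ?epq // (f_counit hP hQ f_v f_deg) sect_mul_pure.
  by rewrite [LHS]counit_bmul -!(f_counit hP hQ f_v f_deg) !f_sect.
rewrite (counit_path_degree (n := n)) ?epq -?epq; last exact: m_deg.
rewrite ![counit kQ _]path_counit_vecE -natrM mulnb.
by case: eqP => //= p0; case: eqP => // q0; rewrite p0 q0 in epq.
Qed.

Definition path_one : kQ := f (oneb A).

Lemma grouplike_path_one : grouplike path_one.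
Proof.
have [d1 e1] := grouplike_one A; split; last by rewrite (f_counit hP hQ f_v f_deg).
by rewrite f_comul d1 tens_map_pure.
Qed.

Lemma sect_one : sect path_one = oneb A.
Proof. by apply: (sect_f (pg_one hP)). Qed.

Lemma wcoef_sect_v v x : cv v (sect x) = wcoef v [::] x.
Proof.
apply: (@path_lin_ext k Q k^o (cv v \o sect) (wcoef v [::])) => p /=.
have [p1|p1] := leqP (qlength p) 1; first by rewrite -f_v f_sect.
rewrite sect_long // linear0 wcoef_vec; case: eqP => // e.
by rewrite /qlength e in p1.
Qed.

Lemma wcoef_sect_a a x : ca a (sect x) = wcoef (src a) [:: a] x.
Proof.
apply: (@path_lin_ext k Q k^o (ca a \o sect) (wcoef (src a) [:: a])) => p /=.
have [p1|p1] := leqP (qlength p) 1; first by rewrite -f_a f_sect.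
rewrite sect_long // linear0 wcoef_vec; case: eqP => // e.
by rewrite /qlength e in p1.
Qed.

Lemma path_mul1l : left_id path_one path_mul.
Proof.
move=> x; rewrite path_mulE -insert_lE.
apply: (path_map_unique (h := m \o insert_l kQ path_one)
  (h' := [the {linear kQ -> kQ} of idfun])).
- by apply: coalgebra_map_comp => //; apply: coalgebra_map_insert_l grouplike_path_one.
- exact: coalgebra_map_id.
- move=> v y /=; rewrite m_v insert_lE sect_mul_pure sect_one /mulb bmul1l.
  exact: wcoef_sect_v.
- move=> a y /=; rewrite m_a insert_lE sect_mul_pure sect_one /mulb bmul1l.
  exact: wcoef_sect_a.
Qed.

Lemma path_mul1r : right_id path_one path_mul.
Proof.
move=> x; rewrite path_mulE -insert_rE.
apply: (path_map_unique (h := m \o insert_r kQ path_one)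
  (h' := [the {linear kQ -> kQ} of idfun])).
- by apply: coalgebra_map_comp => //; apply: coalgebra_map_insert_r grouplike_path_one.
- exact: coalgebra_map_id.
- move=> v y /=; rewrite m_v insert_rE sect_mul_pure sect_one /mulb bmul1r.
  exact: wcoef_sect_v.
- move=> a y /=; rewrite m_a insert_rE sect_mul_pure sect_one /mulb bmul1r.
  exact: wcoef_sect_a.
Qed.

(* In degree at least [2] both sides vanish: [sect] does on the left, and on the
   right the product has degree at least [2]. *)
Lemma sect_mul_assocl (phi : {linear A -> k^o}) p q r :
  (forall n x, gr n x -> (1 < n)%N -> phi x = 0) ->
  phi (mulb (sect (m (vec p ⊗ vec q))) (sect (vec r))) =
  phi (mulb (mulb (sect (vec p)) (sect (vec q))) (sect (vec r))).
Proof.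
move=> hphi; have gpq := tgrad_vec p q.
have [n1|n1] := leqP (qlength p + qlength q) 1.
  by rewrite (sect_m gpq n1) sect_mul_pure.
rewrite (sect_m0 gpq n1) /mulb linear0l linear0.
have := gr_sect_mul gpq; rewrite sect_mul_pure => gm.
rewrite (hphi _ _ (pg_mul hP gm (gr_sect r))) //.
exact: leq_trans n1 (leq_addr _ _).
Qed.

Lemma sect_mul_assocr (phi : {linear A -> k^o}) p q r :
  (forall n x, gr n x -> (1 < n)%N -> phi x = 0) ->
  phi (mulb (sect (vec p)) (sect (m (vec q ⊗ vec r)))) =
  phi (mulb (sect (vec p)) (mulb (sect (vec q)) (sect (vec r)))).
Proof.
move=> hphi; have gqr := tgrad_vec q r.
have [n1|n1] := leqP (qlength q + qlength r) 1.
  by rewrite (sect_m gqr n1) sect_mul_pure.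
rewrite (sect_m0 gqr n1) /mulb linear0r linear0.
have := gr_sect_mul gqr; rewrite sect_mul_pure => gm.
rewrite (hphi _ _ (pg_mul hP (gr_sect p) gm)) //.
exact: leq_trans n1 (leq_addl _ _).
Qed.

(** Both bracketings are coalgebra maps on the triple tensor product, so only vertex and arrow
    coefficients are compared. These are [cv] and [ca] of products in [A], and [ext] treats both as
    functionals vanishing above degree 1. *)
Lemma path_mulA : associative path_mul.
Proof.
move=> x y z; rewrite !path_mulE; symmetry.
pose idm := [the {linear kQ -> kQ} of idfun].
have idP : coalgebra_map idm by apply: coalgebra_map_id.
pose h : {linear tens_coalgebra (tens_coalgebra kQ kQ) kQ -> kQ} :=
  m \o tensor_map m idm.
pose h' : {linear tens_coalgebra (tens_coalgebra kQ kQ) kQ -> kQ} :=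
  m \o (tensor_map idm m \o tensor_assoc kQ kQ kQ).
have -> : m (m (x ⊗ y) ⊗ z) = h (x ⊗ y ⊗ z) by rewrite /h /= tensor_map_pure.
have -> : m (x ⊗ m (y ⊗ z)) = h' (x ⊗ y ⊗ z).
  by rewrite /h' /= tensor_assoc_pure tensor_map_pure.
have ext (phi : {linear A -> k^o}) : (forall n x, gr n x -> (1 < n)%N -> phi x = 0) ->
    forall t, phi (sect_mul (tensor_map m idm t)) =
      phi (sect_mul (tensor_map idm m (tensor_assoc kQ kQ kQ t))).
  move=> hphi.
  have gr3 := tens_comul_graded tgrad_graded (path_comul_graded k Q).
  apply: (graded_lin_ext (f := phi \o (sect_mul \o tensor_map m idm))
    (g := phi \o (sect_mul \o (tensor_map idm m \o tensor_assoc kQ kQ kQ))) gr3).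
  move=> n _ [i [j [_ [_ [_ /tgradP[p [q [_ ->]]] [r _ <-] ->]]]]] /=.
  rewrite tensor_assoc_pure !tensor_map_pure !sect_mul_pure.
  by rewrite sect_mul_assocl // sect_mul_assocr // /mulb bmulA.
apply: path_map_unique.
- by apply: coalgebra_map_comp => //; apply: coalgebra_map_tensor.
- apply: coalgebra_map_comp => //; apply: coalgebra_map_comp.
    exact: coalgebra_map_assoc.
  exact: coalgebra_map_tensor.
- move=> v t; rewrite /h /h' /= !m_v; apply: ext => n u gu n1.
  by apply: (gq_cv_deg hQ v gu) => e; rewrite e in n1.
- move=> a t; rewrite /h /h' /= !m_a; apply: ext => n u gu n1.
  by apply: (gq_ca_deg hQ a gu) => e; rewrite e in n1.
Qed.

Definition path_structure : bialgebra_structure kQ :=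
  BialgebraStructure path_mulA path_mul1l path_mul1r comul_path_mul
    grouplike_path_one.1 counit_path_mul grouplike_path_one.2.

Lemma path_structure_graded : graded_structure path_structure.
Proof.
by split; [exact: m_deg_mul|exact: f_deg (pg_one hP)].
Qed.

Lemma f_mul x y : f (mulb x y) = path_mul (f x) (f y).
Proof.
pose h : {linear tens_coalgebra A A -> kQ} := f \o mul_map (bialg_str A).
pose h' : {linear tens_coalgebra A A -> kQ} := m \o tensor_map f f.
have -> : f (mulb x y) = h (x ⊗ y) by rewrite /h /= mul_map_pure.
have -> : path_mul (f x) (f y) = h' (x ⊗ y) by rewrite /h' /= tensor_map_pure.
have grA := tens_comul_graded (pg_comul hP) (pg_comul hP).
have ext (phi : {linear A -> k^o}) : (forall n x, gr n x -> (1 < n)%N -> phi x = 0) ->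
    forall t, phi (mul_map (bialg_str A) t) = phi (sect_mul (tensor_map f f t)).
  move=> hphi.
  apply: (graded_lin_ext (f := phi \o mul_map (bialg_str A))
    (g := phi \o (sect_mul \o tensor_map f f)) grA).
  move=> n t [i [j [u [v [_ gu gv ->]]]]] /=.
  rewrite mul_map_pure tensor_map_pure sect_mul_pure.
  (* If a factor has degree at least 2, [sect] kills its image, and the product in [A] is out of
     reach of [phi]. *)
  have [i1|i1] := leqP i 1; last first.
    rewrite (sect_deg (f_deg gu) i1) /mulb linear0l linear0.
    exact: hphi (pg_mul hP gu gv) (leq_trans i1 (leq_addr _ _)).
  have [j1|j1] := leqP j 1; last first.
    rewrite (sect_deg (f_deg gv) j1) /mulb linear0r linear0.
    exact: hphi (pg_mul hP gu gv) (leq_trans j1 (leq_addl _ _)).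
  by rewrite (sect_f gu i1) (sect_f gv j1).
apply: path_map_unique.
- by apply: coalgebra_map_comp => //; apply: coalgebra_map_mul.
- by apply: coalgebra_map_comp => //; apply: coalgebra_map_tensor.
- move=> v t; rewrite /h /h' /= m_v f_v; apply: ext => n u gu n1.
  by apply: (gq_cv_deg hQ v gu) => e; rewrite e in n1.
- move=> a t; rewrite /h /h' /= m_a f_a; apply: ext => n u gu n1.
  by apply: (gq_ca_deg hQ a gu) => e; rewrite e in n1.
Qed.

Lemma path_structure_realization : realization path_structure f.
Proof.
split.
- exact: (f_injective hP hQ f_comul f_v f_a f_deg).
- by split; [exact: f_mul|by []|exact: f_comul|exact: (f_counit hP hQ f_v f_deg)].
move=> x0 x1 h0 h1; exists (sect (x0 + x1)) => //.
by rewrite !linearD /= (f_sect_deg h0) // (f_sect_deg h1).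
Qed.

End Structure.

Theorem ex_realization (k : fieldType) (A : bialgebra k) (gr : nat -> set A) :
  pointed_graded gr ->
  exists (Q : quiver) (M : bialgebra_structure (path_coalgebra k Q))
    (f : {linear A -> path_coalgebra k Q}), graded_structure M /\ realization M f.
Proof.
move=> hP; have [Q [ev [ea [cv [ca hQ]]]]] := ex_graded_quiver hP.
have [f [f_comul f_v f_a f_deg]] := ex_graded_path_map (pg_comul hP) (gq_dps hP hQ).
have [m [m_comul m_v m_a m_deg]] := ex_graded_path_map (@tgrad_graded k Q)
  (sect_mul_dps hP hQ).
exists Q, (path_structure hP hQ f_comul f_v f_a f_deg m_comul m_v m_a m_deg), f.
split; first exact: path_structure_graded.
exact: path_structure_realization.
Qed.

(** * Uniqueness *)

Lemma ex_retraction (k : fieldType) (U V : lmodType k) (f : {linear U -> V}) :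
  injective f -> exists r : {linear V -> U}, forall x, r (f x) = x.
Proof.
move=> injf; have sR : subspace (range f).
  split=> [|a _ _ [x _ <-] [y _ <-]]; first by exists 0; rewrite ?linear0.
  by exists (a *: x + y); rewrite ?linearP.
have [E [ER EK]] := ex_projection sR.
have /choice[r hr] : forall y, exists x, f x = E y.
  by move=> y; have [x _ e] := ER y; exists x.
have lin_r : linear r.
  by move=> a x y; apply: injf; rewrite linearP !hr linearP.
by exists (linear_of lin_r) => x; apply: injf; rewrite hr EK //; exists x.
Qed.

(** Over a field an injective linear map has a retraction [r], and [r ⊗ r] is a retraction of
    [f ⊗ f]. It lets embeddings reflect the equations of group-like and skew-primitive elements. *)
Lemma tens_map_injective (k : fieldType) (U V : lmodType k) (f : {linear U -> V}) :
  injective f -> injective (tens_map f f).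
Proof.
move=> /ex_retraction[r hr] s t /(congr1 (tens_map r r)).
rewrite -!tens_map_comp.
have id w : tens_map (r \o f) (r \o f) w = w.
  rewrite [RHS]tens_sum_pure {1}[w]tens_sum_pure tens_map_sum.
  by apply: eq_bigr => p _; rewrite tens_map_pure /= !hr.
by rewrite !id.
Qed.

Lemma injective_card_le (T U : Type) (A : set T) (B : set U) (f : A -> B) :
  injective f -> (A #<= B)%card.
Proof.
move=> injf; apply/card_leP/injfunPex; exists f => //.
by move=> x y _ _; apply: injf.
Qed.

Section PathCoefficientFacts.
Variables (k : fieldType) (Q : quiver).
Local Notation kQ := (path_coalgebra k Q).
Local Notation vec := (@path_vec k Q : qpath Q -> kQ).

Lemma wcoef_degree n (x : kQ) v s : path_degree n x -> size s <> n ->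
  wcoef v s x = 0.
Proof.
move=> /path_degreeP hx sn; rewrite /wcoef; case: insubP => // p _ ep.
by apply: hx; rewrite /qlength ep.
Qed.

Lemma wcoef_v_degree n (x : kQ) v : path_degree n x -> n <> 0%N ->
  wcoef v [::] x = 0.
Proof. by move=> hx n0; apply: (wcoef_degree _ hx); apply: nesym. Qed.

Lemma wcoef_a_degree n (x : kQ) v a : path_degree n x -> n <> 1%N ->
  wcoef v [:: a] x = 0.
Proof. by move=> hx n0; apply: (wcoef_degree _ hx); apply: nesym. Qed.

Lemma wcoef_finite_v (x : kQ) :
  exists s : seq (vertex Q), forall v, wcoef v [::] x <> 0 -> v \in s.
Proof.
exists [seq (qpath_val p).1 | p <- dom x] => v; rewrite (wcoef_path k (vpath v)).
by move=> /eqP; rewrite -mem_dom_pcoef => vx; apply/mapP; exists (vpath v).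
Qed.

Lemma wcoef_finite_a (x : kQ) :
  exists s : seq (arrow Q), forall a, wcoef (src a) [:: a] x <> 0 -> a \in s.
Proof.
exists (flatten [seq (qpath_val p).2 | p <- dom x]) => a.
rewrite (wcoef_path k (apath a)).
move=> /eqP; rewrite -mem_dom_pcoef => ax; apply/flatten_mapP; exists (apath a) => //.
exact: mem_head.
Qed.

End PathCoefficientFacts.

(** * Comparison of two realizations in degrees 0 and 1 *)

Section Comparison.
Variables (k : fieldType) (A : bialgebra k).

(** [realization_deg01] with one summand zero gives preimages of the paths of length [d]; sending
    the other paths to 0 makes functionals composed with [u] homogeneous, as [conv_graded] wants. *)
Lemma ex_realization_section (Q : quiver) (M : bialgebra_structure (path_coalgebra k Q))
    (f : {linear A -> path_coalgebra k Q}) d : realization M f -> (d <= 1)%N ->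
  exists u : {linear path_coalgebra k Q -> A},
    [/\ forall x, path_degree d x -> f (u x) = x,
        forall z, path_degree d (f z) -> u (f z) = z &
        forall n x, path_degree n x -> n <> d -> u x = 0].
Proof.
move=> [injf _ rg] d1.
have /choice[u hu] : forall p : qpath Q, exists z : A,
    f z = (qlength p == d)%:R *: (path_vec k p : path_coalgebra k Q).
  move=> p; have [pd|_] := eqVneq; last by exists 0; rewrite linear0 scale0r.
  have sD n := @subspace_path_degree k Q n.
  rewrite scale1r; case: d d1 pd => [|[|//]] _ pd.
    have [|z _ ez] := rg (path_vec k p) 0 _ (subspace0 (sD 1%N)).
      by rewrite -pd; apply: path_deg_vec.
    by exists z; rewrite ez addr0.
  have [|z _ ez] := rg 0 (path_vec k p) (subspace0 (sD 0%N)).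
    by rewrite -pd; apply: path_deg_vec.
  by exists z; rewrite ez add0r.
pose U : {linear path_coalgebra k Q -> A} :=
  [the {linear path_space k Q -> A} of path_lift u].
have Uvec p : U (path_vec k p) = u p by apply: path_lift_vec.
have fU x : path_degree d x -> f (U x) = x.
  move=> hx; rewrite [x]path_expand !linear_sum !big_seq; apply: eq_bigr => p /hx pd.
  by rewrite !linearZ; congr (_ *: _); rewrite Uvec hu pd eqxx scale1r.
exists U; split=> // [z hz|n x hx nd]; first exact/injf/fU.
rewrite [x]path_expand linear_sum big_seq big1 // => p /hx pn.
rewrite linearZ Uvec; apply/eqP; rewrite scaler_eq0; apply/orP; right.
by apply/eqP/injf; rewrite hu linear0 pn; case: eqP nd => //; rewrite scale0r.
Qed.

Lemma realization_comul (Q : quiver) (M : bialgebra_structure (path_coalgebra k Q))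
    (f : {linear A -> path_coalgebra k Q}) : realization M f -> coalgebra_map f.
Proof. by move=> [_ [_ _ h _] _] x; apply: h. Qed.

Lemma realization_grouplike (Q : quiver) (M : bialgebra_structure (path_coalgebra k Q))
    (f : {linear A -> path_coalgebra k Q}) z : realization M f ->
  grouplike z <-> grouplike (f z).
Proof.
move=> rf; have hf := realization_comul rf; have [injf [_ _ _ ef] _] := rf.
split=> -[dz ez]; split.
- by rewrite hf dz tens_map_pure.
- by rewrite [LHS]ef.
- by apply: (tens_map_injective injf); rewrite -hf dz tens_map_pure.
- by rewrite -ef.
Qed.

(* The graded coalgebra map induced by [f' \o f^-1] in degrees [0] and [1]; in
   degree [1], [f'] need not be graded. *)
Record comparison (Q Q' : quiver) (f : {linear A -> path_coalgebra k Q})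
    (f' : {linear A -> path_coalgebra k Q'})
    (F : {linear path_coalgebra k Q -> path_coalgebra k Q'}) : Prop := {
  comparison_comul : coalgebra_map F;
  comparison_deg : forall n x, path_degree n x -> path_degree n (F x);
  comparison0 : forall z, path_degree 0 (f z) -> F (f z) = f' z;
  comparison1 : forall z, path_degree 1 (f z) ->
    exists2 z0, path_degree 0 (f' z0) & f' z = F (f z) + f' z0
}.

Variables (Q Q' : quiver).
Local Notation kQ := (path_coalgebra k Q).
Local Notation kQ' := (path_coalgebra k Q').
Variables (M : bialgebra_structure kQ) (M' : bialgebra_structure kQ').
Variables (f : {linear A -> kQ}) (f' : {linear A -> kQ'}).
Hypothesis rf : realization M f.
Hypothesis rf' : realization M' f'.

Lemma skew_primitive_transfer z y x : comul A z = y ⊗ z + z ⊗ x ->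
  comul kQ' (f' z) = f' y ⊗ f' z + f' z ⊗ f' x.
Proof.
move=> dz; rewrite (realization_comul rf') dz (tlinD (tens_map f' f')) /=.
by rewrite !tens_map_pure.
Qed.

(** For an arrow [a], the element [f' (u1 a)] is skew-primitive between the images of the ends of
    [a], hence supported on vertices and arrows. Its arrow coefficients supply [la]; its vertex part
    is the correction [f' z0]. *)
Lemma ex_comparison : exists F : {linear kQ -> kQ'}, comparison f f' F.
Proof.
have [injf _ _] := rf; have [injf' _ rg'] := rf'.
have [u0 [f_u0 u0_f u0_deg]] := ex_realization_section rf (leq0n 1).
have [u1 [f_u1 u1_f u1_deg]] := ex_realization_section rf (leqnn 1).
have vdeg (R : quiver) (v : vertex R) : path_degree 0 (path_vec k (vpath v)).
  exact: (@path_deg_vec k R (vpath v)).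
have adeg (R : quiver) (a : arrow R) : path_degree 1 (path_vec k (apath a)).
  exact: (@path_deg_vec k R (apath a)).
have gl v : grouplike (u0 (path_vec k (vpath v))).
  by apply/(realization_grouplike _ rf); rewrite f_u0 //; apply: grouplike_vpath.
have /choice[sg hsg] : forall v, exists w,
    f' (u0 (path_vec k (vpath v))) = path_vec k (vpath w).
  by move=> v; apply: grouplike_path; apply/(realization_grouplike _ rf').
have skew a : comul kQ' (f' (u1 (path_vec k (apath a)))) =
    path_vec k (vpath (sg (tgt a))) ⊗ f' (u1 (path_vec k (apath a))) +
    f' (u1 (path_vec k (apath a))) ⊗ path_vec k (vpath (sg (src a))).
  rewrite -!hsg; apply: skew_primitive_transfer; apply: (tens_map_injective injf).
  rewrite -(realization_comul rf) (tlinD (tens_map f f)) /= !tens_map_pure.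
  by rewrite f_u1 // !f_u0 // comul_apath addrC.
have [lv lvE] : exists lv : vertex Q' -> {linear kQ -> k^o},
    forall v x, lv v x = wcoef v [::] (f' (u0 x)).
  by exists (fun v => wcoef v [::] \o (f' \o u0)).
have [la laE] : exists la : arrow Q' -> {linear kQ -> k^o},
    forall a x, la a x = wcoef (src a) [:: a] (f' (u1 x)).
  by exists (fun a => wcoef (src a) [:: a] \o (f' \o u1)).
have lv_deg v' n x : path_grading n x -> n <> 0%N -> lv v' x = 0.
  move=> [p /= pn <-] n0; rewrite lvE (u0_deg n) ?linear0 //.
  by rewrite -pn; apply: path_deg_vec.
have la_deg a' n x : path_grading n x -> n <> 1%N -> la a' x = 0.
  move=> [p /= pn <-] n0; rewrite laE (u1_deg n) ?linear0 //.
  by rewrite -pn; apply: path_deg_vec.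
have lv_vec v' v : lv v' (path_vec k (vpath v)) = (sg v == v')%:R.
  by rewrite lvE hsg wcoef_vpath andbT.
have lv_a v' b : lv v' (path_vec k (apath b)) = 0.
  by apply: (lv_deg v' 1%N) => //; exists (apath b).
have gp := path_comul_graded k Q.
have dps : dual_path_system (@path_grading k Q) lv la.
  split.
  - move=> v w n x gx; have [n0|/eqP n0] := eqVneq n 0%N; last first.
      by rewrite (lv_deg v n x gx n0) (conv_graded gp (lv_deg v) (lv_deg w) gx n0) mulr0.
    move: gx; rewrite n0 => -[p /= /qlength0P -> <-].
    rewrite grouplike_conv ?lv_vec; last exact: grouplike_vpath.
    have [->|wv] := eqVneq w v.
      by rewrite -natrM mulnb andbb [RHS]mul1r.
    rewrite [RHS]mul0r -natrM mulnb; case: eqP => //= ->.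
    by rewrite eq_sym (negPf wv).
  - move=> v a n x gx; have [n1|/eqP n1] := eqVneq n 1%N; last first.
      by rewrite (la_deg a n x gx n1) (conv_graded gp (lv_deg v) (la_deg a) gx n1) mulr0.
    move: gx; rewrite n1 => -[p /= /qlength1P[b ->] <-].
    rewrite convEl actlE comul_apath tlinD !lfst_pure linearD !linearZ /=.
    rewrite lv_a scale0r add0r.
    (* The relation is imported from [Q']: [conv_wcoef] is evaluated at [f' (u1 b)], whose
       comultiplication is given by [skew]. *)
    rewrite lv_vec; have := conv_wcoef v [::] (src a) [:: a] (f' (u1 (path_vec k (apath b)))).
    rewrite convEl actlE skew tlinD !lfst_pure linearD !linearZ /= wcoef_vpath.
    by rewrite wcoef_vpath !andbF scaler0 addr0 andbT laE.
  - move=> v a n x gx; have [n1|/eqP n1] := eqVneq n 1%N; last first.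
      rewrite (la_deg a n x gx n1) (conv_graded gp (la_deg a) (lv_deg v) gx) ?mulr0 //.
    move: gx; rewrite n1 => -[p /= /qlength1P[b ->] <-].
    rewrite convEl actlE comul_apath tlinD !lfst_pure linearD !linearZ /=.
    rewrite lv_a scaler0 addr0.
    rewrite lv_vec; have := conv_wcoef (src a) [:: a] v [::] (f' (u1 (path_vec k (apath b)))).
    rewrite convEl actlE skew tlinD !lfst_pure linearD !linearZ /= wcoef_vpath.
    rewrite wcoef_vpath !andbF scale0r add0r andbT (eq_sym (src a)).
    by rewrite laE => ->; have [->|_] := eqVneq v (src a); rewrite ?mul0r.
  - exact: lv_deg.
  - exact: la_deg.
  - move=> n x _; have [s hs] := wcoef_finite_v (f' (u0 x)).
    by exists s => v; rewrite lvE; apply: hs.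
  - move=> n x _; have [s hs] := wcoef_finite_a (f' (u1 x)).
    by exists s => a; rewrite laE; apply: hs.
have [F [F_comul F_v F_a F_deg']] := ex_graded_path_map gp dps.
have F_deg n x : path_degree n x -> path_degree n (F x).
  move=> hx; rewrite [x]path_expand linear_sum.
  apply: (subspace_sum_seq (@subspace_path_degree k Q' n)) => p /hx pn _.
  rewrite linearZ; apply: (subspaceZ _ (@subspace_path_degree k Q' n)).
  by apply: F_deg'; exists p.
have f'0 z : path_degree 0 (f z) -> path_degree 0 (f' z).
  move=> hz; rewrite -(u0_f z hz) [f z]path_expand !linear_sum.
  apply: (subspace_sum_seq (@subspace_path_degree k Q' 0)) => p /hz /qlength0P -> _.
  rewrite !linearZ; apply: (subspaceZ _ (@subspace_path_degree k Q' 0)).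
  by rewrite /= hsg.
have eq0 (x y : kQ') : path_degree 0 x -> path_degree 0 y ->
    (forall v, wcoef v [::] x = wcoef v [::] y) -> x = y.
  move=> /path_degreeP hx /path_degreeP hy h; apply: pcoef_eq => p.
  have [/qlength0P ->|/eqP p0] := eqVneq (qlength p) 0%N.
    by rewrite -wcoef_path h.
  by rewrite hx // hy.
exists F; split=> // z hz.
  apply: eq0; [exact: F_deg|exact: f'0|move=> v].
  by rewrite F_v lvE u0_f.
have long p : (1 < qlength p)%N -> pcoef p (f' z) = 0.
  move=> p1; rewrite -(u1_f z hz) [f z]path_expand !linear_sum big_seq big1 // => q /hz.
  move=> /qlength1P[a ->]; rewrite !linearZ /=.
  by rewrite (skew_primitive_path (skew a)) // scaler0.
have d0 : path_degree 0 (f' z - F (f z)).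
  apply/path_degreeP => p p0; rewrite linearB /=.
  have [pl|p1] := ltnP 1 (qlength p).
    rewrite long //; have /path_degreeP -> := F_deg _ _ hz; rewrite ?subrr //.
    by move=> e; rewrite e in pl.
  have /qlength1P[a ->] : qlength p = 1%N by case: (qlength p) p0 p1 => [|[|]].
  by rewrite -wcoef_path F_a laE u1_f // subrr.
have [z0 _ ez0] := rg' _ _ d0 (subspace0 (@subspace_path_degree k Q' 1)).
rewrite addr0 in ez0; exists z0; first by rewrite ez0.
by rewrite ez0 addrC subrK.
Qed.

End Comparison.

Section Uniqueness.
Variables (k : fieldType) (A : bialgebra k).

Lemma path_map_unique_graded (Q Q' : quiver)
    (h h' : {linear path_coalgebra k Q -> path_coalgebra k Q'}) :
  coalgebra_map h -> coalgebra_map h' ->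
  (forall n x, path_degree n x -> path_degree n (h x)) ->
  (forall n x, path_degree n x -> path_degree n (h' x)) ->
  (forall v, h (path_vec k (vpath v)) = h' (path_vec k (vpath v))) ->
  (forall a b, wcoef (src b) [:: b] (h (path_vec k (apath a))) =
     wcoef (src b) [:: b] (h' (path_vec k (apath a)))) ->
  h =1 h'.
Proof.
move=> hh hh' dh dh' e0 e1; apply: path_map_unique => // [v|b] x.
  apply: (@path_lin_ext k Q k^o (wcoef v [::] \o h) (wcoef v [::] \o h')) => p /=.
  have dp := @path_deg_vec k Q p.
  have [/qlength0P ->|/eqP p0] := eqVneq (qlength p) 0%N; first by rewrite e0.
  by rewrite (wcoef_v_degree _ (dh _ _ dp) p0) (wcoef_v_degree _ (dh' _ _ dp) p0).
apply: (@path_lin_ext k Q k^o (wcoef (src b) [:: b] \o h) (wcoef (src b) [:: b] \o h')) => p /=.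
have dp := @path_deg_vec k Q p.
have [/qlength1P[a ->]|/eqP p0] := eqVneq (qlength p) 1%N; first exact: e1.
by rewrite (wcoef_a_degree _ _ (dh _ _ dp) p0) (wcoef_a_degree _ _ (dh' _ _ dp) p0).
Qed.

Lemma realization_vpath (Q : quiver) (M : bialgebra_structure (path_coalgebra k Q))
    (f : {linear A -> path_coalgebra k Q}) v : realization M f ->
  exists z, f z = path_vec k (vpath v).
Proof.
move=> [_ _ rg]; have [|z _ ez] := rg (path_vec k (vpath v)) 0 _
  (subspace0 (@subspace_path_degree k Q 1)).
  exact: (@path_deg_vec k Q (vpath v)).
by exists z; rewrite ez addr0.
Qed.

Lemma realization_apath (Q : quiver) (M : bialgebra_structure (path_coalgebra k Q))
    (f : {linear A -> path_coalgebra k Q}) a : realization M f ->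
  exists z, f z = path_vec k (apath a).
Proof.
move=> [_ _ rg]; have [|z _ ez] := rg 0 (path_vec k (apath a))
  (subspace0 (@subspace_path_degree k Q 0)).
  exact: (@path_deg_vec k Q (apath a)).
by exists z; rewrite ez add0r.
Qed.

Section Compare.
Variables (Q Q' : quiver).
Local Notation kQ := (path_coalgebra k Q).
Local Notation kQ' := (path_coalgebra k Q').
Variables (M : bialgebra_structure kQ) (M' : bialgebra_structure kQ').
Variables (f : {linear A -> kQ}) (f' : {linear A -> kQ'}).
Hypothesis rf : realization M f.
Hypothesis rf' : realization M' f'.
Variables (F : {linear kQ -> kQ'}) (G : {linear kQ' -> kQ}).
Hypothesis hF : comparison f f' F.
Hypothesis hG : comparison f' f G.

(** On arrows, [F] and [G] agree with the transfer between the realizations up to corrections of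
    degree 0. These have no arrow coefficient, and only arrow coefficients are tested in degree
    1. *)
Lemma comparison_cancel : cancel F G.
Proof.
move=> x; apply: (path_map_unique_graded (h := G \o F)
  (h' := [the {linear kQ -> kQ} of idfun])) => //.
- apply: coalgebra_map_comp; [exact: comparison_comul hF|exact: comparison_comul hG].
- exact: coalgebra_map_id.
- by move=> n y /(comparison_deg hF) /(comparison_deg hG).
- move=> v /=; have [z ez] := realization_vpath v rf.
  have dz : path_degree 0 (f z) by rewrite ez; apply: (@path_deg_vec k Q (vpath v)).
  rewrite -ez (comparison0 hF) // (comparison0 hG) //.
  by rewrite -(comparison0 hF dz); apply: (comparison_deg hF).
move=> a b /=; have [z ez] := realization_apath a rf.
have dz : path_degree 1 (f z) by rewrite ez; apply: (@path_deg_vec k Q (apath a)).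
rewrite -ez; have [z0 dz0 e0] := comparison1 hF dz.
(* Absorbing the correction into the argument exhibits [F (f z)] in the image of [f'], so that
   [comparison1] applies to [G]. *)
have eF : F (f z) = f' (z - z0) by rewrite linearB e0 addrK.
have d1 : path_degree 1 (f' (z - z0)) by rewrite -eF; apply: (comparison_deg hF).
have [z1 dz1 e1] := comparison1 hG d1.
have dfz0 : path_degree 0 (f z0).
  by rewrite -(comparison0 hG dz0); apply: (comparison_deg hG).
have e2 : f z = G (f' (z - z0)) + f z1 + f z0 by rewrite -e1 linearB subrK.
rewrite eF [in RHS]e2 !linearD /=.
by rewrite (wcoef_a_degree _ _ dz1) // (wcoef_a_degree _ _ dfz0) // !addr0.
Qed.

Lemma comparison_counit x : counit kQ' (F x) = counit kQ x.
Proof.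
pose h : {linear kQ -> k^o} := counit_dual kQ' \o F.
suff: h x = counit_dual kQ x by rewrite /h /= !counit_dualE.
apply: (@path_lin_ext k Q k^o h (counit_dual kQ)) => p; rewrite /h /= !counit_dualE.
have dp := @path_deg_vec k Q p.
have [p0|] := eqVneq (qlength p) 0%N; last first.
  case: (qlength p) dp => [//|n] dp _.
  rewrite (counit_path_degree dp) (counit_path_degree (n := n)) //.
  exact: (comparison_deg hF).
rewrite p0 in dp; rewrite (qlength0P p0) in dp *.
have [z ez] := realization_vpath (qpath_val p).1 rf.
have [_ [_ _ _ cf] _] := rf; have [_ [_ _ _ cf'] _] := rf'.
by rewrite -ez in dp *; rewrite (comparison0 hF) // [LHS]cf' [RHS]cf.
Qed.

Hypothesis gM : graded_structure M.
Hypothesis gM' : graded_structure M'.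

(** Two coalgebra maps are compared; both preserve degrees because [M] and [M'] are graded, so pairs
    of paths of total length at most 1 suffice. There both sides transport the product of [A], and
    corrections multiplied by an element of degree 0 stay in degree 0, unseen by arrow
    coefficients. *)
Lemma comparison_mul x y : F (bmul M x y) = bmul M' (F x) (F y).
Proof.
pose h : {linear tens_coalgebra kQ kQ -> kQ'} := F \o mul_map M.
pose h' : {linear tens_coalgebra kQ kQ -> kQ'} := mul_map M' \o tensor_map F F.
have -> : F (bmul M x y) = h (x ⊗ y) by rewrite /h /= mul_map_pure.
have -> : bmul M' (F x) (F y) = h' (x ⊗ y).
  by rewrite /h' /= tensor_map_pure mul_map_pure.
have hF_comul := comparison_comul hF; have hF_deg := comparison_deg hF.
have [_ [mf0 _ _ _] _] := rf; have [_ [mf0' _ _ _] _] := rf'.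
have mf z w : f (mulb z w) = bmul M (f z) (f w) by apply: mf0.
have mf' z w : f' (mulb z w) = bmul M' (f' z) (f' w) by apply: mf0'.
have hdeg p q : path_degree (qlength p + qlength q)
    (F (bmul M (path_vec k p : kQ) (path_vec k q : kQ))).
  by apply: hF_deg; apply: gM.1; apply: path_deg_vec.
have h'deg p q : path_degree (qlength p + qlength q)
    (bmul M' (F (path_vec k p)) (F (path_vec k q))).
  by apply: gM'.1; apply: hF_deg; apply: path_deg_vec.
apply: path_map_unique.
- by apply: coalgebra_map_comp => //; apply: coalgebra_map_mul.
- by apply: coalgebra_map_comp; [apply: coalgebra_map_tensor|apply: coalgebra_map_mul].
- move=> v t; apply: (path_pair_ext (h := wcoef v [::] \o h) (h' := wcoef v [::] \o h')).
  move=> p q; rewrite /h /h' /= tensor_map_pure !mul_map_pure.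
  have [n0|/eqP n0] := eqVneq (qlength p + qlength q)%N 0%N; last first.
    by rewrite (wcoef_v_degree _ (hdeg p q) n0) (wcoef_v_degree _ (h'deg p q) n0).
  move/eqP: n0; rewrite addn_eq0 => /andP[/eqP/qlength0P -> /eqP/qlength0P ->].
  move: (qpath_val p).1 (qpath_val q).1 => {p q} p q.
  have [z ez] := realization_vpath p rf; have [w ew] := realization_vpath q rf.
  have dz : path_degree 0 (f z) by rewrite ez; apply: (@path_deg_vec k Q (vpath p)).
  have dw : path_degree 0 (f w) by rewrite ew; apply: (@path_deg_vec k Q (vpath q)).
  rewrite -ez -ew -mf !(comparison0 hF) // ?mf' //.
  by rewrite mf; apply: (gM.1 0%N 0%N).
move=> b t; apply: (path_pair_ext (h := wcoef (src b) [:: b] \o h)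
  (h' := wcoef (src b) [:: b] \o h')).
move=> p q; rewrite /h /h' /= tensor_map_pure !mul_map_pure.
have [n0|/eqP n0] := eqVneq (qlength p + qlength q)%N 1%N; last first.
  by rewrite (wcoef_a_degree _ _ (hdeg p q) n0) (wcoef_a_degree _ _ (h'deg p q) n0).
have dp := @path_deg_vec k Q p; have dq := @path_deg_vec k Q q.
have [[p0 q1]|[p1 q0]] : (qlength p = 0%N /\ qlength q = 1%N) \/
    (qlength p = 1%N /\ qlength q = 0%N).
- by case: (qlength p) (qlength q) n0 => [|[|//]] [|[|//]] //; [left|right].
- rewrite p0 in dp; rewrite q1 in dq.
  have [a ea] := qlength1P q1.
  have [w ew] := realization_apath a rf.
  have [z ez] := realization_vpath (qpath_val p).1 rf.
  rewrite -ea in ew; rewrite -(qlength0P p0) in ez.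
  rewrite -ez in dp *; rewrite -ew in dq *.
  have dzw : path_degree 1 (f (mulb z w)) by rewrite mf; apply: (gM.1 0%N 1%N).
  have [w0 dw0 e0] := comparison1 hF dq; have [u0 du0 e1] := comparison1 hF dzw.
  have eFw : F (f w) = f' w - f' w0 by rewrite e0 addrK.
  have eFzw : F (f (mulb z w)) = f' (mulb z w) - f' u0 by rewrite e1 addrK.
  rewrite -mf eFzw eFw (comparison0 hF) // linearBr -!mf' !linearB /=.
  rewrite (wcoef_a_degree _ _ du0) // [X in _ = _ - X](wcoef_a_degree (n := 0%N)) //.
  rewrite mf'; apply: (gM'.1 0%N 0%N) => //.
  by rewrite -(comparison0 hF dp); apply: hF_deg.
rewrite p1 in dp; rewrite q0 in dq.
have [a ea] := qlength1P p1.
have [z ez] := realization_apath a rf.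
have [w ew] := realization_vpath (qpath_val q).1 rf.
rewrite -ea in ez; rewrite -(qlength0P q0) in ew.
rewrite -ez in dp *; rewrite -ew in dq *.
have dzw : path_degree 1 (f (mulb z w)) by rewrite mf; apply: (gM.1 1%N 0%N).
have [z0 dz0 e0] := comparison1 hF dp; have [u0 du0 e1] := comparison1 hF dzw.
have eFz : F (f z) = f' z - f' z0 by rewrite e0 addrK.
have eFzw : F (f (mulb z w)) = f' (mulb z w) - f' u0 by rewrite e1 addrK.
rewrite -mf eFzw eFz (comparison0 hF dq) linearBl -!mf' !linearB /=.
rewrite (wcoef_a_degree _ _ du0) // [X in _ = _ - X](wcoef_a_degree (n := 0%N)) //.
rewrite mf'; apply: (gM'.1 0%N 0%N) => //.
by rewrite -(comparison0 hF dq); apply: hF_deg.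
Qed.

Lemma comparison_morphism :
  bialgebra_morphism (A := Bialgebra M) (B := Bialgebra M') F.
Proof.
have [_ [_ of_ _ _] _] := rf; have [_ [_ of' _ _] _] := rf'.
split.
- exact: comparison_mul.
- rewrite -of_ (comparison0 hF) ?of' // of_; exact: gM.2.
- exact: comparison_comul hF.
- exact: comparison_counit.
Qed.

End Compare.
End Uniqueness.

(** * From isomorphic path coalgebras to isomorphic quivers *)

Section QuiverIso.
Variables (k : fieldType).

Definition arrow_set (Q : quiver) (v w : vertex Q) : set (arrow Q) :=
  [set a | src a = v /\ tgt a = w].

(** [F] sends the arrows from [v] to [w] to vectors supported on the arrows from [sg v] to [sg w],
    since the skew-primitive equation fixes the ends, and [G] shows that these vectors are
    independent. [independent_le_coordinates] then gives an injection, for infinite sets as well. *)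
Lemma arrow_set_card_le (Q Q' : quiver)
    (F : {linear path_coalgebra k Q -> path_coalgebra k Q'})
    (G : {linear path_coalgebra k Q' -> path_coalgebra k Q})
    (sg : vertex Q -> vertex Q') v w :
  coalgebra_map F -> (forall n x, path_degree n x -> path_degree n (F x)) ->
  cancel F G ->
  (forall v, F (path_vec k (vpath v)) = path_vec k (vpath (sg v))) ->
  (arrow_set v w #<= arrow_set (sg v) (sg w))%card.
Proof.
move=> F_comul F_deg FK hsg.
have coef a b : wcoef (src b) [:: b] (F (path_vec k (apath a))) <> 0 ->
    src b = sg (src a) /\ tgt b = sg (tgt a).
  move=> nz; set y := F _ in nz.
  have dy : comul (path_coalgebra k Q') y = path_vec k (vpath (sg (tgt a))) ⊗ y +
      y ⊗ path_vec k (vpath (sg (src a))).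
    rewrite /y F_comul comul_apath (tlinD (tens_map F F)) /= !tens_map_pure !hsg.
    exact: addrC.
  split; apply: contrapT => ne; apply: nz.
    have := conv_wcoef (src b) [:: b] (src b) [::] y.
    rewrite /= eqxx mul1r => <-; rewrite convEl actlE dy tlinD !lfst_pure.
    rewrite linearD !linearZ /= !wcoef_vpath andbF scale0r add0r andbT.
    by case: eqP => [e|_]; [case: ne|apply: mulr0].
  have := conv_wcoef (tgt b) [::] (src b) [:: b] y.
  rewrite /= eqxx mul1r => <-; rewrite convEl actlE dy tlinD !lfst_pure.
  rewrite linearD !linearZ /= !wcoef_vpath andbF scaler0 addr0 andbT.
  by case: eqP => [e|_]; [case: ne|rewrite scale0r].
pose I : choiceType := arrow_set v w; pose J : choiceType := arrow_set (sg v) (sg w).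
pose vI (i : I) : path_coalgebra k Q' := F (path_vec k (apath (val i))).
pose eJ (j : J) : {linear path_coalgebra k Q' -> k^o} := wcoef (src (val j)) [:: val j].
have IP (i : I) : src (val i) = v /\ tgt (val i) = w by apply: set_mem (valP i).
pose Y : set (path_coalgebra k Q') := [set y | forall p, pcoef p y <> 0 ->
  exists j : J, p = apath (val j)].
have sY : subspace Y.
  split=> [p|a x y hx hy p]; first by rewrite linear0.
  rewrite linearP => nz; have [/hx //|/contrapT x0] := pselect (pcoef p x <> 0).
  by apply: hy => y0; apply: nz; rewrite /= x0 y0 addr0; apply: mulr0.
have [||||g injg] := @independent_le_coordinates k _ I J vI eJ Y _ sY.
- move=> i hi.
  have : pcoef (apath (val i)) (G (vI i)) = 0.
    apply: (span_min (D := (pcoef (apath (val i)) \o G) @^-1` [set 0])) hi.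
      exact: (subspace_preimage (pcoef (apath (val i)) \o G) (subspace_zero _)).
    move=> _ [i' ii' <-]; rewrite /preimage /= /vI FK pcoef_vec.
    by case: eqP => // /apath_inj/val_inj.
  by rewrite /vI FK pcoef_vec eqxx => /eqP; rewrite oner_eq0.
- move=> i p nz.
  have dF := F_deg _ _ (@path_deg_vec k Q (apath (val i))).
  have [p1|p1] := pselect (qlength p = 1%N); last first.
    by case: nz; have /path_degreeP -> := dF.
  have [b eb] := qlength1P p1; rewrite eb -wcoef_path in nz.
  have [sb tb] := coef _ _ nz; have [si ti] := IP i.
  have Jb : b \in arrow_set (sg v) (sg w) 
    by apply: mem_set; split; [exact: etrans sb (congr1 sg si)|exact: etrans tb (congr1 sg ti)].
  by exists (exist _ b Jb).
- move=> y hy ey; apply: pcoef_eq0 => p; apply: contrapT => nz.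
  have [j ej] := hy p nz; apply: nz.
  by rewrite ej -wcoef_path; apply: ey.
- move=> y _; have [s hs] := wcoef_finite_a y.
  exists (pmap insub s) => j /hs js; by rewrite mem_pmap_sub.
exact: injective_card_le injg.
Qed.

Lemma quiver_iso_of_cards (Q Q' : quiver) (sg : vertex Q -> vertex Q') :
  bijective sg ->
  (forall v w, (arrow_set v w #= arrow_set (sg v) (sg w))%card) ->
  quiver_isomorphic Q Q'.
Proof.
move=> bsg card; have [tu sgK tuK] := bsg.
(* Bijections between sets of arrows with given ends have types depending on the ends; option-valued
   maps on all arrows let one choice function serve every pair of vertices. *)
have ex (vw : vertex Q * vertex Q) : exists h :
    (arrow Q -> option (arrow Q')) * (arrow Q' -> option (arrow Q)),
    (forall a, arrow_set vw.1 vw.2 a -> exists b,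
       [/\ arrow_set (sg vw.1) (sg vw.2) b, h.1 a = Some b & h.2 b = Some a]) /\
    (forall b, arrow_set (sg vw.1) (sg vw.2) b -> exists a,
       [/\ arrow_set vw.1 vw.2 a, h.1 a = Some b & h.2 b = Some a]).
  have /card_bijP[p [q pK qK]] := card vw.1 vw.2.
  exists (fun a => omap (fun x => val (p x)) (insub a),
          fun b => omap (fun y => val (q y)) (insub b)); split=> [a /mem_set Aa|b /mem_set Bb].
    exists (val (p (Sub a Aa))); split; first exact: set_mem (valP (p _)).
      by rewrite /= insubT.
    by rewrite /= valK /= pK SubK.
  exists (val (q (Sub b Bb))); split; first exact: set_mem (valP (q _)).
    by rewrite /= valK /= qK SubK.
  by rewrite /= insubT.
have /choice[h hh] := ex.
have /choice[f1 f1P] : forall a, exists b, [/\ arrow_set (sg (src a)) (sg (tgt a)) b,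
    (h (src a, tgt a)).1 a = Some b & (h (src a, tgt a)).2 b = Some a].
  by move=> a; have [h1 _] := hh (src a, tgt a); apply: h1.
have /choice[g1 g1P] : forall b, exists a,
    [/\ arrow_set (tu (src b)) (tu (tgt b)) a,
        (h (tu (src b), tu (tgt b))).1 a = Some b &
        (h (tu (src b), tu (tgt b))).2 b = Some a].
  move=> b; have [_ h2] := hh (tu (src b), tu (tgt b)).
  by apply: h2; split; rewrite /= tuK.
exists sg, f1; split=> // [|a|a]; [|by have [[]] := f1P a|by have [[]] := f1P a].
exists g1 => [a|b].
  have [[s1 t1] _ e1] := f1P a; have [_ _] := g1P (f1 a).
  by rewrite s1 t1 !sgK e1 => -[].
have [[s1 t1] e1 _] := g1P b; have [_ + _] := f1P (g1 b).
by rewrite s1 t1 e1 => -[].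
Qed.

End QuiverIso.

Theorem realization_unique (k : fieldType) (A : bialgebra k) (Q Q' : quiver)
    (M : bialgebra_structure (path_coalgebra k Q))
    (M' : bialgebra_structure (path_coalgebra k Q'))
    (f : {linear A -> path_coalgebra k Q}) (f' : {linear A -> path_coalgebra k Q'}) :
  graded_structure M -> realization M f ->
  graded_structure M' -> realization M' f' ->
  quiver_isomorphic Q Q' /\ graded_bialgebra_isomorphic M M'.
Proof.
move=> gM rf gM' rf'.
have [F hF] := ex_comparison rf rf'; have [G hG] := ex_comparison rf' rf.
have FK := comparison_cancel rf hF hG; have GK := comparison_cancel rf' hG hF.
split; last first.
  exists F; split; [by exists G|exact: comparison_morphism hF gM gM'|].
  exact: comparison_deg hF.
have ex_vertex (R R' : quiver) (N : bialgebra_structure (path_coalgebra k R))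
    (N' : bialgebra_structure (path_coalgebra k R'))
    (g : {linear A -> path_coalgebra k R}) (g' : {linear A -> path_coalgebra k R'})
    (H : {linear path_coalgebra k R -> path_coalgebra k R'}) :
    realization N g -> realization N' g' -> comparison g g' H ->
    exists s : vertex R -> vertex R', forall v,
      H (path_vec k (vpath v)) = path_vec k (vpath (s v)).
  move=> rg rg' hH.
  have /choice[s hs] : forall v, exists w, H (path_vec k (vpath v)) = path_vec k (vpath w).
    move=> v; apply: grouplike_path; have [dv ev] := grouplike_vpath k v; split.
      by rewrite (comparison_comul hH) dv tens_map_pure.
    by rewrite (comparison_counit rg rg' hH).
  by exists s.
have [sg hsg] := ex_vertex _ _ _ _ _ _ _ rf rf' hF.
have [tu htu] := ex_vertex _ _ _ _ _ _ _ rf' rf hG.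
have sgK : cancel sg tu.
  move=> v; apply: (@vpath_inj Q); apply: (@path_vec_inj k Q).
  by rewrite -htu -hsg FK.
have tuK : cancel tu sg.
  move=> v; apply: (@vpath_inj Q'); apply: (@path_vec_inj k Q').
  by rewrite -hsg -htu GK.
apply: (quiver_iso_of_cards (sg := sg)); first by exists tu.
(* [F] gives one injection and [G] the other, after writing [v] and [w] as images under [tu]. *)
move=> v w; apply: Cantor_Bernstein.
  exact: (arrow_set_card_le _ _ (comparison_comul hF) (comparison_deg hF) FK hsg).
rewrite -[X in (_ #<= arrow_set X _)%card](sgK v).
rewrite -[X in (_ #<= arrow_set _ X)%card](sgK w).
exact: (arrow_set_card_le _ _ (comparison_comul hG) (comparison_deg hG) GK htu).
Qed.

(** The identity is a comparison of [f] with itself, with zero correction, so [comparison_mul]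
    identifies the two products. *)
Theorem realization_structure_unique (k : fieldType) (A : bialgebra k) (Q : quiver)
    (M M' : bialgebra_structure (path_coalgebra k Q))
    (f : {linear A -> path_coalgebra k Q}) :
  graded_structure M -> realization M f ->
  graded_structure M' -> realization M' f ->
  (forall x y, bmul M x y = bmul M' x y) /\ bone M = bone M'.
Proof.
move=> gM rf gM' rf'; split.
  have hI : comparison f f [the {linear path_coalgebra k Q -> path_coalgebra k Q} of idfun].
    split=> // [|z hz]; first exact: coalgebra_map_id.
    exists 0; rewrite !linear0 ?addr0 //.
    exact: (subspace0 (@subspace_path_degree k Q 0)).
  by move=> x y; apply: (comparison_mul rf rf' hI gM gM').
have [_ [_ e _ _] _] := rf; have [_ [_ e' _ _] _] := rf'.
by rewrite -[LHS]e -[RHS]e'.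
Qed.

(* [A] is [gr B].  The quiver and the graded structure are unique up to
   isomorphism; once the embedding of [gr B] into the path coalgebra is fixed,
   the graded structure is unique on the nose. *)
Theorem proposition3p3 (k : fieldType) (B : bialgebra k) (hB : pointed B)
    (A : bialgebra k) (gr : nat -> set A) (sym : nat -> B -> A)
    (hA : is_associated_graded B A gr sym) :
  (exists (Q : quiver) (M : bialgebra_structure (path_coalgebra k Q))
          (f : {linear A -> path_coalgebra k Q}),
     graded_structure M /\ realization M f)
  /\
  (forall (Q Q' : quiver)
          (M : bialgebra_structure (path_coalgebra k Q))
          (M' : bialgebra_structure (path_coalgebra k Q'))
          (f : {linear A -> path_coalgebra k Q})
          (f' : {linear A -> path_coalgebra k Q'}),
     graded_structure M -> realization M f ->
     graded_structure M' -> realization M' f' ->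
     quiver_isomorphic Q Q' /\ graded_bialgebra_isomorphic M M')
  /\
  (forall (Q : quiver) (M M' : bialgebra_structure (path_coalgebra k Q))
          (f : {linear A -> path_coalgebra k Q}),
     graded_structure M -> realization M f ->
     graded_structure M' -> realization M' f ->
     (forall x y, bmul M x y = bmul M' x y) /\ bone M = bone M').

Proof.
have hP := associated_graded_pointed hB hA.
split; first exact: ex_realization hP.
split=> [Q Q' M M' f f' gM rf gM' rf'|Q M M' f gM rf gM' rf'].
  exact: (realization_unique gM rf gM' rf').
exact: (realization_structure_unique gM rf gM' rf').
Qed.
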